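(* Let $d\ge 1$ and let $b\in C^1_\sharp(Y_d)^d$ be such that there exists an a.e. positive function $\sigma_0\in L^1_\sharp(Y_d)$ with $\int_{Y_d}\sigma_0(y)\,dy=1$, satisfying $\operatorname{div}(\sigma_0\,b)=0$ in $\mathbb{R}^d$ (in the sense of distributions). Then the flow $X$ associated with $b$ satisfies, for any $\zeta\in\mathbb{R}^d$, $$\mathsf{D}_b=\{\zeta\}\quad\Longleftrightarrow\quad \lim_{t\to\infty}\frac{X(t,x)}{t}=\zeta\ \text{ for a.e. } x\in Y_d .$$
   Context: $Y_d=\mathbb{R}^d/\mathbb{Z}^d$ is the $d$-dimensional torus, identified with $[0,1)^d$. $C^k_\sharp(Y_d)$ denotes the $\mathbb{Z}^d$-periodic real-valued functions in $C^k(\mathbb{R}^d)$, and $L^1_\sharp(Y_d)$ the functions in $L^1_{\rm loc}(\mathbb{R}^d)$ that are $\mathbb{Z}^d$-periodic a.e. ''a.e.'' without further mention refers to Lebesgue measure. For $b\in C^1_\sharp(Y_d)^d$, the flow $X:\mathbb{R}\times\mathbb{R}^d\to\mathbb{R}^d$ is the unique solution to $\partial_tX(t,x)=b(X(t,x))$, $t\in\mathbb{R}$, $X(0,x)=x$. It satisfies $X(t,x+k)=X(t,x)+k$ for $k\in\mathbb{Z}^d$, so it is well defined on the torus. A Borel measure $\mu$ on $Y_d$ is invariant for the flow $X$ if $\int_{Y_d}\psi(X(t,y))\,d\mu(y)=\int_{Y_d}\psi(y)\,d\mu(y)$ for all $t\in\mathbb{R}$ and all $\psi\in C^0_\sharp(Y_d)$.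 $\mathscr{I}_b$ is the set of probability measures on $Y_d$ that are invariant for $X$. The set $\mathsf{D}_b\subset\mathbb{R}^d$ is $$\mathsf{D}_b:=\Big\{\int_{Y_d}b(y)\,\sigma(y)\,dy:\ \sigma\in L^1_\sharp(Y_d)\text{ and }\sigma(y)\,dy\in\mathscr{I}_b\Big\}.$$ *)

(* Defs.v *)
From HB Require Import structures.
From mathcomp Require Import all_boot all_order all_algebra.
From mathcomp Require Import all_classical all_reals all_analysis.

Set Implicit Arguments.
Unset Strict Implicit.
Unset Printing Implicit Defensive.

Import Order.TTheory GRing.Theory Num.Theory.
Import numFieldTopology.Exports numFieldNormedType.Exports.

Local Open Scope classical_set_scope.
Local Open Scope ring_scope.

Definition borel_rV_display : measure_display.
Proof. exact. Qed.

Section borel_rV.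
Context {R : realType} {n : nat}.

Let borel : set (set 'rV[R]_n) := <<s @open 'rV[R]_n >>.

Let borel0 : borel set0.
Proof. exact: sigma_algebra0. Qed.

Let borelC A : borel A -> borel (~` A).
Proof. exact: sigma_algebraC. Qed.

Let borel_bigcup (F : (set 'rV[R]_n)^nat) :
  (forall i, borel (F i)) -> borel (\bigcup_i (F i)).
Proof. exact: sigma_algebra_bigcup. Qed.

HB.instance Definition _ := @isMeasurable.Build borel_rV_display 'rV[R]_n
  borel borel0 borelC borel_bigcup.

Lemma open_measurable_rV (A : set 'rV[R]_n) : open A -> measurable A.
Proof. exact: sub_gen_smallest. Qed.

Lemma measurable_coord_rV (i : 'I_n) :
  measurable_fun [set: 'rV[R]_n] (fun x => x ord0 i : measurableTypeR R).
Proof.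
apply: (measurability _ (measurable_realfun.RGenOpens.measurableE R)) => _ [_ [a [b ->]] <-].
rewrite setTI; apply: open_measurable_rV.
apply: open_comp; last exact: interval_open.
by move=> x _; exact: coord_continuous.
Qed.

Lemma measurable_fun_rV d (T : measurableType d) (f : T -> 'rV[R]_n) :
  (forall i, measurable_fun [set: T] (fun x => f x ord0 i : measurableTypeR R)) ->
  measurable_fun [set: T] f.
Proof.
move=> mf; apply: (@measurability _ _ _ _ _ _ (@open 'rV[R]_n)) => // _ [U oU <-].
rewrite setTI.
pose B (p : 'rV[rat]_n * nat) : set 'rV[R]_n :=
  [set x | forall i, `|ratr (p.1 ord0 i) - x ord0 i| < p.2.+1%:R^-1].
have -> : U = \bigcup_(p in [set p | B p `<=` U]) B p.
  apply/seteqP; split => [x Ux|x [p pU Bx]]; last exact: pU.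
  have /nbhs_ballP[e /= e0 eU] : nbhs x U by exact: open_nbhs_nbhs.
  have [k ke] : exists k : nat, k.+1%:R^-1 < e / 2.
    by have [k] := @ltr_add_invr R 0 (e / 2) (divr_gt0 e0 (@ltr0Sn R 1)); rewrite add0r; exists k.
  have q_ i : exists q : rat, `|ratr q - x ord0 i| < k.+1%:R^-1.
    have h : x ord0 i - k.+1%:R^-1 < x ord0 i + k.+1%:R^-1.
      by rewrite ltrBlDr -addrA ltrDl addr_gt0.
    have [q] := rat_in_itvoo h.
    rewrite in_itv/= => /andP[q1 q2]; exists q.
    by rewrite distrC ltr_distlC q1 q2.
  have [q Hq] := choice q_.
  exists (\row_i q i, k) => [y/= By|i /=]; last by rewrite mxE.
  apply: eU; split => // j i; rewrite ord1.
  rewrite /ball /=; have := By i; rewrite mxE => yq.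
  rewrite -(subrK (ratr (q i)) (x ord0 i)) -addrA.
  rewrite (le_lt_trans (ler_normD _ _))// (splitr e) ltrD//.
    by rewrite distrC (lt_trans (Hq i)).
  exact: lt_trans ke.
rewrite preimage_bigcup.
rewrite bigcup_mkcond.
apply: countable_bigcupT_measurable => [|p]; first exact: countableP.
case: ifPn => // _.
have -> : f @^-1` B p =
    \bigcap_(i in [set: 'I_n]) ((fun x => f x ord0 i) @^-1`
      [set y | `|ratr (p.1 ord0 i) - y| < p.2.+1%:R^-1]).
  by apply/seteqP; split => [x Bx i _|x Bx i]; exact: Bx.
apply: fin_bigcap_measurable => // i _.
rewrite -[X in measurable X]setTI; apply: mf => //.
apply: (@measurable_realfun.open_measurable R).
have -> : [set y | `|ratr (p.1 ord0 i) - y| < p.2.+1%:R^-1] =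
   ball (ratr (p.1 ord0 i) : R) p.2.+1%:R^-1 by [].
exact: ball_open.
Qed.

End borel_rV.

Section row_cons.
Context {R : realType} {n : nat}.

(* 'rV[R]_n.+1 is convertible to 'rV[R]_(1 + n). *)
Definition row_cons (p : measurableTypeR R * 'rV[R]_n) : 'rV[R]_n.+1 :=
  row_mx (p.1 : R)%:M p.2.

Definition row_uncons (x : 'rV[R]_n.+1) : measurableTypeR R * 'rV[R]_n :=
  (x ord0 ord0, rsubmx (x : 'rV[R]_(1 + n))).

Lemma row_cons0 p : row_cons p ord0 ord0 = p.1.
Proof.
have -> : ord0 = lshift n ord0 :> 'I_(1 + n) by exact/val_inj.
by rewrite [LHS]row_mxEl mxE eqxx mulr1n.
Qed.

Lemma row_consS p i : row_cons p ord0 (lift ord0 i) = p.2 ord0 i.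
Proof.
have -> : lift ord0 i = rshift 1 i :> 'I_(1 + n) by exact/val_inj.
exact: row_mxEr.
Qed.

Lemma row_consK : cancel row_cons row_uncons.
Proof. by move=> [x v]; rewrite /row_uncons row_cons0 row_mxKr. Qed.

Lemma measurable_row_cons :
  measurable_fun [set: measurableTypeR R * 'rV[R]_n] row_cons.
Proof.
apply: measurable_fun_rV => i; case: (unliftP ord0 i) => [j|] ->.
- under eq_fun do rewrite row_consS.
  exact: (measurableT_comp (measurable_coord_rV j) measurable_snd).
- under eq_fun do rewrite row_cons0.
  exact: measurable_fst.
Qed.

Lemma measurable_row_uncons : measurable_fun [set: 'rV[R]_n.+1] row_uncons.
Proof.
apply: measurable_fun_pair; first exact: measurable_coord_rV.
apply: measurable_fun_rV => i.
under eq_fun do rewrite mxE.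
exact: measurable_coord_rV.
Qed.

Variable m : {sigma_finite_measure set (measurableTypeR R) -> \bar R}.
Variable mu : {sigma_finite_measure set 'rV[R]_n -> \bar R}.

Definition row_cons_measure : set 'rV[R]_n.+1 -> \bar R :=
  pushforward (m \x mu)%E row_cons.

Let row_cons_measure0 : row_cons_measure set0 = 0%E.
Proof. by rewrite /row_cons_measure /pushforward preimage_set0 measure0. Qed.

Let row_cons_measure_ge0 A : (0 <= row_cons_measure A)%E.
Proof. by rewrite /row_cons_measure /pushforward measure_ge0. Qed.

Let row_cons_measure_sigma_additive : semi_sigma_additive row_cons_measure.
Proof.
move=> F mF tF mUF; rewrite /row_cons_measure /pushforward preimage_bigcup.
have mpre A : measurable A -> measurable (row_cons @^-1` A).
  by move=> mA; rewrite -[X in measurable X]setTI; exact: measurable_row_cons.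
apply: measure_semi_sigma_additive => [n'||]; first exact: mpre.
- by move=> i j _ _ [x [Fi Fj]]; apply: (tF i j) => //; exists (row_cons x).
- by rewrite -preimage_bigcup; exact: mpre.
Qed.

HB.instance Definition _ := isMeasure.Build _ _ _ row_cons_measure
  row_cons_measure0 row_cons_measure_ge0 row_cons_measure_sigma_additive.

Let sigma_finite_row_cons_measure : sigma_finite [set: 'rV[R]_n.+1] row_cons_measure.
Proof.
have /sigma_finiteP[F [TF ndF Foo]] := sigma_finiteT m.
have /sigma_finiteP[G [TG ndG Goo]] := sigma_finiteT mu.
exists (fun i => row_uncons @^-1` (F i `*` G i)).
  rewrite -preimage_bigcup (_ : \bigcup_i (F i `*` G i) = setT) ?preimage_setT//.
  apply/seteqP; split => // -[x y] _.
  have [i _ Fix] : (\bigcup_i F i) x by rewrite -TF.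
  have [j _ Gjy] : (\bigcup_i G i) y by rewrite -TG.
  exists (maxn i j) => //; split => /=.
  - by move: x Fix; exact/subsetPset/ndF/leq_maxl.
  - by move: y Gjy; exact/subsetPset/ndG/leq_maxr.
move=> i; have [mF Fi] := Foo i; have [mG Gi] := Goo i.
have mFG : measurable (F i `*` G i) by exact: measurableX.
split; first by rewrite -[X in measurable X]setTI; exact: measurable_row_uncons.
rewrite /row_cons_measure /pushforward -comp_preimage.
rewrite (_ : row_uncons \o row_cons = id); last first.
  by apply/funext => p; exact: row_consK.
rewrite preimage_id product_measure1E//.
by rewrite lte_mul_pinfty// ge0_fin_numE.
Qed.

HB.instance Definition _ :=
  Measure_isSigmaFinite.Build _ _ _ row_cons_measure sigma_finite_row_cons_measure.

End row_cons.

Fixpoint lebesgue_rV {R : realType} (n : nat) :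
    {sigma_finite_measure set 'rV[R]_n -> \bar R} :=
  match n with
  | 0%N => \d_(0 : 'rV[R]_0)
  | n'.+1 => row_cons_measure (@lebesgue_measure R) (lebesgue_rV n')
  end.

Lemma lebesgue_rV_box (R : realType) (n : nat) (a b : 'rV[R]_n) :
  (forall i, a ord0 i <= b ord0 i) ->
  lebesgue_rV n [set x | forall i, a ord0 i <= x ord0 i < b ord0 i] =
  (\prod_(i < n) (b ord0 i - a ord0 i))%:E.
Proof.
elim: n a b => [|n ih] a b ab.
  rewrite big_ord0 /= diracE mem_set//.
  by case.
rewrite /= /row_cons_measure /pushforward.
pose a' := rsubmx (a : 'rV_(1 + n)); pose b' := rsubmx (b : 'rV_(1 + n)).
have rsubE (x : 'rV[R]_(1 + n)) i : rsubmx x ord0 i = x ord0 (lift ord0 i).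
  by rewrite mxE; congr (x _ _); exact/val_inj.
have -> : row_cons @^-1` [set x | forall i, a ord0 i <= x ord0 i < b ord0 i] =
    `[a ord0 ord0, b ord0 ord0[%classic `*`
    [set x : 'rV[R]_n | forall i, a' ord0 i <= x ord0 i < b' ord0 i].
  apply/seteqP; split => [[x v] /= xv|[x v] /= [xab vab] i].
    split=> [|i]; first by have := xv ord0; rewrite row_cons0 in_itv.
    by have := xv (lift ord0 i); rewrite row_consS !rsubE.
  case: (unliftP ord0 i) => [j|] ->; last by rewrite row_cons0; move: xab; rewrite in_itv.
  by rewrite row_consS; have := vab j; rewrite !rsubE.
rewrite product_measure1E//; last first.
  have -> : [set x : 'rV[R]_n | forall i, a' ord0 i <= x ord0 i < b' ord0 i] =
     \bigcap_(i in [set: 'I_n])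
       ((fun x : 'rV[R]_n => x ord0 i) @^-1` `[a' ord0 i, b' ord0 i[%classic).
    apply/seteqP; split => [x h i _ /=|x h i]; first by rewrite in_itv/= h.
    by have := h i I; rewrite /= in_itv.
  apply: fin_bigcap_measurable => // i _.
  by rewrite -[X in measurable X]setTI; exact: measurable_coord_rV.
rewrite ih; last by move=> i; rewrite !rsubE.
rewrite [X in (X * _)%E](lebesgue_measure_itv `[a ord0 ord0, b ord0 ord0[).
rewrite /= lte_fin big_ord_recl.
under eq_bigr do rewrite !rsubE.
have [ab0|] := ltP (a ord0 ord0) (b ord0 ord0); first by rewrite EFinM EFinB.
move=> /(conj (ab ord0)) /andP /le_anti ->.
by rewrite subrr mul0r mul0e.
Qed.

Section regularity.
Context {R : realType}.

(* By linearity of the differential, all directional derivatives being C^k' is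
   the same as the differential being C^k' (V is used finite-dimensional). *)
Fixpoint Ck {V W : normedModType R} (k : nat) (f : V -> W) : Prop :=
  match k with
  | 0%N => continuous f
  | k'.+1 => (forall x, differentiable f x) /\
             (forall v, Ck k' (fun x => 'D_v f x))
  end.

Definition smooth {V W : normedModType R} (f : V -> W) : Prop :=
  forall k, Ck k f.

End regularity.

Section torus.
Context {R : realType} {d : nat}.
Local Notation Rd := 'rV[R]_d.
Local Notation leb := (lebesgue_rV d).

(* [0, 1)^d, which represents the torus *)
Definition Yd : set Rd := [set y | forall i, 0 <= y ord0 i < 1].

Definition Zd_periodic {T : Type} (f : Rd -> T) : Prop :=
  forall (k : 'rV[int]_d) (x : Rd), f (x + map_mx intr k) = f x.

Definition Ck_sharp {W : normedModType R} (k : nat) (f : Rd -> W) : Prop :=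
  Ck k f /\ Zd_periodic f.

(* Classes of L^1_loc functions are handled through Borel representatives. *)
Definition L1_sharp (f : Rd -> R) : Prop :=
  [/\ measurable_fun [set: Rd] f,
      forall K : set Rd, compact K -> leb.-integrable K (EFin \o f) &
      forall k : 'rV[int]_d, {ae leb, forall x, f (x + map_mx intr k) = f x}].

Definition partial (i : 'I_d) (phi : Rd -> R) (x : Rd) : R :=
  'D_(delta_mx ord0 i) phi x.

(* div F = 0 in the sense of distributions on R^d *)
Definition distr_div_free (F : Rd -> Rd) : Prop :=
  forall phi : Rd -> R, smooth phi -> compact (closure [set x | phi x != 0]) ->
  (\int[leb]_x (\sum_(i < d) F x ord0 i * partial i phi x)%:E = 0)%E.

Definition is_flow (b : Rd -> Rd) (X : R -> Rd -> Rd) : Prop :=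
  forall x, X 0 x = x /\
    forall t : R, is_derive t 1 (fun s : R => X s x) (b (X t x)).

(* Borel measures on the torus are Borel measures on R^d concentrated on Yd. *)
Definition invariant_measure (X : R -> Rd -> Rd)
    (mu : {measure set Rd -> \bar R}) : Prop :=
  forall (t : R) (psi : Rd -> R), Ck_sharp 0 psi ->
  (\int[mu]_(y in Yd) (psi (X t y))%:E = \int[mu]_(y in Yd) (psi y)%:E)%E.

Definition invariant_probabilities (X : R -> Rd -> Rd) :
    set (probability Rd R) :=
  [set mu : probability Rd R | mu Yd = 1%E /\ invariant_measure X mu].

(* mu is sigma(y)dy as a measure on the torus *)
Definition has_density (mu : {measure set Rd -> \bar R}) (sigma : Rd -> R) :=
  forall A : set Rd, measurable A ->
  (mu A = \int[leb]_(y in A `&` Yd) (sigma y)%:E)%E.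

Definition Db (b : Rd -> Rd) (X : R -> Rd -> Rd) : set Rd :=
  [set z | exists sigma : Rd -> R, [/\ L1_sharp sigma,
     exists2 mu : probability Rd R, invariant_probabilities X mu & has_density mu sigma &
     z = \row_(i < d) Rintegral leb Yd (fun y => b y ord0 i * sigma y)]].

End torus.

(* Main.v *)
Require Import Defs.
From HB Require Import structures.
From mathcomp Require Import all_boot all_order all_algebra.
From mathcomp Require Import all_classical all_reals all_analysis.
From mathcomp Require Import measurable_realfun.
From mathcomp Require Import ring lra.
Set Implicit Arguments.
Unset Strict Implicit.
Unset Printing Implicit Defensive.
Import Order.TTheory GRing.Theory Num.Theory.
Import numFieldTopology.Exports numFieldNormedType.Exports.
Local Open Scope classical_set_scope.
Local Open Scope ring_scope.

(* The measure nu = sigma0 dx is invariant under the flow (Liouville), although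
   div (sigma0 b) = 0 is only known against smooth test functions and the flow
   of a C^1 field is only C^1: psi o X_t is replaced by a smooth function whose
   gradient is uniformly close to that of psi o X_t, so that the derivative of
   t |-> int psi(X_t) dnu vanishes.  Hence the restriction P of nu to the torus
   is an invariant probability measure.  For an invariant periodic set A with
   P A > 0, the conditional measure P(. | A) has a density and is invariant, so
   it yields a point z of Db with
     P(A) z = int_A (X_1(x) - x) dP,
   because the mean displacement at time 1 is the mean of b.

   If Db = {zeta}, take for A the set of the x for which
   a (X_n(x))_i - n (a zeta_i + eps), with a = 1 or -1, is unbounded above in n.
   Garsia's maximal ergodic inequality gives
   int_A (a (X_1(x) - x)_i - a zeta_i - eps) dP >= 0, that is
   P(A) (a zeta_i - a zeta_i - eps) >= 0, whence P A = 0; as sigma0 > 0 a.e.,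
   A is Lebesgue-null, and outside the union of these sets X_t(x) / t tends to
   zeta.  Conversely Db is not empty, and by dominated convergence the average
   displacement X_n(y) - y over n, whose mean is int b dmu for every n, has mean
   zeta for every absolutely continuous invariant mu. *)

(** * Smooth steps *)

(** With f = psi o X_t, the increment of t |-> int psi(X_t) dnu over a time s is the integral of f o
    X_s - f. Its first-order part s b.grad f only has to be compared with s b.grad phi, which
    integrates to zero; so grad phi must be uniformly close to grad f, on a ball that does not grow
    as the error shrinks. The gradient of f is never formed: difference quotients of step r, with a
    remainder uniform in the point, are all that Gronwall's inequality has to deliver, and a finite
    sum of tensor-product bumps turns them into a smooth phi without any integration. Liouville's
    theorem is proved on the whole space, where test functions have compact support; since X_t does
    not map the unit cube to itself, invariance on the torus is expressed through periodic sets. The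
    set A is defined by unboundedness in order to be exactly periodic and invariant, so that
    conditioning P on it keeps both the invariance and a density. The slack eps makes the mean over
    A of the time-one drift strictly negative, against Garsia's inequality; no pointwise ergodic
    theorem is invoked. *)

Section smooth_step.
Context {R : realType}.
Implicit Types (f g h : R -> R) (x : R).

(** One-variable C^k functions, with the derivative carried as a witness: closure properties then go
    by induction on k and produce explicit derivatives. *)
Fixpoint diffn (k : nat) (h : R -> R) : Prop :=
  match k with
  | 0%N => continuous h
  | k'.+1 => exists2 h' : R -> R, (forall x : R, is_derive x (1 : R) h (h' x)) & diffn k' h'
  end.

Lemma is_derive_continuous h h' : (forall x : R, is_derive x (1 : R) h (h' x)) -> continuous h.
Proof.
by move=> dh x; apply/differentiable_continuous/derivable1_diffP; have := dh x => -[].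
Qed.

Lemma diffnW k h : diffn k.+1 h -> diffn k h.
Proof.
elim: k h => [|k ih] h [h' dh]; first by move=> _; exact: is_derive_continuous dh.
by exists h' => //; exact: ih.
Qed.

Lemma diffn_cst k (c : R) : diffn k (fun=> c).
Proof.
elim: k c => [|k ih] c; first exact: cst_continuous.
by exists (fun=> 0) => // x; exact: is_derive_cst.
Qed.

Lemma diffnD k f g : diffn k f -> diffn k g -> diffn k (fun x => f x + g x).
Proof.
elim: k f g => [|k ih] f g.
  by move=> cf cg x; apply: cvgD; [exact: cf|exact: cg].
move=> [f' df hf] [g' dg hg]; exists (fun x => f' x + g' x); last exact: ih.
by move=> x; have := df x; have := dg x => ? ?; exact: is_deriveD.
Qed.

Lemma diffnM k f g : diffn k f -> diffn k g -> diffn k (fun x => f x * g x).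
Proof.
elim: k f g => [|k ih] f g.
  by move=> cf cg x; apply: cvgM; [exact: cf|exact: cg].
move=> hf hg; have [f' df hf'] := hf; have [g' dg hg'] := hg.
exists (fun x => f' x * g x + f x * g' x).
  move=> x; have := df x; have := dg x => ? ?.
  by apply: is_derive_eq; rewrite /GRing.scale/= addrC mulrC; congr (_ + _); rewrite mulrC.
by apply: diffnD; apply: ih => //; exact: diffnW.
Qed.

Lemma diffnZ k (c : R) f : diffn k f -> diffn k (fun x => c * f x).
Proof. by move=> hf; apply: diffnM => //; exact: diffn_cst. Qed.

Lemma diffn_id k : diffn k (fun x => x).
Proof.
case: k => [|k]; first by move=> x; exact: cvg_id.
by exists (fun=> 1); [move=> x; exact: is_derive_id|exact: diffn_cst].
Qed.

Lemma diffn_affine k (a c : R) f : diffn k f -> diffn k (fun x => f (a * x + c)).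
Proof.
have daff x : is_derive x (1 : R) (fun x : R => a * x + c) a.
  by apply: is_derive_eq; rewrite /GRing.scale/= addr0 mulr1.
elim: k f => [|k ih] f.
  move=> cf x; apply: (@continuous_comp _ _ _ (fun x => a * x + c)); last exact: cf.
  exact: (@is_derive_continuous _ (fun=> a)).
move=> [f' df hf']; exists (fun x => f' (a * x + c) * a).
  by move=> x; apply: is_derive1_comp.
by apply: diffnM; [exact: ih|exact: diffn_cst].
Qed.

Lemma diffnV k f : (forall x, f x != 0) -> diffn k f -> diffn k (fun x => (f x)^-1).
Proof.
move=> f0; elim: k => [|k ih].
  by move=> cf x; apply: cvgV => //; exact: cf.
move=> hf; have [f' df hf'] := hf.
exists (fun x => (-1) * ((f x)^-1 * (f x)^-1 * f' x)).
  move=> x; apply: is_derive_eq (is_deriveV (f0 x) (df x)) _.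
  by rewrite /GRing.scale/= expr2 invfM; ring.
have hV : diffn k (fun x => (f x)^-1) by apply: ih; exact: diffnW.
by apply: diffnZ; apply: diffnM => //; apply: diffnM.
Qed.

(** The flat function exp(-1/x), extended by 0, with the extra factors x^(-n): differentiation maps
    the span of this family to itself, so a single induction gives smoothness. *)
Definition flatexp (n : nat) (x : R) : R :=
  if x <= 0 then 0 else x^-1 ^+ n * expR (- x^-1).

Lemma flatexp_ge0 n x : 0 <= flatexp n x.
Proof.
rewrite /flatexp; case: ifPn => //; rewrite -ltNge => x0.
by rewrite mulr_ge0// ?expR_ge0// exprn_ge0// invr_ge0 ltW.
Qed.

(** With y = 1/x this is y^(n+1) / (n+1)! <= exp y, one term of the exponential series. *)
Lemma flatexp_le n x : 0 < x -> flatexp n x <= n.+1`!%:R * x.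
Proof.
move=> x0; have xN0 : (x <= 0) = false by rewrite leNgt x0.
rewrite /flatexp xN0 expRN ler_pdivrMr ?expR_gt0//.
have iv0 : 0 <= x^-1 by rewrite invr_ge0 ltW.
apply: (@le_trans _ _ (n.+1`!%:R * x * (x^-1 ^+ n.+1 / n.+1`!%:R))).
  have F0 : (n.+1`!%:R : R) != 0 by rewrite pnatr_eq0 gtn_eqF ?fact_gt0.
  rewrite exprS; set y := _ ^+ n; set F := (_`!%:R : R) in F0 *.
  suff -> : F * x * (x^-1 * y / F) = y by [].
  by field; rewrite F0 gt_eqF.
rewrite ler_wpM2l ?mulr_ge0 ?ler0n ?ltW//.
by rewrite (lt_le_trans _ (expR_ge1Dxn n iv0))// ltrDr.
Qed.

Lemma flatexp_continuous0 n : {for 0, continuous (flatexp n)}.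
Proof.
rewrite /prop_for /continuous_at {2}/flatexp lexx.
apply/cvgrPdist_lt => e e0.
have K0 : 0 < (n.+1`!%:R : R) by rewrite ltr0n fact_gt0.
exists (e / n.+1`!%:R) => /=; first by rewrite divr_gt0.
move=> x /=; rewrite !sub0r !normrN => xe.
have [x0|x0] := leP x 0; first by rewrite /flatexp x0 normr0.
rewrite ger0_norm ?flatexp_ge0// (le_lt_trans (flatexp_le _ x0))//.
by rewrite mulrC -ltr_pdivlMr// -(gtr0_norm x0).
Qed.

Lemma is_derive_flatexp n x :
  is_derive x (1 : R) (flatexp n) (flatexp n.+2 x - n%:R * flatexp n.+1 x).
Proof.
have [x0|x0|x0] := ltgtP x 0.
- have -> : flatexp n.+2 x - n%:R * flatexp n.+1 x = 0.
    by rewrite /flatexp ltW// mulr0 subr0.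
  apply: (@near_eq_is_derive _ _ _ (fun=> 0)).
  + near=> y; rewrite /flatexp ifT//; apply: ltW.
    by near: y; exact: lt_nbhsl.
- apply: (@near_eq_is_derive R R^o R^o (fun y : R => y^-1 ^+ n * expR (- y^-1))).
  + near=> y; rewrite /flatexp ifF//; apply/negbTE; rewrite -ltNge.
    by near: y; exact: lt_nbhsr.
  + have xn0 : x != 0 by rewrite gt_eqF.
    have dV : is_derive x 1 (fun y : R => y^-1) (- x^-1 ^+ 2).
      apply: is_derive_eq (is_deriveV xn0 (is_derive_id x 1)) _.
      by rewrite /GRing.scale/= mulr1 exprVn.
    have dE : is_derive x 1 (fun y => expR (- y^-1)) (expR (- x^-1) * x^-1 ^+ 2).
      have dN : is_derive x 1 (fun y : R => - y^-1) (x^-1 ^+ 2).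
        by apply: is_derive_eq; rewrite opprK.
      exact: (is_derive1_comp (is_derive_expR _) dN).
    have dX : is_derive x 1 (fun y : R => y^-1 ^+ n)
        ((n%:R * x^-1 ^+ n.-1) * (- x^-1 ^+ 2)).
      apply: (@is_derive1_comp _ (fun y => y ^+ n)) => //.
      have := @exprn_derivable R n x^-1 1 => /derivableP.
      by rewrite -derive1E exp_derive1.
    apply: (is_derive_eq (is_deriveM dX dE)).
    rewrite /flatexp [x <= 0]leNgt x0 /GRing.scale/=.
    case: n dX => [|n] _; first by rewrite expr0 mulr0n; ring.
    by rewrite /= !exprS; ring.
(* At 0 the difference quotient of [flatexp n] is [flatexp n.+1], already known to be continuous
   there with value 0. *)
- rewrite x0; apply/is_derive1_caratheodory; exists (flatexp n.+1); split.
  + move=> z; rewrite subr0 {2}/flatexp lexx subr0 /flatexp.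
    case: ifPn => z0; first by rewrite mul0r.
    by rewrite exprSr mulrAC -[X in _ = X * _]mulrA mulVf ?mulr1// gt_eqF// ltNge.
  + exact: flatexp_continuous0.
  + by rewrite /flatexp lexx mulr0 subr0.
Unshelve. all: by end_near. Qed.

Lemma diffn_flatexp k n : diffn k (flatexp n).
Proof.
elim: k n => [|k ih] n; first exact: is_derive_continuous (is_derive_flatexp n).
exists (fun x => flatexp n.+2 x + (- n%:R) * flatexp n.+1 x).
  by move=> x; rewrite mulNr; exact: is_derive_flatexp.
by apply: diffnD => //; exact: diffnZ.
Qed.

Definition smooth_step (x : R) : R :=
  flatexp 0 x / (flatexp 0 x + flatexp 0 (1 - x)).

Lemma flatexp0_gt0 x : 0 < x -> 0 < flatexp 0 x.
Proof. by move=> x0; rewrite /flatexp ifF ?leNgt ?x0// expr0 mul1r expR_gt0. Qed.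

Lemma smooth_step_den x : 0 < flatexp 0 x + flatexp 0 (1 - x).
Proof.
have [x0|x0] := ltP 0 x; first by rewrite ltr_pwDl ?flatexp_ge0 ?flatexp0_gt0.
by rewrite ltr_pwDr ?flatexp_ge0// flatexp0_gt0//; lra.
Qed.

Lemma diffn_smooth_step k : diffn k smooth_step.
Proof.
apply: diffnM; first exact: diffn_flatexp.
apply: diffnV => [x|]; first by rewrite gt_eqF// smooth_step_den.
apply: diffnD; first exact: diffn_flatexp.
rewrite (_ : (fun x => _) = (fun x => flatexp 0 (-1 * x + 1))); last first.
  by apply/funext => x; rewrite mulN1r addrC.
exact/diffn_affine/diffn_flatexp.
Qed.

Lemma smooth_step0 x : x <= 0 -> smooth_step x = 0.
Proof. by move=> x0; rewrite /smooth_step {1}/flatexp x0 mul0r. Qed.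

Lemma smooth_step1 x : 1 <= x -> smooth_step x = 1.
Proof.
move=> x1; rewrite /smooth_step {3}/flatexp ifT ?addr0; last lra.
by rewrite divff// gt_eqF// flatexp0_gt0//; lra.
Qed.

Lemma smooth_step_ge0 x : 0 <= smooth_step x.
Proof. by rewrite divr_ge0 ?flatexp_ge0// ltW// smooth_step_den. Qed.

Lemma smooth_step_le1 x : smooth_step x <= 1.
Proof.
rewrite ler_pdivrMr ?smooth_step_den// mul1r lerDl; exact: flatexp_ge0.
Qed.

End smooth_step.

(** * The sup norm and linear forms on row vectors *)

Section row_norm.
Context {R : realType} {d : nat}.
Implicit Types (x y v z : 'rV[R]_d).

Lemma rV_norm_coord x i : `|x ord0 i| <= `|x|.
Proof.
by rewrite [leRHS]/Num.norm/= mx_normrE (le_bigmax _ (fun ij => `|x ij.1 ij.2|) (ord0, i)).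
Qed.

Lemma rV_norm_le x (M : R) : 0 <= M -> (forall i, `|x ord0 i| <= M) -> `|x| <= M.
Proof.
move=> M0 xM; rewrite [leLHS]/Num.norm/= mx_normrE; apply/bigmax_leP; split => //.
by move=> [i j] _ /=; rewrite ord1.
Qed.

(** The pairing of a vector with a gradient. [G] is a bare family of reals, so that difference
    quotients can stand in for partial derivatives. *)
Definition lin (v : 'rV[R]_d) (G : 'I_d -> R) : R := \sum_i v ord0 i * G i.

Lemma lin_le v G (C : R) : (forall i, `|G i| <= C) -> `|lin v G| <= d%:R * C * `|v|.
Proof.
move=> GC; rewrite (le_trans (ler_norm_sum _ _ _))//.
apply: (@le_trans _ _ (\sum_(i < d) C * `|v|)).
  apply: ler_sum => i _; rewrite normrM mulrC ler_pM//; exact: rV_norm_coord.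
by rewrite sumr_const card_ord -[leLHS]mulr_natl mulrA.
Qed.

Lemma linD v w G : lin (v + w) G = lin v G + lin w G.
Proof. by rewrite /lin -big_split/=; apply: eq_bigr => i _; rewrite mxE mulrDl. Qed.

Lemma linN v G : lin (- v) G = - lin v G.
Proof. by rewrite /lin -sumrN; apply: eq_bigr => i _; rewrite mxE mulNr. Qed.

Lemma linZ (a : R) v G : lin (a *: v) G = a * lin v G.
Proof. by rewrite /lin mulr_sumr; apply: eq_bigr => i _; rewrite mxE mulrA. Qed.

Lemma linB_r v G H : lin v (fun i => G i - H i) = lin v G - lin v H.
Proof. by rewrite /lin -sumrB; apply: eq_bigr => i _; rewrite mulrBr. Qed.

Lemma lin_sum (I : finType) (w : I -> 'rV[R]_d) G :
  lin (\sum_k w k) G = \sum_k lin (w k) G.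
Proof.
by rewrite /lin exchange_big/=; apply: eq_bigr => i _; rewrite summxE mulr_suml.
Qed.

Lemma fin_min_gt0 (n : nat) (r : 'I_n -> R) : (forall i, 0 < r i) ->
  exists2 m, 0 < m & forall i, m <= r i.
Proof.
move=> r0; exists (\big[Num.min/1]_i r i); last first.
  by move=> i; rewrite (bigD1 i)//= ge_min lexx.
by elim/big_ind : _ => // a b a0 b0; rewrite lt_min a0 b0.
Qed.

Lemma fin_max (n : nat) (C : 'I_n -> R) : exists2 m, 0 <= m & forall i, C i <= m.
Proof.
exists (\big[Num.max/0]_i `|C i|); last first.
  by move=> i; rewrite (bigD1 i)//= le_max ler_norm.
by elim/big_ind : _ => // a b a0 b0; rewrite le_max a0.
Qed.

End row_norm.

(** * Differentiability with a uniform remainder *)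

Section uniform_differentiability.
Context {R : realType} {d : nat}.
Local Notation Rd := 'rV[R]_d.

(* Up to translation, f only takes its values on a bounded set; both periodic
   and compactly supported functions have this property. *)
Definition locally_bounded_type {T} (f : Rd -> T) : Prop :=
  exists M : R, forall x : Rd, exists2 z : Rd, `|z| <= M &
    forall v : Rd, `|v| < 1 -> f (x + v) = f (z + v).

Lemma periodic_lbt T (f : Rd -> T) : Zd_periodic f -> locally_bounded_type f.
Proof.
move=> pf; exists 1 => x.
pose k : 'rV[int]_d := \row_i - Num.floor (x ord0 i).
exists (x + map_mx intr k).
  apply: rV_norm_le => // i; rewrite !mxE rmorphN/=.
  have := floor_itv (x ord0 i); rewrite intrD1.
  by move=> /andP[h1 h2]; rewrite ger0_norm; lra.
by move=> v _; rewrite addrAC pf.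
Qed.

(** A far point x is replaced by its radial projection on the sphere of radius |M| + 2; the unit
    balls around both points lie where f vanishes. *)
Lemma bounded_support_lbt (f : Rd -> R) (M : R) :
  (forall x : Rd, M < `|x| -> f x = 0) -> locally_bounded_type f.
Proof.
move=> fM; exists (`|M| + 2) => x.
have [xM|xM] := leP `|x| (`|M| + 2); first by exists x.
have x0 : `|x| != 0 by rewrite gt_eqF// (le_lt_trans _ xM)// addr_ge0.
have nz : `|(`|M| + 2) / `|x| *: x| = `|M| + 2.
  by rewrite normrZ ger0_norm ?divr_ge0 ?addr_ge0// divfK.
exists ((`|M| + 2) / `|x| *: x); first by rewrite nz.
have far z v : `|M| + 2 <= `|z| -> `|v| < 1 -> f (z + v) = 0.
  move=> zM v1; apply: fM; have := ler_norm M.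
  have := lerB_dist z (- v); rewrite opprK normrN.
  by move: zM v1; lra.
by move=> v v1; rewrite !far// ?nz// ltW.
Qed.

Lemma compact_norm_le (M : R) : compact [set z : Rd | `|z| <= M].
Proof.
apply: bounded_closed_compact.
    exists M; split; first exact: num_real.
  move=> N MN z /= zM; by rewrite (le_trans zM)// ltW.
rewrite (_ : [set z | _] = (fun z : Rd => `|z|) @^-1` [set y | y <= M])//.
apply: closed_comp; last exact: closed_le.
by move=> z _; exact: norm_continuous.
Qed.

(** Heine-Cantor on the closed ball of radius M, with compactness used as a near-covering property
    for radii tending to 0; any other point is first exchanged for one of that ball. *)
Lemma lbt_unif_cont (g : Rd -> R) : continuous g -> locally_bounded_type g ->
  forall e : R, 0 < e -> exists2 r : R, 0 < r & forall x v : Rd, `|v| < r -> `|g (x + v) - g x| <= e.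
Proof.
move=> cg [M gM] e e0.
have cK := @compact_norm_le M.
have /compact_near_coveringP := cK.
pose P (r : R) (z : Rd) := forall v, `|v| < r -> `|g (z + v) - g z| <= e.
move=> /(_ R (0^'+) P _) [|r /= r0 rP].
- move=> z _.
  have /cvgrPdist_lt/(_ (e / 2)) := cg z.
  rewrite divr_gt0// => /(_ isT) /nbhs_ballP[r /= r0 rz].
  exists (ball z (r / 2), [set s | 0 < s < r / 2]) => /=.
    split; first by apply: nbhsx_ballx; rewrite divr_gt0.
    exists (r / 2) => /=; first by rewrite divr_gt0.
    by move=> s /=; rewrite sub0r normrN => sr s0; rewrite s0 (le_lt_trans _ sr)// ler_norm.
  move=> [z' s] /= [zz' /andP[s0 sr]] v vs.
  have h1 : `|g z - g (z' + v)| < e / 2.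
    apply: rz; rewrite -ball_normE /ball_/= opprD addrA.
    rewrite (le_lt_trans (ler_normB _ _))// (splitr r) ltrD//.
      by move: zz'; rewrite -ball_normE.
    exact: lt_trans sr.
  have h2 : `|g z - g z'| < e / 2.
    by apply: rz; move: zz'; apply: le_ball; rewrite ler_pdivrMr// ler_pMr// ler1n.
  have -> : g (z' + v) - g z' = (g z - g z') - (g z - g (z' + v)) by ring.
  by rewrite (le_trans (ler_normB _ _))// (splitr e) lerD// ltW.
(* The cap 1 is the range of v on which g around x coincides with g around its substitute z. *)
- exists (Num.min (r / 2) 1) => [|x v].
    by rewrite lt_min divr_gt0/=.
  rewrite lt_min => /andP[vr v1].
  have [z zM xz] := gM x.
  have -> : g x = g z by rewrite -[x]addr0 xz ?addr0// normr0.
  rewrite xz//; apply: (rP (r / 2)) => //=.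
  + by rewrite sub0r normrN gtr0_norm ?divr_gt0// ltr_pdivrMr// ltr_pMr// ltr1n.
  + by rewrite divr_gt0.
Qed.

Lemma lbt_bounded (g : Rd -> R) : continuous g -> locally_bounded_type g ->
  exists2 C : R, 0 <= C & forall x : Rd, `|g x| <= C.
Proof.
move=> cg lg; have [r r0 rg] := lbt_unif_cont cg lg ltr01.
have [M gM] := lg.
have cK := @compact_norm_le M.
have := continuous_compact (continuous_subspaceT cg) cK.
move=> /compact_bounded[C [_ /(_ (`|C| + 1))]].
have -> : C < `|C| + 1 by rewrite (le_lt_trans (ler_norm C))// ltrDl.
move=> /(_ isT) hC; exists (`|C| + 1) => [|x]; first by rewrite addr_ge0.
have [z zM xz] := gM x.
have -> : g x = g z by rewrite -[x]addr0 xz ?addr0// normr0.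
by apply: hC; exists z.
Qed.

(** The strict inequality |v| < 1 leaves room: for small h the vector h w + v is still in the unit
    ball, so the difference quotients at x + v and z + v agree. *)
Lemma lbt_derive (f : Rd -> R) (w : Rd) : locally_bounded_type f ->
  locally_bounded_type (fun x => 'D_w f x).
Proof.
move=> [M fM]; exists M => x; have [z zM xz] := fM x; exists z => // v v1.
have e0 : 0 < (1 - `|v|) / (`|w| + 1).
  by rewrite divr_gt0 ?subr_gt0// ltr_wpDl.
have E h : `|h| < (1 - `|v|) / (`|w| + 1) -> f (h *: w + (x + v)) = f (h *: w + (z + v)).
  move=> he; rewrite [_ + (x + v)]addrCA [_ + (z + v)]addrCA xz//.
  rewrite (le_lt_trans (ler_normD _ _))// normrZ -ltrBrDr.
  rewrite (@le_lt_trans _ _ (`|h| * (`|w| + 1))) ?ler_wpM2l ?lerDl//.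
  by rewrite -ltr_pdivlMr ?ltr_wpDl.
rewrite /derive; congr (lim _); rewrite eqEsubset; split; apply: near_eq_cvg.
- near=> h; congr (_ *: (_ - _)); last exact: xz.
  by rewrite /= E//; near: h; exact: dnbhs0_lt.
- near=> h; congr (_ *: (_ - _)); last by rewrite xz.
  by rewrite /= E//; near: h; exact: dnbhs0_lt.
Unshelve. all: by end_near. Qed.

Lemma is_derive_line (f : Rd -> R) (x v : Rd) (s : R) : differentiable f (x + s *: v) ->
  is_derive s (1 : R) (fun s => f (x + s *: v)) ('D_v f (x + s *: v)).
Proof.
move=> df; have dv : derivable f (x + s *: v) v by exact: diff_derivable.
have E : (fun h : R => h^-1 *: (((fun s => f (x + s *: v)) \o shift s) (h *: 1) - f (x + s *: v))) =
    (fun h => h^-1 *: ((f \o shift (x + s *: v)) (h *: v) - f (x + s *: v))).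
  apply/funext => h /=; congr (_ *: (f _ - _)).
  by rewrite [h *: 1]mulr1 scalerDl addrCA.
by apply: DeriveDef; rewrite /derivable /derive E.
Qed.

Lemma derive_lin (f : Rd -> R) (x v : Rd) : differentiable f x ->
  'D_v f x = lin v (fun i => partial i f x).
Proof.
move=> df; rewrite deriveE// {1}(row_sum_delta v) linear_sum; apply: eq_bigr => i _.
by rewrite linearZ/= /partial deriveE.
Qed.

Lemma MVT_line (f : Rd -> R) (x v : Rd) : (forall x, differentiable f x) ->
  exists2 c, 0 <= c <= 1 & f (x + v) - f x = lin v (fun i => partial i f (x + c *: v)).
Proof.
move=> df.
have dl (s : R) := is_derive_line (df (x + s *: v)).
have [|c] := MVT_segment (@ler01 R) (fun s _ => dl s).
  apply: continuous_subspaceT => s.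
  by apply/differentiable_continuous/derivable1_diffP; have := dl s => -[].
rewrite in_itv/= scale1r scale0r addr0 subr0 mulr1 => c01 ->.
by exists c => //; rewrite derive_lin.
Qed.

(** By the mean value theorem the remainder is v paired with the variation of the gradient along a
    segment, and the partial derivatives inherit uniform continuity through [lbt_derive]. *)
Lemma Ck1_unif_diff (f : Rd -> R) : Ck 1 f -> locally_bounded_type f ->
  (exists2 C : R, 0 <= C & forall (x : Rd) i, `|partial i f x| <= C) /\
  forall e : R, 0 < e -> exists2 r : R, 0 < r & forall x v : Rd, `|v| < r ->
    `|f (x + v) - f x - lin v (fun i => partial i f x)| <= e * `|v|.
Proof.
move=> [df cf] lf; split.
  have /choice[C hC] : forall i, exists C, forall x, `|partial i f x| <= C.
    by move=> i; have [C _ hC] := lbt_bounded (cf (delta_mx ord0 i)) (lbt_derive _ lf); exists C.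
  have [m m0 mC] := fin_max C.
  by exists m => // x i; rewrite (le_trans (hC _ _)).
move=> e e0; pose e' := e / d.+1%:R.
have e'0 : 0 < e' by rewrite divr_gt0.
have /choice[r hr] : forall i, exists r, 0 < r /\
    forall x v, `|v| < r -> `|partial i f (x + v) - partial i f x| <= e'.
  move=> i; have [r r0 hr] := lbt_unif_cont (cf (delta_mx ord0 i)) (lbt_derive _ lf) e'0.
  by exists r.
have [m m0 mr] := fin_min_gt0 (fun i => (hr i).1).
exists m => // x v vm; have [c /andP[c0 c1] ->] := MVT_line x v df.
rewrite -linB_r (le_trans (lin_le (C := e') _ _))//.
  move=> i; apply: (hr i).2; rewrite (lt_le_trans _ (mr i))// (le_lt_trans _ vm)//.
  by rewrite normrZ ger0_norm// ler_piMl.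
rewrite ler_wpM2r// /e' mulrCA ger_pMr// ler_pdivrMr// mul1r ler_nat//.
Qed.

Lemma Ck1_lipschitz (f : Rd -> R) : Ck 1 f -> locally_bounded_type f ->
  exists2 L : R, 0 <= L & forall x y : Rd, `|f x - f y| <= L * `|x - y|.
Proof.
move=> f1 lf; have [[C C0 hC] _] := Ck1_unif_diff f1 lf.
exists (d%:R * C) => [|x y]; first by rewrite mulr_ge0.
by have [c _] := MVT_line y (x - y) f1.1; rewrite [y + _]addrC subrK => ->; exact: lin_le.
Qed.

End uniform_differentiability.

(** * Gronwall's inequality and the flow *)

Section mean_value.
Context {R : realType} {d : nat}.
Local Notation Rd := 'rV[R]_d.

Lemma is_derive_coord (u : R -> Rd) (l : Rd) (s : R) i :
  is_derive s (1 : R) u l -> is_derive s (1 : R) (fun s => u s ord0 i) (l ord0 i).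
Proof.
move=> [du ul]; have dui := (derivable_mxP _ _ _).1 du ord0 i.
by apply: DeriveDef => //; rewrite -ul derive_mx// mxE.
Qed.

Lemma is_derive_within (f df : R -> R) (a b : R) :
  (forall s, is_derive s (1 : R) f (df s)) -> {within `[a, b], continuous f}.
Proof. by move=> fdf; apply: continuous_subspaceT => s; exact: is_derive_continuous fdf s. Qed.

Lemma mean_value_ineq (u u' : R -> Rd) (M t : R) :
  (forall s, is_derive s (1 : R) u (u' s)) ->
  (forall s, `|s| <= `|t| -> `|u' s| <= M) -> `|u t - u 0| <= M * `|t|.
Proof.
move=> du uM; have M0 : 0 <= M by rewrite (le_trans _ (uM t _)).
apply: rV_norm_le => [|i]; first by rewrite mulr_ge0.
have dui s := is_derive_coord i (du s).
rewrite !mxE; have [t0|/ltW t0] := leP 0 t.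
- have [|c] := MVT_segment t0 (fun s _ => dui s); first exact: is_derive_within dui.
  rewrite in_itv/= => /andP[c0 ct] ->; rewrite subr0 normrM ler_wpM2r//.
  by rewrite (le_trans (rV_norm_coord _ _))// uM// !ger0_norm.
- have [|c] := MVT_segment t0 (fun s _ => dui s); first exact: is_derive_within dui.
  rewrite in_itv/= => /andP[c0 ct]; rewrite sub0r distrC => ->; rewrite normrM normrN ler_wpM2r//.
  by rewrite (le_trans (rV_norm_coord _ _))// uM// !ler0_norm// lerN2.
Qed.

Lemma rV_norm_sqr_le (x : Rd) : `|x| ^+ 2 <= \sum_i x ord0 i ^+ 2.
Proof.
have s0 : 0 <= \sum_i x ord0 i ^+ 2 by apply: sumr_ge0 => i _; exact: sqr_ge0.
rewrite -[leRHS]sqr_sqrtr// lerXn2r// ?nnegrE ?sqrtr_ge0//.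
apply: rV_norm_le; first exact: sqrtr_ge0.
move=> i; rewrite -sqrtr_sqr ler_wsqrtr// (bigD1 i)//= lerDl.
by apply: sumr_ge0 => j _; exact: sqr_ge0.
Qed.

Lemma sum_sqr_le_norm (x : Rd) : \sum_i x ord0 i ^+ 2 <= d%:R * `|x| ^+ 2.
Proof.
apply: (@le_trans _ _ (\sum_(i < d) `|x| ^+ 2)); last by rewrite sumr_const card_ord mulr_natl.
by apply: ler_sum => i _; rewrite -real_normK ?num_real// lerXn2r ?nnegrE//; exact: rV_norm_coord.
Qed.

(** The sup norm is not differentiable, so the estimate runs on the sum of squares g. From 2 |u| eta
    <= |u|^2 + eta^2 comes g' <= K g + d eta^2, and then g(s) exp(-K s) - d eta^2 s is
    nonincreasing. *)
Lemma gronwall_pos (C eta t : R) (u u' : R -> Rd) : 0 <= C -> 0 <= eta -> 0 <= t ->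
  (forall s, is_derive s (1 : R) u (u' s)) ->
  (forall s, 0 <= s <= t -> `|u' s| <= C * `|u s| + eta) ->
  `|u t| ^+ 2 <= expR ((2 * d%:R * C + d%:R) * t) * (d%:R * (`|u 0| ^+ 2 + eta ^+ 2 * t)).
Proof.
move=> C0 eta0 t0 du uC; set K := 2 * d%:R * C + d%:R.
pose g s := \sum_i u s ord0 i ^+ 2.
pose g' s := \sum_i 2 * u s ord0 i * u' s ord0 i.
have dg s : is_derive s (1 : R) g (g' s).
  have dui i : is_derive s (1 : R) (fun s => u s ord0 i ^+ 2) (2 * u s ord0 i * u' s ord0 i).
    have dc := is_derive_coord i (du s).
    apply: (is_derive_eq (is_deriveM dc dc)).
    by rewrite /GRing.scale/=; ring.
  rewrite (_ : g = \sum_i (fun s => u s ord0 i ^+ 2)); first exact: is_derive_sum.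
  by apply/funext => z; rewrite fct_sumE.
pose h s := g s * expR (- K * s) - d%:R * eta ^+ 2 * s.
pose h' s := g s * (expR (- K * s) * - K) + g' s * expR (- K * s) - d%:R * eta ^+ 2.
have dh s : is_derive s (1 : R) h (h' s).
  have dE : is_derive s (1 : R) (fun s => expR (- K * s)) (expR (- K * s) * - K).
    apply: (@is_derive1_comp _ expR (fun s => - K * s)).
    by apply: is_derive_eq; rewrite /GRing.scale/= mulr1.
  have dL : is_derive s (1 : R) (fun s => d%:R * eta ^+ 2 * s) (d%:R * eta ^+ 2).
    by apply: is_derive_eq; rewrite /GRing.scale/= mulr1.
  have := dg s => dgs.
  apply: (is_derive_eq (is_deriveB (is_deriveM dgs dE) dL)).
  by rewrite /h' /GRing.scale/= [expR _ * g' s]mulrC.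
have K0 : 0 <= K by rewrite addr_ge0// !mulr_ge0.
have h'le s : 0 <= s <= t -> h' s <= 0.
  move=> /[dup] /andP[s0 st] /uC us.
  have ug : `|u s| ^+ 2 <= g s by exact: rV_norm_sqr_le.
  have g'le : g' s <= K * g s + d%:R * eta ^+ 2.
    apply: (@le_trans _ _ (\sum_(i < d) 2 * (`|u s| * (C * `|u s| + eta)))).
      apply: ler_sum => i _; rewrite -mulrA ler_wpM2l// (le_trans (ler_norm _))// normrM.
      by rewrite ler_pM// ?rV_norm_coord// (le_trans (rV_norm_coord _ _)).
    rewrite sumr_const card_ord -[leLHS]mulr_natl.
    apply: (@le_trans _ _ (K * `|u s| ^+ 2 + d%:R * eta ^+ 2)); last by rewrite lerD2r ler_wpM2l.
    rewrite -subr_ge0.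
    suff -> : K * `|u s| ^+ 2 + d%:R * eta ^+ 2 - d%:R * (2 * (`|u s| * (C * `|u s| + eta)))
        = d%:R * (`|u s| - eta) ^+ 2 by rewrite mulr_ge0// sqr_ge0.
    by rewrite /K; ring.
  have E1 : expR (- K * s) <= 1 by rewrite expR_le1 mulNr oppr_le0 mulr_ge0.
  have E0 := expR_ge0 (- K * s).
  rewrite /h'; set E := expR _ in E0 E1 *.
  have -> : g s * (E * - K) + g' s * E = (g' s - K * g s) * E by ring.
  rewrite subr_le0; apply: (@le_trans _ _ (d%:R * eta ^+ 2 * E)).
    by rewrite ler_wpM2r// lerBlDl.
  by rewrite ler_piMr// mulr_ge0// sqr_ge0.
have hle : h t <= h 0.
  apply: (@ler0_derive1_nincr _ h 0 t) => // [x|].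
  - rewrite in_itv/= => /andP[x0 xt]; rewrite derive1E; have := dh x => -[_ ->].
    by apply: h'le; rewrite !ltW.
  - exact: is_derive_within dh.
move: hle; rewrite /h mulr0 expR0 mulr1 mulr0 subr0 lerBlDr mulNr => hle.
apply: (le_trans (rV_norm_sqr_le _)); rewrite -/(g t).
have -> : g t = expR (K * t) * (g t * expR (- (K * t))).
  by rewrite mulrCA -expRD subrr expR0 mulr1.
rewrite ler_wpM2l ?expR_ge0// (le_trans hle)// mulrDr -mulrA lerD2r.
exact: sum_sqr_le_norm.
Qed.

Lemma is_derive_oppt (u : R -> Rd) (l : Rd) (s : R) :
  is_derive (- s) (1 : R) u l -> is_derive s (1 : R) (fun s => u (- s)) (- l).
Proof.
move=> [du ul].
have E : (fun h : R => h^-1 *: (((fun s => u (- s)) \o shift s) (h *: 1) - u (- s))) =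
    (fun h => - (h^-1 *: ((u \o shift (- s)) (h *: 1) - u (- s)))) \o -%R.
  apply/funext => h /=; rewrite invrN scaleNr opprK; congr (_ *: (u _ - _)).
  by rewrite [- h *: 1]mulr1 [h *: 1]mulr1 opprD.
have cv : (fun h : R => h^-1 *: (((fun s => u (- s)) \o shift s) (h *: 1) - u (- s))) @ 0^' --> - l.
  rewrite E; apply: (@cvg_comp _ _ _ -%R (fun h => - (h^-1 *: ((u \o shift (- s)) (h *: 1) - u (- s)))) 0^' 0^').
    move=> A [e /= e0 eA]; exists e => //= h; rewrite /= sub0r normrN => he h0.
    by apply: eA; rewrite /= ?sub0r ?opprK// oppr_eq0.
  by apply: cvgN; rewrite -ul; exact: du.
by apply: DeriveDef; [apply/cvg_ex; exists (- l)|apply: cvg_lim].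
Qed.

(** [G] is chosen before [u], which makes every later estimate uniform in the starting point. The
    squared bound becomes a linear one through Q <= (Q + 1)^2, and negative times follow by
    reversing time. *)
Lemma gronwall (C T : R) : 0 <= C -> 0 <= T -> exists2 G : R, 0 <= G &
  forall (u u' : R -> Rd) (eta : R), 0 <= eta ->
  (forall s, is_derive s (1 : R) u (u' s)) ->
  (forall s, `|s| <= T -> `|u' s| <= C * `|u s| + eta) ->
  forall t, `|t| <= T -> `|u t| <= G * (`|u 0| + eta).
Proof.
move=> C0 T0; pose K := 2 * d%:R * C + d%:R.
pose Q := expR (K * T) * (d%:R * (1 + T)).
have K0 : 0 <= K by rewrite addr_ge0// !mulr_ge0.
have Q0 : 0 <= Q by rewrite mulr_ge0 ?expR_ge0// mulr_ge0// addr_ge0.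
have key (u u' : R -> Rd) (eta t : R) : 0 <= eta -> 0 <= t <= T ->
    (forall s, is_derive s (1 : R) u (u' s)) ->
    (forall s, `|s| <= T -> `|u' s| <= C * `|u s| + eta) -> `|u t| <= (Q + 1) * (`|u 0| + eta).
  move=> eta0 /andP[t0 tT] du uC.
  rewrite -(@ler_pXn2r _ 2)// ?nnegrE ?mulr_ge0 ?addr_ge0//.
  apply: (le_trans (gronwall_pos C0 eta0 t0 du _)).
    by move=> s /andP[s0 st]; apply: uC; rewrite ger0_norm// (le_trans st).
  apply: (@le_trans _ _ (Q * (`|u 0| + eta) ^+ 2)); last first.
    rewrite exprMn ler_wpM2r ?sqr_ge0//; nra.
  rewrite /Q -[leRHS]mulrA; apply: ler_pM.
  - exact: expR_ge0.
  - by rewrite mulr_ge0// addr_ge0 ?sqr_ge0// mulr_ge0 ?sqr_ge0.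
  - by rewrite ler_expR ler_wpM2l.
  - rewrite -mulrA ler_wpM2l//.
    have : 0 <= `|u 0| by []. 
    move: (`|u 0|) => a a0.
    have h1 : a ^+ 2 + eta ^+ 2 * t <= a ^+ 2 + eta ^+ 2 * T by rewrite lerD2l ler_wpM2l// sqr_ge0.
    apply: (le_trans h1); rewrite -subr_ge0.
    have -> : (1 + T) * (a + eta) ^+ 2 - (a ^+ 2 + eta ^+ 2 * T) =
      eta ^+ 2 + 2 * (a * eta) + T * (a ^+ 2 + 2 * (a * eta)) by ring.
    by rewrite !addr_ge0 ?sqr_ge0// ?mulr_ge0// addr_ge0 ?sqr_ge0// !mulr_ge0.
exists (Q + 1); first by rewrite addr_ge0.
move=> u u' eta eta0 du uC t tT; have [t0|/ltW t0] := leP 0 t.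
  by apply: (key u u') => //; rewrite t0 -(ger0_norm t0).
have := @key (fun s => u (- s)) (fun s => - u' (- s)) eta (- t) eta0.
rewrite opprK oppr0; apply.
- by rewrite oppr_ge0 t0 -(ler0_norm t0).
- by move=> s; exact: is_derive_oppt.
- by move=> s sT; rewrite normrN; apply: uC; rewrite normrN.
Qed.

End mean_value.

(** * Uniform bounds on a periodic C^1 field *)

Section periodic_field.
Context {R : realType} {d : nat}.
Local Notation Rd := 'rV[R]_d.
Variable b : Rd -> Rd.
Hypothesis hb : Ck_sharp 1 b.

Let bi (i : 'I_d) (x : Rd) : R := b x ord0 i.

Lemma derive_coord (f : Rd -> Rd) (x v : Rd) i : derivable f x v ->
  'D_v (fun x => f x ord0 i) x = ('D_v f x) ord0 i.
Proof. by move=> df; rewrite derive_mx// mxE. Qed.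

Lemma Ck1_coord i : Ck 1 (bi i).
Proof.
have [[db cb] _] := hb; split=> [x|v].
  by apply: (@differentiable_comp _ _ _ _ b (fun M : Rd => M ord0 i)) => //; exact: differentiable_coord.
rewrite /= (_ : (fun x => 'D_v (bi i) x) = (fun x => ('D_v b x) ord0 i)); last first.
  by apply/funext => x; rewrite derive_coord//; exact: diff_derivable.
by move=> x; apply: (@continuous_comp _ _ _ (fun x => 'D_v b x) (fun M : Rd => M ord0 i));
  [exact: cb|exact: coord_continuous].
Qed.

Lemma lbt_coord i : locally_bounded_type (bi i).
Proof. by apply: periodic_lbt => k x; rewrite /bi hb.2. Qed.

Lemma field_continuous : continuous b.
Proof. by move=> x; apply: differentiable_continuous; exact: hb.1.1. Qed.

Lemma field_bounded : exists2 B : R, 0 <= B & forall x, `|b x| <= B.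
Proof.
have /choice[C hC] : forall i, exists C, forall x, `|bi i x| <= C.
  move=> i; have cbi : continuous (bi i).
    by move=> x; apply: (@continuous_comp _ _ _ b (fun M : Rd => M ord0 i));
      [exact: field_continuous|exact: coord_continuous].
  by have [C _ hC] := lbt_bounded cbi (lbt_coord i); exists C.
have [m m0 mC] := fin_max C.
by exists m => // x; apply: rV_norm_le => // i; exact: le_trans (hC _ _) (mC i).
Qed.

Lemma field_lipschitz : exists2 L : R, 0 <= L & forall x y : Rd, `|b x - b y| <= L * `|x - y|.
Proof.
have /choice[C hC] : forall i, exists C, forall x y, `|bi i x - bi i y| <= C * `|x - y|.
  by move=> i; have [C _ hC] := Ck1_lipschitz (Ck1_coord i) (lbt_coord i); exists C.
have [m m0 mC] := fin_max C.
exists m => // x y; apply: rV_norm_le => [|i]; first by rewrite mulr_ge0.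
by rewrite !mxE (le_trans (hC _ _ _))// ler_wpM2r.
Qed.

Let jac (x : Rd) : 'M[R]_d := \matrix_(j, i) partial j (bi i) x.

Lemma field_unif_diff : exists (J : Rd -> 'M[R]_d) (C : R),
  [/\ 0 <= C, forall x (v : Rd), `|v *m J x| <= C * `|v| &
  forall e : R, 0 < e -> exists2 r : R, 0 < r & forall x v : Rd, `|v| < r ->
    `|b (x + v) - b x - v *m J x| <= e * `|v|].
Proof.
have jacE x v i : (v *m jac x) ord0 i = lin v (fun j => partial j (bi i) x).
  by rewrite mxE; apply: eq_bigr => j _; rewrite mxE.
have h i := Ck1_unif_diff (Ck1_coord i) (lbt_coord i).
have /choice[C hC] : forall i, exists C, forall x j, `|partial j (bi i) x| <= C.
  by move=> i; have [[C _ hC] _] := h i; exists C.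
have [m m0 mC] := fin_max C.
exists jac, (d%:R * m); split=> [|x v|e e0]; first by rewrite mulr_ge0.
- apply: rV_norm_le => [|i]; first by rewrite !mulr_ge0.
  by rewrite jacE; apply: lin_le => j; exact: le_trans (hC _ _ _) (mC i).
- have /choice[r hr] : forall i, exists r, 0 < r /\ forall x v, `|v| < r ->
      `|bi i (x + v) - bi i x - lin v (fun j => partial j (bi i) x)| <= e * `|v|.
    by move=> i; have [_ /(_ e e0)[r r0 hr]] := h i; exists r.
  have [n n0 nr] := fin_min_gt0 (fun i => (hr i).1).
  exists n => // x v vn; apply: rV_norm_le => [|i]; first by rewrite mulr_ge0// ltW.
  by rewrite 4!mxE jacE; apply: (hr i).2; exact: lt_le_trans vn (nr i).
Qed.

End periodic_field.

(** * Regularity of the flow, uniform in the starting point *)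

Section flow.
Context {R : realType} {d : nat}.
Local Notation Rd := 'rV[R]_d.
Variable b : Rd -> Rd.
Hypothesis hb : Ck_sharp 1 b.
Variable X : R -> Rd -> Rd.
Hypothesis hX : is_flow b X.

Lemma flow0 x : X 0 x = x. Proof. exact: (hX x).1. Qed.

Lemma is_derive_flow x s : is_derive s (1 : R) (fun s => X s x) (b (X s x)).
Proof. exact: (hX x).2. Qed.

Lemma flow_lipschitz (T : R) : 0 <= T -> exists2 G : R, 0 <= G &
  forall t (x v : Rd), `|t| <= T -> `|X t (x + v) - X t x| <= G * `|v|.
Proof.
move=> T0; have [L L0 hL] := field_lipschitz hb.
have [G G0 hG] := gronwall (d := d) L0 T0.
exists G => // t x v tT.
have := hG (fun s => X s (x + v) - X s x) (fun s => b (X s (x + v)) - b (X s x)) 0 (lexx _).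
rewrite !flow0 addr0 [x + v - x]addrC addKr; apply => //.
  by move=> s; have := is_derive_flow x s; have := is_derive_flow (x + v) s => ? ?; exact: is_deriveB.
by move=> s _; rewrite addr0 hL.
Qed.

Lemma is_derive_translate (u : R -> Rd) (l : Rd) (s t : R) :
  is_derive (s + t) (1 : R) u l -> is_derive s (1 : R) (fun s => u (s + t)) l.
Proof.
move=> [du ul].
have E : (fun h : R => h^-1 *: (((fun s => u (s + t)) \o shift s) (h *: 1) - u (s + t))) =
    (fun h => h^-1 *: ((u \o shift (s + t)) (h *: 1) - u (s + t))).
  by apply/funext => h /=; rewrite addrA.
by apply: DeriveDef; rewrite /derivable /derive E.
Qed.

Lemma flow_uniq (u : R -> Rd) x : u 0 = x ->
  (forall s, is_derive s (1 : R) u (b (u s))) -> forall t, u t = X t x.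
Proof.
move=> u0 du t; have [L L0 hL] := field_lipschitz hb.
have [G G0 hG] := gronwall (d := d) L0 (normr_ge0 t).
have := hG (fun s => u s - X s x) (fun s => b (u s) - b (X s x)) 0 (lexx _).
rewrite u0 flow0 subrr normr0 addr0 mulr0 => /(_ _ _ t (lexx _)).
rewrite normr_le0 subr_eq0 => /(_ _ _)/eqP; apply.
  by move=> s; have := is_derive_flow x s; have := du s => ? ?; exact: is_deriveB.
by move=> s _; rewrite addr0 hL.
Qed.

Lemma flowD s t x : X (s + t) x = X s (X t x).
Proof.
apply: (@flow_uniq (fun s => X (s + t) x)); first by rewrite add0r.
by move=> r; apply: (@is_derive_translate (fun s => X s x)); exact: is_derive_flow.
Qed.

Lemma flowK t : cancel (X t) (X (- t)).
Proof. by move=> x; rewrite -flowD addrC subrr flow0. Qed.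

Lemma flowNK t : cancel (X (- t)) (X t).
Proof. by move=> x; rewrite -flowD subrr flow0. Qed.

Lemma flow_periodic t x (k : 'rV[int]_d) : X t (x + map_mx intr k) = X t x + map_mx intr k.
Proof.
apply/esym; apply: (@flow_uniq (fun s => X s x + map_mx intr k)); first by rewrite flow0.
move=> s; rewrite hb.2; have := is_derive_flow x s => ?.
by apply: is_derive_eq; rewrite addr0.
Qed.

Lemma flow_displacement (B : R) : (forall x, `|b x| <= B) ->
  forall t x, `|X t x - x| <= B * `|t|.
Proof.
move=> hB t x; rewrite -[in X in _ - X](flow0 x).
by apply: (@mean_value_ineq _ _ (fun s => X s x) (fun s => b (X s x))) => // s; exact: is_derive_flow.
Qed.

(** The curve s |-> X_s(x) - s b(x) has derivative b(X_s x) - b(x), of norm at most L B |s|: a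
    Lipschitz bounded field already gives a second-order remainder. *)
Lemma flow_displacement2 : exists2 C : R, 0 <= C &
  forall t x, `|X t x - x - t *: b x| <= C * t ^+ 2.
Proof.
have [B B0 hB] := field_bounded hb; have [L L0 hL] := field_lipschitz hb.
exists (L * B) => [|t x]; first by rewrite mulr_ge0.
have := @mean_value_ineq _ _ (fun s => X s x - s *: b x) (fun s => b (X s x) - b x) (L * B * `|t|) t.
rewrite flow0 scale0r subr0 addrAC => h; apply: (le_trans (h _ _)).
- move=> s; have := is_derive_flow x s => ?.
  have ? : is_derive s (1 : R) (fun s => s *: b x) (b x).
    have E : (fun h : R => h^-1 *: (((fun s => s *: b x) \o shift s) (h *: 1) - s *: b x)) =
       (fun h => (h^-1 * h) *: b x).
      by apply/funext => h' /=; rewrite -scalerBl addrK scalerA [h' *: 1]mulr1.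
    have cv : (fun h : R => h^-1 *: (((fun s => s *: b x) \o shift s) (h *: 1) - s *: b x)) @ 0^' --> b x.
      rewrite E; apply: cvg_near_cst; near=> h'; rewrite mulVf ?scale1r//.
      by near: h'; exact: nbhs_dnbhs_neq.
    by apply: DeriveDef; [apply/cvg_ex; exists (b x)|apply: cvg_lim].
  exact: is_deriveB.
- move=> s st; rewrite (le_trans (hL _ _))// -mulrA ler_wpM2l//.
  by rewrite (le_trans (flow_displacement hB _ _))// ler_wpM2l.
- by rewrite -mulrA -expr2 real_normK ?num_real.
Unshelve. all: by end_near. Qed.

Lemma flow_continuous t : continuous (X t).
Proof.
move=> x; have [G G0 hG] := flow_lipschitz (normr_ge0 t).
apply/(@cvgrPdist_lt R Rd Rd (nbhs x) (nbhs_filter x)) => e e0; have G1 : 0 < G + 1 by rewrite ltr_wpDl.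
apply/nbhs_ballP; exists (e / (G + 1)) => /=; first by rewrite divr_gt0.
move=> y; rewrite -ball_normE /ball_/= => xy.
have := hG t y (x - y) (lexx _); rewrite [y + _]addrC subrK => h.
rewrite (le_lt_trans h)//.
rewrite (@le_lt_trans _ _ ((G + 1) * `|x - y|)) ?ler_wpM2r ?lerDl//.
by rewrite mulrC -ltr_pdivlMr.
Qed.

(* Each increment W_v = X_s(x+v) - X_s(x) solves the same linear equation
   W' = W Db(X_s x) up to a small error, so by Gronwall it depends almost
   linearly on v; no variational equation has to be solved. *)
Lemma flow_unif_diff (T : R) : 0 <= T -> forall e : R, 0 < e ->
  exists2 r0 : R, 0 < r0 & forall r : R, 0 < r <= r0 -> forall t (x v : Rd), `|t| <= T -> `|v| <= r ->
  `|X t (x + v) - X t x - \sum_i (v ord0 i / r) *: (X t (x + r *: delta_mx ord0 i) - X t x)|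
    <= e * `|v|.
Proof.
move=> T0 e e0; have [J [C [C0 hJ bJ]]] := field_unif_diff hb.
have [G1 G10 hG1] := flow_lipschitz T0; have [G2 G20 hG2] := gronwall (d := d) C0 T0.
pose G := G1 + 1; have G0 : 0 < G by rewrite ltr_wpDl.
have hG t x v : `|t| <= T -> `|X t (x + v) - X t x| <= G * `|v|.
  by move=> tT; rewrite (le_trans (hG1 _ _ _ tT))// ler_wpM2r// lerDl.
(* The error of one linearization of b is amplified by the Lipschitz constant G of the flow, occurs
   for v and for the d basis increments, and passes through Gronwall's constant G2. *)
pose e' := e / ((G2 + 1) * (G * d.+1%:R)).
have e'0 : 0 < e' by rewrite divr_gt0// !mulr_gt0// ltr_wpDl.
have [rho rho0 hrho] := bJ e' e'0.
(* An initial increment of size r grows to at most G r < rho, the range in which b is nearly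
   linear. *)
exists (rho / (2 * G)) => [|r /andP[r0 rr] t x v tT vr]; first by rewrite divr_gt0// mulr_gt0.
have rG : G * r < rho.
  move: rr; rewrite ler_pdivlMr ?mulr_gt0// => h.
  by rewrite (@lt_le_trans _ _ (r * (2 * G)))//; have := mulr_gt0 G0 r0; lra.
pose ei (i : 'I_d) : Rd := r *: delta_mx ord0 i.
have eir i : `|ei i| <= r.
  rewrite normrZ gtr0_norm// -[leRHS]mulr1 ler_pM2l//.
  by apply: rV_norm_le => // j; rewrite mxE eqxx/=; case: eqP => _; rewrite ?normr1 ?normr0.
pose W (v : Rd) s := X s (x + v) - X s x.
pose a i := v ord0 i / r.
have ar i : `|a i| * r <= `|v|.
  by rewrite normrM normfV (gtr0_norm r0) divfK ?gt_eqF// rV_norm_coord.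
pose u s := W v s - \sum_i a i *: W (ei i) s.
pose W' (v : Rd) s := b (X s (x + v)) - b (X s x).
pose u' s := W' v s - \sum_i a i *: W' (ei i) s.
have dW w s : is_derive s (1 : R) (W w) (W' w s).
  by have := is_derive_flow x s; have := is_derive_flow (x + w) s => ? ?; exact: is_deriveB.
have du s : is_derive s (1 : R) u (u' s).
  apply: is_deriveB.
  rewrite (_ : (fun s => \sum_i _) = \sum_i (a i *: W (ei i))); last first.
    by apply/funext => z; rewrite fct_sumE.
  by apply: is_derive_sum => i; exact: is_deriveZ.
have Werr w s : `|w| <= r -> `|s| <= T -> `|W' w s - W w s *m J (X s x)| <= e' * (G * `|w|).
  move=> wr sT; have Wr := hG s x w sT.
  have := hrho (X s x) (W w s); rewrite [_ + W _ _]addrC /W subrK => h.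
  apply: (le_trans (h _)); last by rewrite ler_wpM2l// ltW.
  by rewrite (le_lt_trans Wr)// (le_lt_trans _ rG)// ler_wpM2l// ltW.
have u'u s : `|s| <= T -> `|u' s| <= C * `|u s| + e' * (G * (d.+1%:R * `|v|)).
  move=> sT.
  (* The linear parts regroup, because the same matrix acts on all increments; only the d + 1
     linearization errors are left as a source term. *)
  have -> : u' s = u s *m J (X s x) + ((W' v s - W v s *m J (X s x)) -
     \sum_i a i *: (W' (ei i) s - W (ei i) s *m J (X s x))).
    rewrite /u mulmxBl mulmx_suml.
    under [X in _ - X + _]eq_bigr do rewrite -scalemxAl.
    under [X in _ + (_ - X)]eq_bigr do rewrite scalerBr.
    rewrite sumrB /u'; set A := W v s *m _; set S1 := \sum_i _; set S2 := \sum_i _.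
    by apply/rowP => k; rewrite !mxE; ring.
  rewrite (le_trans (ler_normD _ _))// lerD ?hJ//.
  rewrite (le_trans (ler_normB _ _))//.
  have -> : e' * (G * (d.+1%:R * `|v|)) = e' * (G * `|v|) + d%:R * (e' * (G * `|v|)).
    by rewrite -[d.+1%:R]natr1; ring.
  rewrite lerD ?Werr// (le_trans (ler_norm_sum _ _ _))//.
  rewrite -[d in d%:R]card_ord mulr_natl -sumr_const; apply: ler_sum => i _.
  rewrite normrZ (@le_trans _ _ (`|a i| * (e' * (G * r))))//.
    by rewrite ler_wpM2l// (le_trans (Werr _ _ _ _))// (ler_pM2l e'0) (ler_pM2l G0).
  have -> : `|a i| * (e' * (G * r)) = e' * (G * (`|a i| * r)) by ring.
  by rewrite (ler_pM2l e'0) (ler_pM2l G0).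
have eta0 : 0 <= e' * (G * (d.+1%:R * `|v|)).
  by rewrite mulr_ge0 ?(ltW e'0)// mulr_ge0 ?(ltW G0)// mulr_ge0.
have := hG2 u u' _ eta0 du u'u t tT.
have -> : u 0 = 0.
  rewrite /u /W !flow0 [x + v - x]addrC addKr {1}(row_sum_delta v).
  rewrite -sumrB big1// => i _; rewrite !flow0 [x + _ - x]addrC addKr scalerA divfK ?gt_eqF//.
  by rewrite subrr.
rewrite normr0 add0r => /le_trans; apply.
apply: (@le_trans _ _ ((G2 + 1) * (e' * (G * (d.+1%:R * `|v|))))); first by rewrite ler_wpM2r ?lerDl.
rewrite (_ : _ * _ = e * `|v|)// /e'; field.
have h1 : 1 + d%:R != 0 :> R by rewrite addrC natr1 pnatr_eq0.
have h2 : G2 + 1 != 0 by rewrite gt_eqF// ltr_wpDl.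
by rewrite h1 h2 gt_eqF.
Qed.

(** The slope of psi o X_t is given by difference quotients of step r, valid for all |v| <= r with
    the same r: exactly the data that the quasi-interpolation takes as input. *)
Lemma comp_flow_unif_diff (psi : Rd -> R) (t : R) : Ck 1 psi -> locally_bounded_type psi ->
  (exists2 L : R, 0 <= L & forall x v : Rd, `|psi (X t (x + v)) - psi (X t x)| <= L * `|v|) /\
  forall e : R, 0 < e -> exists2 r0 : R, 0 < r0 & forall r : R, 0 < r <= r0 ->
    forall x v : Rd, `|v| <= r ->
  `|psi (X t (x + v)) - psi (X t x) -
    lin v (fun i => (psi (X t (x + r *: delta_mx ord0 i)) - psi (X t x)) / r)| <= e * `|v|.
Proof.
move=> cpsi lpsi; have [[C C0 hC] udpsi] := Ck1_unif_diff cpsi lpsi.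
have [L L0 hL] := Ck1_lipschitz cpsi lpsi.
have [G1 G10 hG1] := flow_lipschitz (normr_ge0 t).
split.
  exists (L * G1) => [|x v]; first by rewrite mulr_ge0.
  rewrite (le_trans (hL _ _))// -mulrA ler_wpM2l//.
  exact: hG1.
move=> e e0.
pose G := G1 + 1; have G0 : 0 < G by rewrite ltr_wpDl.
have hG x v : `|X t (x + v) - X t x| <= G * `|v|.
  by rewrite (le_trans (hG1 _ _ _ (lexx _)))// ler_wpM2r// lerDl.
(* One half of e pays for the d + 1 linearizations of psi, the other for the nonlinearity of the
   flow, magnified by the gradient bound C. *)
pose e1 := e / 2 / (G * d.+1%:R); pose e2 := e / 2 / (d%:R * C + 1).
have dC0 : 0 < d%:R * C + 1 by rewrite ltr_wpDl// mulr_ge0.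
have e10 : 0 < e1 by rewrite !divr_gt0// mulr_gt0.
have e20 : 0 < e2 by rewrite !divr_gt0.
have [rho rho0 hrho] := udpsi e1 e10.
have [r1 r10 hr1] := flow_unif_diff (normr_ge0 t) e20.
exists (Num.min r1 (rho / (2 * G))) => [|r /andP[r0]].
  by rewrite lt_min r10 divr_gt0// mulr_gt0.
rewrite le_min => /andP[rr1 rr] x v vr.
have rG : G * r < rho.
  move: rr; rewrite ler_pdivlMr ?mulr_gt0// => h.
  by rewrite (@lt_le_trans _ _ (r * (2 * G)))//; have := mulr_gt0 G0 r0; lra.
pose ei (i : 'I_d) : Rd := r *: delta_mx ord0 i.
have eir i : `|ei i| <= r.
  rewrite normrZ gtr0_norm// -[leRHS]mulr1 ler_pM2l//.
  by apply: rV_norm_le => // j; rewrite mxE eqxx/=; case: eqP => _; rewrite ?normr1 ?normr0.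
pose P y i := partial i psi y.
pose W (v : Rd) := X t (x + v) - X t x.
pose F (v : Rd) := psi (X t (x + v)) - psi (X t x).
have Ferr w : `|w| <= r -> `|F w - lin (W w) (P (X t x))| <= e1 * (G * `|w|).
  move=> wr; have Wr := hG x w.
  have := hrho (X t x) (W w); rewrite [_ + W _]addrC /W subrK => h.
  apply: (le_trans (h _)); last by rewrite ler_wpM2l// ltW.
  by rewrite (le_lt_trans Wr)// (le_lt_trans _ rG)// ler_wpM2l// ltW.
pose a i := v ord0 i / r.
have ar i : `|a i| * r <= `|v|.
  by rewrite normrM normfV (gtr0_norm r0) divfK ?gt_eqF// rV_norm_coord.
have -> : lin v (fun i => (psi (X t (x + r *: delta_mx ord0 i)) - psi (X t x)) / r) =
    \sum_i a i * F (ei i).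
  by apply: eq_bigr => i _; rewrite /a mulrAC mulrA.
(* Each increment of psi is compared with its linearization at X_t(x); the linear parts combine into
   the defect of linearity of the flow itself. *)
have -> : F v - \sum_i a i * F (ei i) = (F v - lin (W v) (P (X t x))) -
    \sum_i a i * (F (ei i) - lin (W (ei i)) (P (X t x))) +
    lin (W v - \sum_i a i *: W (ei i)) (P (X t x)).
  rewrite linD linN lin_sum.
  under [X in _ - _ + (_ - X)]eq_bigr do rewrite linZ.
  under [X in _ - X + _]eq_bigr do rewrite mulrBr.
  by rewrite sumrB; ring.
have -> : e * `|v| = e1 * (G * `|v|) + d%:R * (e1 * (G * `|v|)) + (d%:R * C + 1) * (e2 * `|v|).
  rewrite /e1 /e2 -[d.+1%:R]natr1; field.
  by rewrite !gt_eqF// ltr_wpDl.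
rewrite (le_trans (ler_normD _ _))// lerD//; last first.
  rewrite (le_trans (lin_le _ (hC _)))// ler_pM// ?mulr_ge0// ?lerDl//.
  by apply: hr1; rewrite ?r0.
rewrite (le_trans (ler_normB _ _))// lerD ?Ferr//.
rewrite (le_trans (ler_norm_sum _ _ _))//.
rewrite -[d in d%:R]card_ord mulr_natl -sumr_const; apply: ler_sum => i _.
rewrite normrM (@le_trans _ _ (`|a i| * (e1 * (G * r))))//.
  by rewrite ler_wpM2l// (le_trans (Ferr _ _))// (ler_pM2l e10) (ler_pM2l G0).
have -> : `|a i| * (e1 * (G * r)) = e1 * (G * (`|a i| * r)) by ring.
by rewrite (ler_pM2l e10) (ler_pM2l G0).
Qed.

End flow.

(** * Quasi-interpolation by smooth functions *)

Section Ck_closure.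
Context {R : realType} {d : nat}.
Local Notation Rd := 'rV[R]_d.
Implicit Types f g : Rd -> R.

Lemma CkW k f : Ck k.+1 f -> Ck k f.
Proof.
elim: k f => [|k ih] f [df cf]; first by move=> x; exact: differentiable_continuous.
by split=> // v; apply: ih; exact: cf.
Qed.

Lemma Ck_cst k (c : R) : Ck k (fun _ : Rd => c).
Proof.
elim: k c => [|k ih] c; first exact: cst_continuous.
split=> [x|v]; first exact: differentiable_cst.
by rewrite (_ : 'D_v _ = (fun=> 0))//; apply/funext => x; exact: derive_cst.
Qed.

Lemma CkD k f g : Ck k f -> Ck k g -> Ck k (fun x => f x + g x).
Proof.
elim: k f g => [|k ih] f g; first by move=> cf cg x; exact: (@cvgD _ _ _ (nbhs x) (nbhs_filter x) f g _ _ (cf x) (cg x)).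
move=> [df cf] [dg cg]; split=> [x|v]; first exact: differentiableD.
rewrite (_ : 'D_v _ = (fun x => 'D_v f x + 'D_v g x)); first by apply: ih; [exact: cf|exact: cg].
by apply/funext => x; rewrite -deriveD//; exact: diff_derivable.
Qed.

Lemma CkM k f g : Ck k f -> Ck k g -> Ck k (fun x => f x * g x).
Proof.
elim: k f g => [|k ih] f g; first by move=> cf cg x; exact: (@cvgM _ _ (nbhs x) (nbhs_filter x) f g _ _ (cf x) (cg x)).
move=> hf hg; have [df cf] := hf; have [dg cg] := hg.
split=> [x|v]; first exact: differentiableM.
rewrite (_ : 'D_v _ = (fun x => f x * 'D_v g x + g x * 'D_v f x)).
  by apply: CkD; apply: ih; [exact: CkW hf|exact: cg|exact: CkW hg|exact: cf].
apply/funext => x; rewrite (_ : (fun x => f x * g x) = f * g)//.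
by rewrite deriveM//; exact: diff_derivable.
Qed.

Lemma Ck_sum_seq k (I : Type) (s : seq I) (f : I -> Rd -> R) :
  (forall i, Ck k (f i)) -> Ck k (fun x => \sum_(i <- s) f i x).
Proof.
move=> hf; elim: s => [|i s ih].
  rewrite (_ : (fun x => _) = (fun=> 0)); first exact: Ck_cst.
  by apply/funext => x; rewrite big_nil.
rewrite (_ : (fun x => _) = (fun x => f i x + \sum_(i <- s) f i x)); first exact: CkD.
by apply/funext => x; rewrite big_cons.
Qed.

Lemma Ck_prod k (I : finType) (f : I -> Rd -> R) :
  (forall i, Ck k (f i)) -> Ck k (fun x => \prod_i f i x).
Proof.
move=> hf; suff : forall s : seq I, Ck k (fun x => \prod_(i <- s) f i x) by apply.
elim=> [|i s ih].
  rewrite (_ : (fun x => _) = (fun=> 1)); first exact: Ck_cst.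
  by apply/funext => x; rewrite big_nil.
rewrite (_ : (fun x => _) = (fun x => f i x * \prod_(i <- s) f i x)); first exact: CkM.
by apply/funext => x; rewrite big_cons.
Qed.

Lemma derive_lineE f (x v : Rd) : 'D_v f x = 'D_(1 : R) (fun s : R => f (x + s *: v)) 0.
Proof.
rewrite /derive.
suff -> : (fun h : R => h^-1 *: ((f \o shift x) (h *: v) - f x)) =
  (fun h : R => h^-1 *: (((fun s : R => f (x + s *: v)) \o shift 0) (h *: 1) - f (x + 0 *: v))) by [].
by apply/funext => h /=; rewrite scale0r !addr0 [h *: 1]mulr1 [_ *: v + x]addrC.
Qed.

Lemma Ck_comp_coord k (h : R -> R) i : diffn k h -> Ck k (fun x : Rd => h (x ord0 i)).
Proof.
elim: k h => [|k ih] h.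
  move=> ch x; apply: (@continuous_comp _ _ _ (fun x : Rd => x ord0 i)); last exact: ch.
  exact: coord_continuous.
move=> [h' dh hh']; split=> [x|v].
  apply: (@differentiable_comp _ _ _ _ (fun x : Rd => x ord0 i)).
    exact: differentiable_coord.
  by apply/derivable1_diffP; have := dh (x ord0 i) => -[].
rewrite (_ : 'D_v _ = (fun x : Rd => h' (x ord0 i) * v ord0 i)).
  by apply: CkM; [exact: ih|exact: Ck_cst].
apply/funext => x; rewrite derive_lineE.
have dl : is_derive (0 : R) (1 : R) (fun s : R => x ord0 i + s * v ord0 i) (v ord0 i).
  by apply: is_derive_eq; rewrite /GRing.scale/=; ring.
have := dh (x ord0 i + 0 * v ord0 i); rewrite mul0r addr0 => dhx.
rewrite (_ : (fun s => _) = h \o (fun s : R => x ord0 i + s * v ord0 i)); last first.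
  by apply/funext => s /=; rewrite !mxE.
apply: derive_val; apply: is_derive1_comp => //=.
by rewrite mul0r addr0.
Qed.

Lemma partial_sum_seq (I : Type) (s : seq I) (f : I -> Rd -> R) j x : (forall i, Ck 1 (f i)) ->
  partial j (fun x => \sum_(i <- s) f i x) x = \sum_(i <- s) partial j (f i) x.
Proof.
move=> hf; pose F (s : seq I) x := \sum_(i <- s) f i x.
rewrite -/(F s); elim: s => [|i s ih].
  rewrite big_nil (_ : F [::] = (fun=> 0)); first exact: derive_cst.
  by apply/funext => y; rewrite /F big_nil.
have -> : F (i :: s) = f i + F s by apply/funext => y; rewrite /F big_cons.
have dF : derivable (F s) x (delta_mx ord0 j).
  apply: diff_derivable; have := @Ck_sum_seq 1 I s f hf; rewrite -/(F s).
  by move=> [+ _]; apply.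
have dfi : derivable (f i) x (delta_mx ord0 j).
  by apply: diff_derivable; have [+ _] := hf i; apply.
by rewrite big_cons -ih /partial deriveD.
Qed.

Lemma partial_tensor (g g' : 'I_d -> R -> R) j x :
  (forall i s, is_derive s (1 : R) (g i) (g' i s)) ->
  partial j (fun x => \prod_i g i (x ord0 i)) x =
  \prod_i (if i == j then g' i (x ord0 i) else g i (x ord0 i)).
Proof.
move=> dg; rewrite /partial derive_lineE.
pose c := \prod_(i | i != j) g i (x ord0 i).
rewrite [RHS](bigD1 j)//= eqxx (eq_bigr (fun i => g i (x ord0 i))); last by move=> i /negbTE ->.
rewrite -/c.
rewrite (_ : (fun s => _) = (fun s : R => g j (s + x ord0 j) * c)); last first.
  apply/funext => s; rewrite (bigD1 j)//= !mxE !eqxx mulr1 addrC; congr (_ * _).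
  by apply: eq_bigr => i /negbTE ij; rewrite !mxE ij andbF mulr0 addr0.
apply: derive_val.
have dl : is_derive (0 : R) (1 : R) (fun s : R => s + x ord0 j) 1.
  by apply: is_derive_eq; rewrite addr0.
have dgj : is_derive (0 : R) (1 : R) (g j \o (fun s : R => s + x ord0 j)) (g' j (x ord0 j) * 1).
  by apply: is_derive1_comp => //; have := dg j (x ord0 j); rewrite add0r.
have := is_deriveM dgj (is_derive_cst c (0 : R) (1 : R)) => h.
apply: (is_derive_eq h).
by rewrite scaler0 add0r mulr1 /GRing.scale/= mulrC.
Qed.

End Ck_closure.

(** * Second differences and their telescoping sums *)

Section second_difference.
Context {R : realType}.
Implicit Types (S : R -> R) (y z : R).

Definition second_diff S y := S (y + 1) - 2 * S y + S (y - 1).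

Lemma sum_second_diff S z (N : nat) :
  \sum_(j < N) second_diff S (z - j%:R) = (S (z + 1) - S z) - (S (z - N%:R + 1) - S (z - N%:R)).
Proof.
elim: N => [|N ih]; first by rewrite big_ord0 subr0 subrr.
rewrite big_ord_recr/= ih /second_diff -[N.+1%:R]natr1.
have -> : z - (N%:R + 1) + 1 = z - N%:R by ring.
have -> : z - (N%:R + 1) = z - N%:R - 1 by ring.
by ring.
Qed.

(** Summation by parts. If S is the identity near z and 0 near z - N, the right-hand side is z: this
    is how the bumps reproduce the identity function. *)
Lemma sum_second_diff1 S z (N : nat) :
  \sum_(j < N) j%:R * second_diff S (z - j%:R) =
  S z - S (z - N%:R) - N%:R * (S (z - N%:R + 1) - S (z - N%:R)).
Proof.
elim: N => [|N ih]; first by rewrite big_ord0 subr0 subrr mul0r subr0.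
rewrite big_ord_recr/= ih /second_diff -[N.+1%:R]natr1.
have -> : z - (N%:R + 1) + 1 = z - N%:R by ring.
have -> : z - (N%:R + 1) = z - N%:R - 1 by ring.
by ring.
Qed.

Let clamp y : R := Num.max (- 4) (Num.min y 4).

(** Counting the integers within distance 3 of z is avoided: [clamp] gains exactly 1 over [y, y + 1]
    when |y| < 3 and never decreases, so the sum telescopes to at most its total variation 8. The
    bound does not depend on N. *)
Lemma sum_translates_le (F : R -> R) (K z : R) (N : nat) :
  (forall y, `|F y| <= K) -> (forall y, 3 <= `|y| -> F y = 0) ->
  \sum_(j < N) `|F (z - j%:R)| <= 8 * K.
Proof.
move=> FK F0; have K0 : 0 <= K by rewrite (le_trans _ (FK 0)).
have clF y : `|F y| <= K * (clamp (y + 1) - clamp y).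
  have [y3|y3] := leP 3 `|y|.
    rewrite F0// normr0 mulr_ge0// subr_ge0 /clamp.
    by rewrite ge_max !le_max lexx/= le_min !ge_min lerDl ler01 lexx/= !orbT.
  suff -> : clamp (y + 1) - clamp y = 1 by rewrite mulr1.
  move: y3; rewrite ltr_norml => /andP[y1 y2].
  by rewrite /clamp !min_l ?max_r; lra.
have clb y : - 4 <= clamp y <= 4.
  by rewrite /clamp le_max lexx/= ge_max ge_min lexx orbT andbT; lra.
apply: (@le_trans _ _ (\sum_(j < N) K * (clamp (z - j%:R + 1) - clamp (z - j%:R)))).
  by apply: ler_sum => j _; exact: clF.
rewrite -mulr_sumr mulrC ler_wpM2r//.
have -> : \sum_(j < N) (clamp (z - j%:R + 1) - clamp (z - j%:R)) =
    clamp (z + 1) - clamp (z - N%:R + 1).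
  elim: N => [|N ih]; first by rewrite big_ord0 subr0 subrr.
  rewrite big_ord_recr/= ih -[N.+1%:R]natr1.
  have -> : z - (N%:R + 1) + 1 = z - N%:R by ring.
  by ring.
have := clb (z + 1); have := clb (z - N%:R + 1); lra.
Qed.

End second_difference.

(** * A smooth bump reproducing affine functions *)

Section bspline.
Context {R : realType}.

Definition smooth_ramp (y : R) : R := y * smooth_step y.

Lemma diffn_smooth_ramp k : diffn k smooth_ramp.
Proof. by apply: diffnM; [exact: diffn_id|exact: diffn_smooth_step]. Qed.

(** From the ramp max(y, 0) this would be the hat function. Rounding the corner makes it smooth
    without losing the reproduction of affine functions, as the telescoped sums only see the ramp
    away from the corner. *)
Definition bspline : R -> R := second_diff smooth_ramp.

Lemma diffn_second_diff k (S : R -> R) : diffn k S -> diffn k (second_diff S).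
Proof.
move=> hS.
have h (c : R) : diffn k (fun y => S (y + c)).
  rewrite (_ : (fun y => _) = (fun y => S (1 * y + c))); first exact: diffn_affine.
  by apply/funext => y; rewrite mul1r.
rewrite (_ : second_diff S = (fun y => (S (y + 1) + (- 2) * S y) + S (y + (- 1)))).
  by apply: diffnD => //; apply: diffnD => //; exact: diffnZ.
by apply/funext => y; rewrite mulNr.
Qed.

Lemma smooth_ramp0 y : y <= 0 -> smooth_ramp y = 0.
Proof. by move=> y0; rewrite /smooth_ramp smooth_step0// mulr0. Qed.

Lemma smooth_ramp1 y : 1 <= y -> smooth_ramp y = y.
Proof. by move=> y1; rewrite /smooth_ramp smooth_step1// mulr1. Qed.

(* The translates of the bump [bspline] form a partition of unity that also
   reproduces affine functions. *)
Lemma bspline_exists : exists (chi' : R -> R) (K : R),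
  [/\ (forall y : R, is_derive y (1 : R) bspline (chi' y)),
      (forall y : R, `|bspline y| <= K /\ `|chi' y| <= K),
      (forall y : R, 3 <= `|y| -> bspline y = 0 /\ chi' y = 0),
      (forall (z : R) (N : nat), 3 <= z <= N%:R - 3 -> \sum_(j < N) bspline (z - j%:R) = 1 /\
          \sum_(j < N) chi' (z - j%:R) = 0) &
      (forall (z : R) (N : nat), 3 <= z <= N%:R - 3 -> \sum_(j < N) j%:R * bspline (z - j%:R) = z /\
          \sum_(j < N) j%:R * chi' (z - j%:R) = 1)].
Proof.
have [S' dS cS] := @diffn_smooth_ramp 2.
have S'0 y : y < 0 -> S' y = 0.
  move=> y0; have := dS y => -[_ <-].
  rewrite (@near_eq_derive _ _ _ smooth_ramp (fun=> 0)); first exact: derive_cst.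
  by near=> z; rewrite smooth_ramp0// ltW//; near: z; exact: lt_nbhsl.
have S'1 y : 1 < y -> S' y = 1.
  move=> y1; have := dS y => -[_ <-].
  rewrite (@near_eq_derive _ _ _ smooth_ramp id); first exact: derive_id.
  by near=> z; rewrite smooth_ramp1// ltW//; near: z; exact: lt_nbhsr.
pose chi' := second_diff S'.
have dchi (y : R) : is_derive y (1 : R) bspline (chi' y).
  have h (c : R) : is_derive y (1 : R) (fun y => smooth_ramp (y + c)) (S' (y + c)).
    have dl : is_derive y (1 : R) (fun y => y + c) 1 by apply: is_derive_eq; rewrite addr0.
    by have := @is_derive1_comp _ smooth_ramp (fun y => y + c) y _ _ (dS (y + c)) dl; rewrite mulr1.
  have h0 := dS y; have h1 := h 1; have h2 := h (- 1).
  by apply: is_derive_eq; rewrite /chi' /second_diff /GRing.scale/=; ring.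
have z3 y : 3 <= `|y| -> bspline y = 0 /\ chi' y = 0.
  rewrite ler_normr => /orP[y3|y3].
    by rewrite /bspline /chi' /second_diff !smooth_ramp1 ?S'1; try lra; split; ring.
  by rewrite /bspline /chi' /second_diff !smooth_ramp0 ?S'0; try lra; split; ring.
have cchi : continuous bspline by apply: (@diffn_second_diff 0); exact: (@diffn_smooth_ramp 0).
have cchi' : continuous chi' by apply: (@diffn_second_diff 0); exact: diffnW.
have bnd (F : R -> R) : continuous F -> (forall y, 3 <= `|y| -> F y = 0) ->
    exists K, forall y, `|F y| <= K.
  move=> cF F0.
  have [||c _ hc] := @EVT_max R (fun y => `|F y|) (- 3) 3; first lra.
    apply: continuous_subspaceT => y; apply: continuous_comp; first exact: cF.
    exact: norm_continuous.
  exists `|F c| => y; have [y3|y3] := leP 3 `|y|; first by rewrite F0// normr0.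
  by apply: hc; rewrite in_itv/=; move: y3; rewrite ltr_norml => /andP[? ?]; lra.
have [K1 hK1] := bnd _ cchi (fun y h => (z3 y h).1).
have [K2 hK2] := bnd _ cchi' (fun y h => (z3 y h).2).
(* The margin 3 puts the four end points of the telescoped sums where the ramp is exactly y or
   exactly 0. *)
have ends (z : R) (N : nat) : 3 <= z <= N%:R - 3 ->
    [/\ smooth_ramp (z + 1) = z + 1, smooth_ramp z = z,
        smooth_ramp (z - N%:R + 1) = 0 & smooth_ramp (z - N%:R) = 0] /\
    [/\ S' (z + 1) = 1, S' z = 1, S' (z - N%:R + 1) = 0 & S' (z - N%:R) = 0].
  move=> /andP[z1 z2].
  by split; split; first [by apply: smooth_ramp1; lra | by apply: smooth_ramp0; lra
    | by apply: S'1; lra | by apply: S'0; lra].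
exists chi', (Num.max K1 K2); split => //.
- by move=> y; rewrite !le_max hK1 hK2 orbT.
- move=> z N /ends[[e1 e2 e3 e4] [e5 e6 e7 e8]].
  by rewrite !sum_second_diff e1 e2 e3 e4 e5 e6 e7 e8; split; ring.
- move=> z N /ends[[e1 e2 e3 e4] [e5 e6 e7 e8]].
  by rewrite !sum_second_diff1 e2 e3 e4 e6 e7 e8; split; ring.
Unshelve. all: by end_near. Qed.

End bspline.

Section quasi_interpolation.
Context {R : realType} {d : nat}.
Local Notation Rd := 'rV[R]_d.

Lemma norm_gt_coord (x : Rd) (M : R) : 0 <= M -> M < `|x| -> exists i, M < `|x ord0 i|.
Proof.
move=> M0 Mx; apply: contrapT => /forallNP h.
suff : `|x| <= M by rewrite leNgt Mx.
by apply: rV_norm_le => // i; rewrite leNgt; apply/negP; exact: h.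
Qed.

(* phi(x) = \sum_k f (delta k) prod_i bspline (x_i / delta - k_i); since
   the sums of the translates of bspline' against 1 and k are 0 and 1, its
   partial derivatives at x recover those of the affine part of f at x. *)
Lemma smooth_quasi_interpolation : exists2 C : R, 0 <= C &
  forall (f : Rd -> R) (A : Rd -> 'I_d -> R) (e r R0 : R), 0 <= e -> 0 < r -> 0 <= R0 ->
  (forall x : Rd, R0 < `|x| -> f x = 0) ->
  (forall x : Rd, R0 + r < `|x| -> forall i, A x i = 0) ->
  (forall x v : Rd, `|v| <= r -> `|f (x + v) - f x - lin v (A x)| <= e * `|v|) ->
  exists phi : Rd -> R, [/\ smooth phi,
    forall x : Rd, R0 + r < `|x| -> phi x = 0,
    forall x : Rd, R0 + r < `|x| -> forall j, partial j phi x = 0 &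
    forall (x : Rd) j, `|partial j phi x - A x j| <= C * e].
Proof.
have [chi' [K [dchi bK z3 s0 s1]]] := @bspline_exists R.
have K0 : 0 <= K by rewrite (le_trans _ (bK 0).1).
(* Each coordinate contributes 8 K by [sum_translates_le]; the 4 is r / delta, from the error e r at
   the nodes divided by the mesh. *)
exists (4 * (8 * K) ^+ d); first by rewrite mulr_ge0// exprn_ge0// mulr_ge0.
move=> f A e r R0 e0 r0 R00 fR AR fA.
(* A bump has support of radius 3 delta < r, so only nodes within r of x matter, where the remainder
   bound on f applies. *)
pose delta := r / 4.
have de0 : 0 < delta by rewrite divr_gt0.
have den0 : delta != 0 by rewrite gt_eqF.
(* The grid is centred at 0 and exceeds the ball of radius R0 + r by enough meshes for the moment
   identities to hold at every point of that ball. *)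
have [M hM] : exists M : nat, (R0 + r) / delta + 4 <= M%:R.
  exists (Num.bound ((R0 + r) / delta + 4)); apply: ltW.
  have := archi_boundP (_ : 0 <= (R0 + r) / delta + 4); apply.
  by rewrite addr_ge0// divr_ge0 ?addr_ge0// ltW.
pose N := (2 * M).+1.
pose p (k : {ffun 'I_d -> 'I_N}) : Rd := \row_i (delta * ((k i)%:R - M%:R)).
pose z (x : Rd) i : R := x ord0 i / delta + M%:R.
pose term (g : 'I_d -> R -> R) (k : {ffun 'I_d -> 'I_N}) (x : Rd) :=
  \prod_i g i (z x i - (k i)%:R).
pose H (j i : 'I_d) := if i == j then chi' else bspline.
have far g k x : (forall i y, 3 <= `|y| -> g i y = 0) -> r < `|p k - x| -> term g k x = 0.
  move=> g0 kx; have [i] := norm_gt_coord (ltW r0) kx.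
  rewrite !mxE => hi; rewrite /term (bigD1 i)//= g0 ?mul0r//.
  have -> : z x i - (k i)%:R = - ((delta * ((k i)%:R - M%:R) - x ord0 i) / delta).
    by rewrite /z; field.
  rewrite normrN normrM normfV (gtr0_norm de0) ler_pdivlMr// (le_trans _ (ltW hi))//.
  by rewrite /delta; lra.
have H3 j i y : 3 <= `|y| -> H j i y = 0.
  by move=> /z3[? ?]; rewrite /H; case: ifP.
(* A nonzero term needs a node in the ball of radius R0 and at distance at most r from x. *)
have fp (k : {ffun 'I_d -> 'I_N}) x g : (forall i y, 3 <= `|y| -> g i y = 0) ->
    R0 + r < `|x| -> f (p k) * term g k x = 0.
  move=> g0 xR; have [pR|pR] := ltP R0 `|p k|; first by rewrite fR// mul0r.
  rewrite far ?mulr0//.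
  by have := lerB_dist x (p k); rewrite distrC; move: xR pR; lra.
pose phi x := \sum_k f (p k) * term (fun=> bspline) k x.
have dterm k j x : partial j (fun x => f (p k) * term (fun=> bspline) k x) x =
    delta^-1 * (f (p k) * term (H j) k x).
  pose g (i : 'I_d) (y : R) := bspline (delta^-1 * y + (M%:R - (k i)%:R)).
  pose g' (i : 'I_d) (y : R) := chi' (delta^-1 * y + (M%:R - (k i)%:R)) * delta^-1.
  have dg i (y : R) : is_derive y (1 : R) (g i) (g' i y).
    have dl : is_derive y (1 : R) (fun y => delta^-1 * y + (M%:R - (k i)%:R)) delta^-1.
      by apply: is_derive_eq; rewrite /GRing.scale/=; ring.
    by apply: is_derive1_comp.
  have cg i : diffn 1 (g i).
    by apply: diffn_affine; apply: diffn_second_diff; exact: diffn_smooth_ramp.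
  have E : (fun x => f (p k) * term (fun=> bspline) k x) =
      f (p k) *: (fun x : Rd => \prod_i g i (x ord0 i)).
    apply/funext => y; rewrite /term /g; congr (_ * _).
    by apply: eq_bigr => i _; congr bspline; rewrite /z; ring.
  rewrite E /partial deriveZ; last first.
    apply: diff_derivable.
    have : Ck 1 (fun x : Rd => \prod_i g i (x ord0 i)).
      by apply: Ck_prod => i; exact: Ck_comp_coord.
    by move=> [+ _]; apply.
  rewrite -/(partial j _ x) (partial_tensor _ _ dg) mulrCA; congr (_ * _).
  rewrite /term (bigD1 j)//= [in RHS](bigD1 j)//= /H eqxx /g' mulrAC mulrC.
  congr (_ * (_ * _)).
    by congr chi'; rewrite /z; ring.
  apply: eq_bigr => i /negbTE ->; congr bspline; rewrite /z; ring.
have cterm n k : Ck n (fun x => f (p k) * term (fun=> bspline) k x).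
  apply: CkM; first exact: Ck_cst.
  apply: Ck_prod => i.
  rewrite (_ : (fun x => _) = (fun x : Rd => bspline (delta^-1 * x ord0 i + (M%:R - (k i)%:R)))).
    apply: (@Ck_comp_coord _ _ n (fun y => bspline (delta^-1 * y + (M%:R - (k i)%:R)))).
    by apply: diffn_affine; apply: diffn_second_diff; exact: diffn_smooth_ramp.
  by apply/funext => y; congr bspline; rewrite /z; ring.
have dphi j x : partial j phi x = delta^-1 * \sum_k f (p k) * term (H j) k x.
  rewrite partial_sum_seq// mulr_sumr; apply: eq_bigr => k _; exact: dterm.
exists phi; split.
- by move=> n; exact: Ck_sum_seq.
- by move=> x xR; rewrite /phi big1// => k _; apply: fp => // i y /z3[].
- by move=> x xR j; rewrite dphi big1 ?mulr0// => k _; apply: fp => // i y; exact: H3.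
move=> x j; have [xR|xR] := ltP (R0 + r) `|x|.
  rewrite dphi AR// subr0 big1 ?mulr0 ?normr0; last by move=> k _; apply: fp => // i y; exact: H3.
  by rewrite mulr_ge0// mulr_ge0// exprn_ge0// mulr_ge0.
have zN i : 3 <= z x i <= N%:R - 3.
  have /ler_normlP[h1 h2] := le_trans (rV_norm_coord x i) xR.
  have h3 : x ord0 i / delta <= (R0 + r) / delta by rewrite ler_pM2r ?invr_gt0.
  have h4 : - (x ord0 i / delta) <= (R0 + r) / delta by rewrite -mulNr ler_pM2r ?invr_gt0.
  have -> : (N%:R : R) = 2 * M%:R + 1 by rewrite /N -addn1 natrD natrM.
  rewrite /z; move: hM h3 h4.
  by move: (x ord0 i / delta) ((R0 + r) / delta) (M%:R : R) => u v w *; apply/andP; split; lra.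
(* Distributivity reduces all moments on the grid to the one-variable sums [s0] and [s1]. *)
have sumH (g : 'I_d -> R -> R -> R) : \sum_(k : {ffun 'I_d -> 'I_N}) \prod_i g i (z x i - (k i)%:R) ((k i)%:R) =
    \prod_i \sum_(n < N) g i (z x i - n%:R) n%:R.
  by rewrite bigA_distr_bigA.
have S0 : \sum_k term (H j) k x = 0.
  rewrite /term (sumH (fun i y _ => H j i y)) (bigD1 j)//= /H eqxx.
  by rewrite (s0 _ _ (zN j)).2 mul0r.
have S1 l : \sum_k term (H j) k x * (p k - x) ord0 l = if l == j then delta else 0.
  transitivity (\sum_(k : {ffun 'I_d -> 'I_N}) \prod_i (H j i (z x i - (k i)%:R) *
      (if i == l then delta * ((k i)%:R - z x i) else 1))).
    apply: eq_bigr => k _; rewrite big_split/= -/(term _ _ _); congr (_ * _).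
    rewrite (bigD1 l)//= eqxx big1 ?mulr1; last by move=> i /negbTE ->.
    by rewrite !mxE /z; field.
  rewrite (sumH (fun i y n => H j i y * (if i == l then delta * (n - z x i) else 1))).
  have [->|lj] := eqVneq l j.
    rewrite (bigD1 j)//= eqxx [X in _ * X]big1 ?mulr1; last first.
      move=> i ij; rewrite (negbTE ij) /H (negbTE ij).
      by under eq_bigr do rewrite mulr1; exact: (s0 _ _ (zN i)).1.
    under eq_bigr => n _.
      rewrite /H eqxx (_ : _ * _ = delta * (n%:R * chi' (z x j - n%:R)) -
        delta * z x j * chi' (z x j - n%:R)); last by ring.
      over.
    by rewrite sumrB -!mulr_sumr (s0 _ _ (zN j)).2 (s1 _ _ (zN j)).2; ring.
  rewrite (bigD1 j)//= [j == l]eq_sym (negbTE lj) /H eqxx.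
  by under eq_bigr do rewrite mulr1; rewrite (s0 _ _ (zN j)).2 mul0r.
have Slin : \sum_k term (H j) k x * lin (p k - x) (A x) = delta * A x j.
  transitivity (\sum_l A x l * \sum_k term (H j) k x * (p k - x) ord0 l).
    under eq_bigr do rewrite /lin mulr_sumr.
    rewrite exchange_big/=; apply: eq_bigr => l _; rewrite mulr_sumr.
    by apply: eq_bigr => k _; rewrite mulrA mulrC.
  rewrite (bigD1 j)//= S1 eqxx big1 ?addr0 1?mulrC//.
  by move=> l /negbTE lj; rewrite S1 lj mulr0.
pose err k := f (p k) - f x - lin (p k - x) (A x).
(* Replacing f by its remainder at x changes nothing but A x j: the constant part has zero sum and
   the linear part sums to delta A x j. *)
have -> : partial j phi x - A x j = delta^-1 * \sum_k term (H j) k x * err k.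
  have -> : \sum_k term (H j) k x * err k = \sum_k f (p k) * term (H j) k x -
      f x * (\sum_k term (H j) k x) - \sum_k term (H j) k x * lin (p k - x) (A x).
    by rewrite mulr_sumr -!sumrB; apply: eq_bigr => k _; rewrite /err; ring.
  by rewrite S0 Slin dphi mulr0 subr0 mulrBr mulKf.
have errle k : `|term (H j) k x * err k| <= e * r * `|term (H j) k x|.
  have [pr|pr] := ltP r `|p k - x|; first by rewrite (far _ _ _ (H3 j) pr) mul0r !normr0 mulr0.
  rewrite normrM mulrC ler_wpM2r//.
  have := fA x (p k - x) pr; rewrite [x + _]addrC subrK => h.
  by rewrite (le_trans h)// ler_wpM2l.
rewrite normrM normfV (gtr0_norm de0).
apply: (@le_trans _ _ (delta^-1 * (e * r * (8 * K) ^+ d))); last first.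
  by rewrite /delta -subr_ge0 le_eqVlt; apply/orP; left; apply/eqP; field; rewrite gt_eqF.
rewrite ler_pM2l ?invr_gt0// (le_trans (ler_norm_sum _ _ _))//.
apply: (le_trans (ler_sum _ (fun k _ => errle k))).
rewrite -mulr_sumr ler_wpM2l ?mulr_ge0// ?(ltW r0)//.
rewrite /term; under eq_bigr do rewrite normr_prod.
rewrite (sumH (fun i y _ => `|H j i y|)) -[d in _ ^+ d]card_ord -prodr_const.
apply: ler_prod => i _; rewrite sumr_ge0//=; apply: sum_translates_le.
  by move=> y; rewrite /H; case: ifP => _; have [] := bK y.
by move=> y; exact: H3.
Qed.

End quasi_interpolation.

(** * Smooth substitutes for a test function carried by the flow *)

Section flow_test_function.
Context {R : realType} {d : nat}.
Local Notation Rd := 'rV[R]_d.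
Variable b : Rd -> Rd.
Hypothesis hb : Ck_sharp 1 b.
Variable X : R -> Rd -> Rd.
Hypothesis hX : is_flow b X.

(** The radius [Q] comes before [eta]: the error eta |s| is later integrated over the ball of radius
    Q, whose mass has to be known when eta is chosen. *)
Lemma flow_test_function (psi : Rd -> R) (R0 t : R) : 0 <= R0 -> Ck 1 psi ->
  (forall x : Rd, R0 < `|x| -> psi x = 0) ->
  exists2 Q : R, 0 <= Q & forall eta : R, 0 < eta ->
  exists (phi : Rd -> R) (s0 : R),
  [/\ smooth phi, (forall x : Rd, Q < `|x| -> phi x = 0), 0 < s0,
    (forall (s : R) (x : Rd), `|s| < s0 -> Q < `|x| ->
      [/\ psi (X (t + s) x) = 0, psi (X t x) = 0 & forall j, partial j phi x = 0]) &
    forall (s : R) (x : Rd), `|s| < s0 ->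
      `|psi (X (t + s) x) - psi (X t x) - s * lin (b x) (fun j => partial j phi x)|
        <= eta * `|s|].
Proof.
move=> R00 cpsi psi0; have [B B0 hB] := field_bounded hb.
have [C2 C20 hC2] := flow_displacement2 hb hX.
have [[L L0 hL] ud] := comp_flow_unif_diff hb hX t cpsi (bounded_support_lbt psi0).
have [C C0 qi] := @smooth_quasi_interpolation R d.
pose f x := psi (X t x).
pose R1 := R0 + B * `|t|; have R10 : 0 <= R1 by rewrite addr_ge0// mulr_ge0.
have far (s : R) (x : Rd) : R0 + B * `|s| < `|x| -> psi (X s x) = 0.
  move=> xR; apply: psi0; have := flow_displacement hX hB s x.
  by have := lerB_dist x (X s x); rewrite distrC; move: xR; lra.
(* R1 bounds the support of psi o X_t, B the further displacement during a time |s| < 1, and 1 the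
   spreading by the step r <= 1. *)
exists (R1 + B + 1) => [|eta eta0]; first by rewrite addr_ge0// addr_ge0.
(* Half of eta covers the nonlinearity of f, e B |s|, and the gradient error of phi, d C e B |s|.
   The other half is for the second-order displacement and is secured by taking s small. *)
pose e := eta / 2 / (1 + B + d%:R * C * B).
have den0 : 0 < 1 + B + d%:R * C * B by rewrite ltr_pwDl ?mulr_ge0// ltr_pwDl.
have e0 : 0 < e by rewrite !divr_gt0.
have [r0 r00 hr0] := ud e e0.
pose r := Num.min r0 1; have r_gt0 : 0 < r by rewrite lt_min r00 ltr01.
have r1 : r <= 1 by rewrite ge_min lexx orbT.
have {hr0} fA : forall x v : Rd, `|v| <= r ->
    `|f (x + v) - f x - lin v (fun i => (f (x + r *: delta_mx ord0 i) - f x) / r)| <= e * `|v|.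
  by apply: hr0; rewrite r_gt0 ge_min lexx.
pose A (x : Rd) i := (f (x + r *: delta_mx ord0 i) - f x) / r.
have eir i : `|r *: delta_mx ord0 i : Rd| <= r.
  rewrite normrZ gtr0_norm// -[leRHS]mulr1 ler_pM2l//.
  by apply: rV_norm_le => // j; rewrite mxE eqxx/=; case: eqP => _; rewrite ?normr1 ?normr0.
have AL x i : `|A x i| <= L.
  rewrite /A normrM normfV (gtr0_norm r_gt0) ler_pdivrMr// (le_trans (hL _ _))//.
  by rewrite ler_wpM2l.
have f0 (x : Rd) : R1 < `|x| -> f x = 0 by move=> xR; exact: far.
have A0 (x : Rd) : R1 + r < `|x| -> forall i, A x i = 0.
  move=> xR i; rewrite /A !f0 ?subrr ?mul0r//; first by move: xR r_gt0; lra.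
  have := lerB_dist x (- (r *: delta_mx ord0 i)); rewrite opprK normrN.
  by have := eir i; move: xR; lra.
have [phi [sphi phi0 dphi0 phiA]] := qi f A e r R1 (ltW e0) r_gt0 R10 f0 A0 fA.
(* The three bounds keep the displacement within B, keep it within r, and make d L C2 |s| at most
   eta / 2. *)
pose s0 := Num.min (Num.min 1 (r / (B + 1))) (eta / 2 / (d%:R * L * C2 + 1)).
have B1 : 0 < B + 1 by rewrite ltr_wpDl.
have dLC : 0 < d%:R * L * C2 + 1 by rewrite ltr_wpDl// !mulr_ge0.
exists phi, s0; split => //.
- by move=> x xQ; apply: phi0; move: xQ r1 B0; lra.
- by rewrite !lt_min ltr01 !divr_gt0.
- move=> s x; rewrite !lt_min => /andP[/andP[s1 _] _] xQ.
  have Bs : B * `|s| <= B by rewrite ler_piMr// ltW.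
  have Bts : B * `|t + s| <= B * `|t| + B * `|s| by rewrite -mulrDr ler_wpM2l// ler_normD.
  have := xQ; rewrite /R1 => xQ'.
  split; first by apply: far; move: Bs Bts xQ'; lra.
  - by apply: far; move: xQ'; lra.
  - by apply: dphi0; move: xQ r1 B0; lra.
move=> s x; rewrite !lt_min => /andP[/andP[s1 sr] seta].
rewrite (flowD hb hX) -/(f _) -/(f _); pose v := X s x - x.
have vB : `|v| <= B * `|s| by exact: flow_displacement.
have vr : `|v| <= r.
  rewrite (le_trans vB)// (@le_trans _ _ ((B + 1) * `|s|)) ?ler_wpM2r ?lerDl//.
  by move: sr; rewrite ltr_pdivlMr// mulrC => /ltW.
have -> : f (X s x) = f (x + v) by rewrite /v [x + _]addrC subrK.
(* Three errors: f against its slope A x, the displacement v against s b(x), and the gradient of phi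
   against A x. *)
have -> : f (x + v) - f x - s * lin (b x) (fun j => partial j phi x) =
  (f (x + v) - f x - lin v (A x)) + lin (v - s *: b x) (A x) -
   s * lin (b x) (fun j => partial j phi x - A x j).
  by rewrite linB_r linD linN linZ; ring.
have h1 := fA x v vr.
have h2 : `|lin (v - s *: b x) (A x)| <= d%:R * L * (C2 * s ^+ 2).
  by rewrite (le_trans (lin_le _ (AL x)))// ler_wpM2l ?mulr_ge0//; exact: hC2.
have h3 : `|s * lin (b x) (fun j => partial j phi x - A x j)| <= `|s| * (d%:R * (C * e) * B).
  rewrite normrM ler_wpM2l// (le_trans (lin_le _ (phiA x)))// ler_wpM2l//.
  by rewrite mulr_ge0// mulr_ge0// ltW.
rewrite (le_trans (ler_normB _ _))//.
apply: (@le_trans _ _ (e * (B * `|s|) + d%:R * L * (C2 * s ^+ 2) + `|s| * (d%:R * (C * e) * B))).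
  apply: lerD => //; rewrite (le_trans (ler_normD _ _))// lerD// (le_trans h1)//.
  by rewrite ler_wpM2l// ltW.
have -> : s ^+ 2 = `|s| * `|s| by rewrite -expr2 real_normK ?num_real.
have k1 : e * B + d%:R * (C * e) * B <= eta / 2.
  rewrite /e (_ : _ + _ = eta / 2 / (1 + B + d%:R * C * B) * (B + d%:R * C * B)); last by ring.
  by rewrite mulrAC ler_pdivrMr// ler_wpM2l ?divr_ge0 ?ltW// -addrA ltrDr.
have k2 : d%:R * L * C2 * `|s| <= eta / 2.
  move: seta; rewrite ltr_pdivlMr// => /ltW; apply: le_trans.
  by rewrite mulrC ler_wpM2l// lerDl.
have -> : e * (B * `|s|) + d%:R * L * (C2 * (`|s| * `|s|)) + `|s| * (d%:R * (C * e) * B) =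
  (e * B + d%:R * (C * e) * B + d%:R * L * C2 * `|s|) * `|s| by ring.
by rewrite ler_wpM2r// [leRHS](splitr eta) lerD.
Qed.

End flow_test_function.

(** * Measures on R^d *)

Section density_measure.
Local Open Scope ereal_scope.
Context d (T : measurableType d) (R : realType) (mu : {measure set T -> \bar R}).
Variable s : T -> R.

(** The two proofs are arguments so that the measure structure can be inferred from the term
    alone. *)
Definition density_measure of measurable_fun [set: T] s & (forall x, (0 <= s x)%R) :
  set T -> \bar R := fun A => \int[mu]_(x in A) (s x)%:E.

Variables (ms : measurable_fun [set: T] s) (s0 : forall x, (0 <= s x)%R).
Local Notation nu := (density_measure ms s0).

Let nu0 : nu set0 = 0. Proof. exact: integral_set0. Qed.

Let nu_ge0 A : 0 <= nu A.
Proof. by apply: integral_ge0 => x _; rewrite lee_fin. Qed.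

Let nu_sigma_additive : semi_sigma_additive nu.
Proof.
apply: semi_sigma_additive_nng_induced; first exact/measurable_EFinP.
by move=> x; rewrite lee_fin.
Qed.

HB.instance Definition _ := isMeasure.Build _ _ _ nu nu0 nu_ge0 nu_sigma_additive.

Import HBNNSimple.

Lemma ge0_integral_density (f : T -> \bar R) : measurable_fun setT f ->
  (forall x, 0 <= f x) -> \int[nu]_x f x = \int[mu]_x (f x * (s x)%:E).
Proof.
move=> mf f0.
have mE : measurable_fun setT (EFin \o s) by exact/measurable_EFinP.
pose h := nnsfun_approx measurableT mf.
have cvh x : (h n x)%:E @[n --> \oo] --> f x by exact: cvg_nnsfun_approx.
have ndh x : {homo (fun n => h n x) : m n / (m <= n)%N >-> (m <= n)%R}.
  by move=> m n mn; exact/lefP/nd_nnsfun_approx.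
have mh n : measurable_fun setT (EFin \o h n) by exact/measurable_EFinP.
have hs n : \int[nu]_x (h n x)%:E = \int[mu]_x ((h n x)%:E * (s x)%:E).
  have mi y : measurable (h n @^-1` [set y]) by exact: measurable_sfunP.
  have mI y : measurable_fun setT (fun x => (y * \1_(h n @^-1` [set y]) x)%:E).
    by apply/measurable_EFinP; apply: measurable_funM.
  transitivity (\sum_(y \in range (h n)) y%:E * nu (h n @^-1` [set y])).
    rewrite -[LHS]/(\int[nu]_x (EFin \o h n) x) integralT_nnsfun sintegralE.
    by apply: eq_fsbigr => y _.
  transitivity (\int[mu]_x (\sum_(y \in range (h n)) (y * \1_(h n @^-1` [set y]) x)%:E * (s x)%:E)).
    rewrite ge0_integral_fsum//; first last.
    - by move=> y x _; rewrite mule_ge0 ?lee_fin//; exact: nnfun_muleindic_ge0.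
    - by move=> y; apply: emeasurable_funM.
    apply: eq_fsbigr => y; rewrite inE => -[x _ <-].
    under eq_integral do rewrite EFinM -muleA.
    rewrite ge0_integralZl//; first last.
    - by rewrite lee_fin.
    - by move=> z _; rewrite mule_ge0// lee_fin.
    - by apply: emeasurable_funM => //; exact/measurable_EFinP.
    congr (_ * _); rewrite /density_measure integral_mkcond.
    by apply: eq_integral => z _; rewrite muleC epatch_indic.
  apply: eq_integral => x _.
  rewrite -ge0_mule_fsuml; last by move=> y; exact: nnfun_muleindic_ge0.
  by rewrite fsumEFin// -fimfunE.
transitivity (limn (fun n => \int[nu]_x (h n x)%:E)).
  rewrite -monotone_convergence//.
  - by apply: eq_integral => x _; apply/esym/cvg_lim.
  - by move=> n x _; rewrite lee_fin.
  - by move=> x _ m n mn; rewrite lee_fin ndh.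
under eq_fun do rewrite hs.
rewrite -monotone_convergence//.
- by apply: eq_integral => x _; apply/cvg_lim => //; apply: cvgeZr.
- by move=> n; apply: emeasurable_funM => //; exact: mh.
- by move=> n x _; rewrite mule_ge0// lee_fin.
- by move=> x _ m n mn; rewrite lee_wpmul2r ?lee_fin// ndh.
Qed.

(** Positive and negative parts commute with the factor s >= 0, so the nonnegative case applies to
    each of them. *)
Lemma integral_density (f : T -> R) : measurable_fun setT f ->
  \int[nu]_x (f x)%:E = \int[mu]_x (f x * s x)%:E.
Proof.
move=> mf; have mfE : measurable_fun setT (EFin \o f) by exact/measurable_EFinP.
rewrite [LHS]integralE [RHS]integralE; congr (_ - _).
- rewrite ge0_integral_density//; last exact: measurable_funepos.
  apply: eq_integral => x _; rewrite !funeposE -!EFin_max -EFinM; congr (_%:E).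
  by rewrite maxr_pMl// mul0r.
- rewrite ge0_integral_density//; last exact: measurable_funeneg.
  apply: eq_integral => x _; rewrite !funenegE -!EFin_max -EFinM; congr (_%:E).
  by rewrite maxr_pMl// mul0r mulNr.
Qed.

End density_measure.

Section rV_measure.
Context {R : realType} {d : nat}.
Local Notation Rd := 'rV[R]_d.

Lemma continuous_measurable_rV (f : Rd -> R) : continuous f ->
  measurable_fun [set: Rd] f.
Proof.
move=> cf; apply: (measurability _ (RGenOpens.measurableE R)) => _ [_ [a [b ->]] <-].
rewrite setTI; apply: open_measurable_rV; apply: open_comp; last exact: interval_open.
by move=> x _; exact: cf.
Qed.

Lemma continuous_measurable_rVrV (f : Rd -> Rd) : continuous f ->
  measurable_fun [set: Rd] f.
Proof.
move=> cf; apply: measurable_fun_rV => i; apply: continuous_measurable_rV => x.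
by apply: (@continuous_comp _ _ _ f (fun M : Rd => M ord0 i));
  [exact: cf|exact: coord_continuous].
Qed.

Definition box (a b : Rd) : set Rd := [set x | forall i, a ord0 i <= x ord0 i < b ord0 i].

Lemma measurable_box a b : measurable (box a b).
Proof.
have -> : box a b = \bigcap_(i in [set: 'I_d])
    ((fun x : Rd => x ord0 i) @^-1` `[a ord0 i, b ord0 i[%classic).
  apply/seteqP; split => [x h i _ /=|x h i]; first by rewrite in_itv/= h.
  by have := h i I; rewrite /= in_itv.
apply: fin_bigcap_measurable => // i _.
by rewrite -[X in measurable X]setTI; exact: measurable_coord_rV.
Qed.

Definition boxes : set (set Rd) := [set A | exists a b, A = box a b].

Lemma boxes_setI : setI_closed boxes.
Proof.
move=> _ _ [a1 [b1 ->]] [a2 [b2 ->]].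
exists (\row_i Num.max (a1 ord0 i) (a2 ord0 i)), (\row_i Num.min (b1 ord0 i) (b2 ord0 i)).
apply/seteqP; split => [x [h1 h2] i|x h].
  by rewrite !mxE ge_max lt_min; have /andP[-> ->] := h1 i; have /andP[-> ->] := h2 i.
by split=> i; have := h i; rewrite !mxE ge_max lt_min => /andP[/andP[? ?] /andP[? ?]]; exact/andP.
Qed.

Definition cube (k : nat) : set Rd := box (const_mx (- k%:R)) (const_mx k%:R).

Lemma bigcup_cube : \bigcup_k cube k = setT.
Proof.
apply/seteqP; split => // x _; exists (Num.bound `|x|) => // i; rewrite !mxE.
have := rV_norm_coord x i; rewrite ler_norml => /andP[h1 h2].
have := archi_boundP (normr_ge0 x); move: h1 h2.
by move: (Num.bound _)%:R => M *; apply/andP; split; lra.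
Qed.

(** The identity, from the space with the sigma-algebra generated by boxes, has measurable
    coordinates since a half-space x_i >= a is a countable union of boxes; it is therefore Borel
    measurable. *)
Lemma boxes_generate (A : set Rd) : measurable A -> <<s boxes >> A.
Proof.
move=> mA; pose G := g_sigma_algebraType boxes.
have mc (i : 'I_d) : measurable_fun [set: G] (fun x : G => (x : Rd) ord0 i : measurableTypeR R).
  apply: (measurability _ (RGenCInfty.measurableE R)) => _ [_ [a ->] <-].
  rewrite setTI.
  have -> : (fun x : G => (x : Rd) ord0 i) @^-1` `[a, +oo[ =
    \bigcup_k (box (\row_j if j == i then a else - k%:R) (const_mx k%:R)).
    apply/seteqP; split => [x /=|x [k _ h] /=].
      rewrite in_itv/= andbT => ax; exists (Num.bound `|(x : Rd)|) => // j; rewrite !mxE.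
      have := rV_norm_coord (x : Rd) j; rewrite ler_norml => /andP[h1 h2].
      have := archi_boundP (normr_ge0 (x : Rd)); move: h1 h2.
      move: (Num.bound _)%:R => M *; apply/andP; split; last lra.
      by case: eqP => [->//|_]; lra.
    by rewrite in_itv/= andbT; have := h i; rewrite !mxE eqxx => /andP[].
  apply: bigcup_measurable => k _; apply: sub_sigma_algebra.
  by exists (\row_j if j == i then a else - k%:R), (const_mx k%:R).
have mid : measurable_fun [set: G] (fun x : G => (x : Rd)) by exact: measurable_fun_rV.
by have := mid measurableT A mA; rewrite setTI.
Qed.

Lemma measure_eq_boxes (m1 m2 : {measure set Rd -> \bar R}) :
  (forall a b, m1 (box a b) = m2 (box a b)) ->
  (forall k, (m1 (cube k) < +oo)%E) ->
  forall A, measurable A -> m1 A = m2 A.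
Proof.
move=> m12 mfin A mA.
apply: (@g_sigma_algebra_measure_unique _ _ _ boxes _ cube) => //.
- by move=> _ [a [b ->]]; exact: measurable_box.
- by move=> k; exists (const_mx (- k%:R)), (const_mx k%:R).
- exact: bigcup_cube.
- exact: boxes_setI.
- by move=> _ [a [b ->]].
- exact: boxes_generate.
Qed.

Lemma cube_norm k (x : Rd) : cube k x -> `|x| <= k%:R.
Proof.
move=> xk; apply: rV_norm_le => // i; have := xk i; rewrite !mxE => /andP[h1 h2].
by rewrite ler_norml h1 ltW.
Qed.

Lemma measurable_norm_le (Q : R) : measurable [set x : Rd | `|x| <= Q].
Proof.
rewrite -[X in measurable X]setTI; have -> : [set x : Rd | `|x| <= Q] =
    (fun x : Rd => `|x|) @^-1` `]-oo, Q]%classic.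
  by apply/seteqP; split => x; rewrite /= in_itv.
have mn : measurable_fun [set: Rd] (fun x : Rd => `|x|).
  by apply: continuous_measurable_rV; exact: norm_continuous.
by apply: mn => //.
Qed.

End rV_measure.

(** * Smooth approximations of half-open boxes *)

Section box_bump.
Context {R : realType} {d : nat}.
Local Notation Rd := 'rV[R]_d.

(** The shift by 1 on the left face only makes the factor 1 at x_i = a_i but 0 at x_i = b_i: the
    limit is the indicator of the half-open box at every point, faces included. *)
Definition box_bump (a b : Rd) (n : nat) (x : Rd) : R :=
  \prod_i (smooth_step (n%:R * (x ord0 i - a ord0 i) + 1) *
           smooth_step (n%:R * (b ord0 i - x ord0 i))).

Lemma box_bump_Ck a b n k : Ck k (box_bump a b n).
Proof.
apply: Ck_prod => i; apply: CkM.
  rewrite (_ : (fun x => _) = (fun x : Rd => smooth_step (n%:R * x ord0 i + (1 - n%:R * a ord0 i)))).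
    apply: (@Ck_comp_coord _ _ k (fun y => smooth_step (n%:R * y + (1 - n%:R * a ord0 i)))).
    by apply: diffn_affine; exact: diffn_smooth_step.
  by apply/funext => x; congr smooth_step; ring.
rewrite (_ : (fun x => _) = (fun x : Rd => smooth_step (- n%:R * x ord0 i + n%:R * b ord0 i))).
  apply: (@Ck_comp_coord _ _ k (fun y => smooth_step (- n%:R * y + n%:R * b ord0 i))).
  by apply: diffn_affine; exact: diffn_smooth_step.
by apply/funext => x; congr smooth_step; ring.
Qed.

Lemma box_bump_ge0 a b n x : 0 <= box_bump a b n x.
Proof. by apply: prodr_ge0 => i _; rewrite mulr_ge0 ?smooth_step_ge0. Qed.

Lemma box_bump_le1 a b n x : box_bump a b n x <= 1.
Proof.
by apply: prodr_ile1 => i _; rewrite mulr_ge0 ?smooth_step_ge0//= mulr_ile1 ?smooth_step_ge0 ?smooth_step_le1.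
Qed.

Lemma box_bump_support a b n (x : Rd) : (0 < n)%N -> `|a| + `|b| + 1 < `|x| -> box_bump a b n x = 0.
Proof.
move=> n0 xab; have ab0 : 0 <= `|a| + `|b| + 1 by rewrite !addr_ge0.
have [i] := norm_gt_coord ab0 xab; rewrite lter_normr => h.
have := rV_norm_coord a i; rewrite ler_norml => /andP[a1 a2].
have := rV_norm_coord b i; rewrite ler_norml => /andP[b1 b2].
have A0 := normr_ge0 a; have B0 := normr_ge0 b.
have n1 : 1 <= n%:R :> R by rewrite ler1n.
rewrite /box_bump (bigD1 i)//=; case/orP: h => h.
  by rewrite [X in _ * X * _]smooth_step0 ?mulr0 ?mul0r//; nra.
by rewrite [X in X * _ * _]smooth_step0 ?mul0r//; nra.
Qed.

Lemma box_bump_cvg a b (x : Rd) : \forall n \near \oo, box_bump a b n x = \1_(box a b) x.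
Proof.
suff H i : \forall n \near \oo, smooth_step (n%:R * (x ord0 i - a ord0 i) + 1) *
           smooth_step (n%:R * (b ord0 i - x ord0 i)) = ((a ord0 i <= x ord0 i < b ord0 i)%R : bool)%:R :> R.
  have : \forall n \near \oo, forall i, smooth_step (n%:R * (x ord0 i - a ord0 i) + 1) *
           smooth_step (n%:R * (b ord0 i - x ord0 i)) = ((a ord0 i <= x ord0 i < b ord0 i)%R : bool)%:R :> R.
    exact: filter_forall.
  apply: filterS => n hn; rewrite /box_bump (eq_bigr _ (fun i _ => hn i)) indicE.
  have [/set_mem xab|xab] := boolP (x \in box a b).
    by rewrite big1// => i _; rewrite xab.
  have [i] : exists i, ~ (a ord0 i <= x ord0 i < b ord0 i).
    by apply/existsNP => h; move/negP: xab; apply; exact/mem_set.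
  by move=> /negP/negbTE h; rewrite (bigD1 i)//= h mul0r.
have large (u : R) : 0 < u -> \forall n \near \oo, 1 <= n%:R * u.
  move=> u0; near=> n; rewrite -ler_pdivrMr// mul1r; near: n.
  exact: nbhs_infty_ger.
have [ax|xa] := leP (a ord0 i) (x ord0 i); last first.
  have := large (a ord0 i - x ord0 i); rewrite subr_gt0 => /(_ xa).
  apply: filterS => n hn; rewrite smooth_step0 ?mul0r//; nra.
have [xb|bx] := ltP (x ord0 i) (b ord0 i); last first.
  near=> n; rewrite [X in _ * X]smooth_step0 ?mulr0// mulr_ge0_le0// subr_le0//.
have := large (b ord0 i - x ord0 i); rewrite subr_gt0 => /(_ xb).
apply: filterS => n hn; rewrite !smooth_step1 ?mulr1//.
by rewrite lerDr mulr_ge0// subr_ge0.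
Unshelve. all: by end_near. Qed.

End box_bump.

(** * Invariance of the measure *)

Section liouville.
Context {R : realType} {d : nat}.
Local Notation Rd := 'rV[R]_d.
Variable b : Rd -> Rd.
Hypothesis hb : Ck_sharp 1 b.
Variable X : R -> Rd -> Rd.
Hypothesis hX : is_flow b X.
Variable nu : {measure set Rd -> \bar R}.
Hypothesis nu_fin : forall Q : R, (nu [set x : Rd | (`|x| <= Q)%R] < +oo)%E.
Hypothesis nu_div : forall (phi : Rd -> R) (Q : R), smooth phi ->
  (forall x : Rd, Q < `|x| -> phi x = 0) ->
  (\int[nu]_x (lin (b x) (fun j => partial j phi x))%:E = 0)%E.

Lemma zero_derive (G : R -> R) (t : R) :
  (forall e : R, 0 < e -> exists2 s0 : R, 0 < s0 &
    forall s, `|s| < s0 -> `|G (t + s) - G t| <= e * `|s|) -> is_derive t (1 : R) G 0.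
Proof.
move=> hG.
have cv : (fun h : R => h^-1 *: ((G \o shift t) (h *: 1) - G t)) @ 0^' --> (0 : R).
  apply/cvgrPdist_le => e e0; have [s0 s00 hs] := hG e e0.
  near=> h; have h0 : h != 0 by near: h; exact: nbhs_dnbhs_neq.
  rewrite sub0r normrN /= [h *: 1]mulr1 [h + t]addrC normrZ normfV ler_pdivrMl ?normr_gt0//.
  by rewrite mulrC; apply: hs; near: h; exact: dnbhs0_lt.
by apply: DeriveDef; [apply/cvg_ex; exists 0|apply: cvg_lim].
Unshelve. all: by end_near. Qed.

Lemma integrable_bounded_support (g : Rd -> R) (C Q : R) : measurable_fun setT g ->
  (forall x, `|g x| <= C) -> (forall x : Rd, Q < `|x| -> g x = 0) ->
  nu.-integrable setT (EFin \o g).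
Proof.
move=> mg gC g0; pose K : set Rd := [set x | `|x| <= Q].
have mK : measurable K by exact: measurable_norm_le.
have -> : EFin \o g = (EFin \o g) \_ K.
  apply/funext => x; rewrite /patch; case: ifPn => //= xK; rewrite g0// ltNge.
  by apply: contra xK => xQ; exact/mem_set.
apply/(integrable_mkcond _ mK); apply: measurable_bounded_integrable => //.
- exact: nu_fin.
- exact: measurable_funTS.
- by exists C; split; [exact: num_real|move=> M CM x _; rewrite /= (le_trans (gC x))// ltW].
Qed.

Lemma integrable_indic_ball (Q : R) :
  nu.-integrable setT (EFin \o (\1_[set x : Rd | `|x| <= Q] : Rd -> R)).
Proof.
apply: (@integrable_bounded_support _ 1 Q) => [|x|x xQ].
- by apply: measurable_indic; exact: measurable_norm_le.
- by rewrite indicE; case: (_ \in _); rewrite ?normr1 ?normr0.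
- by rewrite indicE memNset// => /= /le_lt_trans/(_ xQ); rewrite ltxx.
Qed.

Lemma Rintegral_le_support (g : Rd -> R) (c Q : R) : 0 <= c -> measurable_fun setT g ->
  (forall x, `|g x| <= c) -> (forall x : Rd, Q < `|x| -> g x = 0) ->
  `|\int[nu]_x g x| <= c * fine (nu [set x : Rd | `|x| <= Q]).
Proof.
move=> c0 mg gc g0; pose K : set Rd := [set x | `|x| <= Q].
have mK : measurable K by exact: measurable_norm_le.
have ig := integrable_bounded_support mg gc g0.
have iK : nu.-integrable setT (EFin \o (\1_K : Rd -> R)).
  exact: integrable_indic_ball.
rewrite (le_trans (le_normr_Rintegral measurableT ig))//.
apply: (@le_trans _ _ (\int[nu]_x (c * \1_K x))).
  apply: le_Rintegral => //.
  - exact: integrable_norm.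
  - by have := integrableZl measurableT c iK; apply: eq_integrable.
  - move=> x _; rewrite indicE; have [xK|xK] := boolP (x \in K); first by rewrite mulr1.
    rewrite mulr0 g0 ?normr0// ltNge; apply: contra xK => xQ; exact/mem_set.
by rewrite RintegralZl// ler_wpM2l// /Rintegral integral_indic// setIT.
Qed.

Lemma flow_measurable t : measurable_fun [set: Rd] (X t).
Proof. by apply: continuous_measurable_rVrV; exact: (flow_continuous hb hX). Qed.

Lemma liouville_test (psi : Rd -> R) (R0 : R) : 0 <= R0 -> Ck 1 psi ->
  (forall x : Rd, R0 < `|x| -> psi x = 0) ->
  forall t, \int[nu]_x psi (X t x) = \int[nu]_x psi x.
Proof.
move=> R00 cpsi psi0 t; pose G t := \int[nu]_x psi (X t x).
have G0 : G 0 = \int[nu]_x psi x by apply: eq_Rintegral => x _; rewrite (flow0 hX).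
rewrite -/(G t) -G0; apply: is_derive_0_is_cst => {}t; apply: zero_derive => e e0.
have cont : continuous psi by move=> x; apply: differentiable_continuous; exact: cpsi.1.
have [C C0 hC] := lbt_bounded cont (bounded_support_lbt psi0).
have mpsi s : measurable_fun setT (fun x => psi (X s x)).
  apply: (measurableT_comp (continuous_measurable_rV cont)); exact: flow_measurable.
have [Q Q0 hQ] := flow_test_function hb hX t R00 cpsi psi0.
pose I := fine (nu [set x : Rd | `|x| <= Q]); have I0 : 0 <= I by rewrite fine_ge0.
pose eta := e / (I + 1); have eta0 : 0 < eta by rewrite divr_gt0// ltr_wpDl.
have [phi [s0 [sphi phi0 s00 vanish est]]] := hQ eta eta0.
exists s0 => // s ss0.
pose div x := lin (b x) (fun j => partial j phi x).
have [B B0 hB] := field_bounded hb.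
have mdiv : measurable_fun setT div.
  apply: measurable_sum => i; apply: measurable_funM.
    apply: (measurableT_comp (measurable_coord_rV i)).
    by apply: continuous_measurable_rVrV; exact: (field_continuous hb).
  by apply: continuous_measurable_rV; exact: (sphi 1%N).2.
have phi1 : Ck 1 phi by exact: sphi.
have [[P P0 hP] _] := Ck1_unif_diff phi1 (bounded_support_lbt phi0).
have divC x : `|div x| <= d%:R * P * B.
  by rewrite (le_trans (lin_le _ (hP x)))// ler_wpM2l// mulr_ge0.
have div0 (x : Rd) : Q < `|x| -> div x = 0.
  move=> xQ; rewrite /div /lin big1// => j _.
  by have [_ _ ->] := vanish s x ss0 xQ; rewrite mulr0.
have i1 : nu.-integrable setT (EFin \o (fun x => psi (X (t + s) x))).
  apply: (@integrable_bounded_support _ C Q) => // x xQ.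
  by have [-> _ _] := vanish s x ss0 xQ.
have i2 : nu.-integrable setT (EFin \o (fun x => psi (X t x))).
  apply: (@integrable_bounded_support _ C Q) => // x xQ.
  by have [_ -> _] := vanish s x ss0 xQ.
have i3 := integrable_bounded_support mdiv divC div0.
have I3 : \int[nu]_x div x = 0 by rewrite /Rintegral (nu_div sphi phi0).
have -> : G (t + s) - G t = \int[nu]_x (psi (X (t + s) x) - psi (X t x) - s * div x).
  rewrite RintegralB//; first last.
  - by have := integrableZl measurableT s i3; apply: eq_integrable.
  - by have := integrableB measurableT i1 i2; apply: eq_integrable.
  by rewrite RintegralB// RintegralZl// I3 mulr0 subr0.
apply: (@le_trans _ _ (eta * `|s| * I)).
  apply: Rintegral_le_support.
  - by rewrite mulr_ge0// ltW.
  - apply: measurable_funB; first exact: measurable_funB.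
    by apply: measurable_funM.
  - by move=> x; exact: est.
  - by move=> x xQ; have [-> -> _] := vanish s x ss0 xQ; rewrite div0// mulr0 !subr0.
rewrite mulrAC ler_wpM2r// /eta mulrAC ler_pdivrMr ?ltr_wpDl//.
by rewrite ler_wpM2l ?lerDl// ltW.
Qed.

Lemma flow_preimage_measurable t A : measurable A -> measurable (X t @^-1` A).
Proof. by move=> mA; rewrite -[X in measurable X]setTI; exact: flow_measurable. Qed.

Lemma liouville_box t (a c : Rd) : nu (X t @^-1` box a c) = nu (box a c).
Proof.
have [B B0 hB] := field_bounded hb.
pose psi n := box_bump a c n.+1.
pose R0 := `|a| + `|c| + 1; have R00 : 0 <= R0 by rewrite !addr_ge0.
have psi0 n (x : Rd) : R0 < `|x| -> psi n x = 0 by exact: box_bump_support.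
pose Q := R0 + B * `|t|.
have psiQ n (x : Rd) : Q < `|x| -> psi n (X t x) = 0.
  move=> xQ; apply: psi0; have := flow_displacement hX hB t x.
  by have := lerB_dist x (X t x); rewrite distrC; move: xQ; rewrite /Q; lra.
have mpsi n : measurable_fun setT (psi n).
  by apply: continuous_measurable_rV; exact: (box_bump_Ck a c n.+1 0).
have mpsiX n : measurable_fun setT (fun x => psi n (X t x)).
  by apply: (measurableT_comp (mpsi n)); exact: flow_measurable.
have psi1 n x : `|psi n x| <= 1 by rewrite ger0_norm ?box_bump_ge0 ?box_bump_le1.
have cvpsi x : (psi n x)%:E @[n --> \oo] --> (\1_(box a c) x)%:E.
  apply: cvg_near_cst; have [N _ hN] := box_bump_cvg a c x.
  by exists N => // n /= Nn; rewrite /psi hN//= (leq_trans Nn).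
(* Dominated convergence for a general map, used once for X_t and once for the identity; the
   dominating function is the indicator of a ball, of finite mass. *)
have lim (T : Rd -> Rd) (P : R) : measurable_fun setT T ->
    (forall n (x : Rd), P < `|x| -> psi n (T x) = 0) ->
    (\int[nu]_x (psi n (T x))%:E @[n --> \oo] --> nu (T @^-1` box a c))%E.
  move=> mT h0; pose K : set Rd := [set x | `|x| <= P].
  have mTb : measurable (T @^-1` box a c).
    by rewrite -[X in measurable X]setTI; apply: mT => //; exact: measurable_box.
  have -> : nu (T @^-1` box a c) = (\int[nu]_x (\1_(box a c) (T x))%:E)%E.
    rewrite -(setIT (T @^-1` box a c)) -integral_indic//.
  have mK : measurable K by exact: measurable_norm_le.
  have iK : nu.-integrable setT (EFin \o (\1_K : Rd -> R)).
    exact: integrable_indic_ball.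
  have [] // := @dominated_convergence _ _ _ nu setT measurableT
    (fun n x => (psi n (T x))%:E) (fun x => (\1_(box a c) (T x))%:E) (EFin \o \1_K) _ _ _ iK.
  - by move=> n; apply/measurable_EFinP; exact: (measurableT_comp (mpsi n)).
  - by apply/measurable_EFinP; apply: (measurableT_comp (measurable_indic _)) => //; exact: measurable_box.
  - by apply: aeW => x _; exact: cvpsi.
  - apply: aeW => x n _; rewrite /= lee_fin indicE.
    have [xK|xK] := boolP (x \in K); first exact: psi1.
    rewrite h0 ?normr0// ltNge; apply: contra xK => xQ; exact/mem_set.
have h2 := lim (X t) Q (flow_measurable t) psiQ.
have h1 : (\int[nu]_x (psi n x)%:E @[n --> \oo] --> nu (box a c))%E.
  exact: (lim id R0 (@measurable_id _ _ _) psi0).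
have E : (fun n => \int[nu]_x (psi n (X t x))%:E)%E = (fun n => \int[nu]_x (psi n x)%:E)%E.
  apply/funext => n.
  have i1 : nu.-integrable setT (EFin \o (fun x => psi n (X t x))).
    by apply: (@integrable_bounded_support _ 1 Q) => [|x|x xQ];
      [exact: mpsiX|exact: psi1|exact: psiQ].
  have i2 : nu.-integrable setT (EFin \o psi n) by apply: (@integrable_bounded_support _ 1 R0) => [|x|x xQ];
      [exact: mpsi|exact: psi1|exact: psi0].
  rewrite -[LHS]fineK; last exact: integrable_fin_num i1.
  rewrite -[RHS]fineK; last exact: integrable_fin_num i2.
  have E1 : \int[nu]_x psi n (X t x) = \int[nu]_x psi n x.
    exact: (@liouville_test (psi n) R0 R00 (box_bump_Ck a c n.+1 1) (psi0 n) t).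
  exact: (congr1 EFin E1).
rewrite E in h2; exact: (cvg_unique _ h2 h1).
Qed.

Theorem liouville t A : measurable A -> nu (X t @^-1` A) = nu A.
Proof.
move=> mA.
pose f : {mfun Rd >-> Rd} := HB.pack (X t) (isMeasurableFun.Build _ _ _ _ _ (flow_measurable t)).
have := @measure_eq_boxes R d (pushforward nu f) nu _ _ A mA; apply.
- by move=> a c; exact: liouville_box.
- move=> k; rewrite [X in (X < _)%E](_ : _ = nu (cube k)); last exact: liouville_box.
  apply: le_lt_trans (nu_fin k%:R); apply: le_measure; rewrite ?inE.
  + exact: measurable_box.
  + exact: measurable_norm_le.
  + by move=> x; exact: cube_norm.
Qed.

End liouville.

(** * Translation invariance of Lebesgue measure *)

Section translation.
Context {R : realType} {d : nat}.
Local Notation Rd := 'rV[R]_d.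
Local Notation leb := (lebesgue_rV d : {measure set Rd -> \bar R}).

Lemma translate_measurable (c : Rd) : measurable_fun [set: Rd] (fun x => x + c).
Proof.
apply: measurable_fun_rV => i; under eq_fun do rewrite mxE.
by apply: measurable_funD => //; exact: measurable_coord_rV.
Qed.

Lemma lebesgue_rV_cube k : (leb (cube k) < +oo)%E.
Proof.
rewrite /cube /box [X in (X < _)%E]lebesgue_rV_box ?ltry// => i.
by rewrite !mxE (@le_trans _ _ 0)// oppr_le0.
Qed.

Lemma lebesgue_rV_translate (c : Rd) A : measurable A ->
  leb ((fun x => x + c) @^-1` A) = leb A.
Proof.
move=> mA.
pose f : {mfun Rd >-> Rd} :=
  HB.pack (fun x : Rd => x + c) (isMeasurableFun.Build _ _ _ _ _ (translate_measurable c)).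
have bE a b : (fun x => x + c) @^-1` box a b = box (a - c) (b - c).
  apply/seteqP; split => x h i; have := h i; rewrite !mxE => /andP[h1 h2]; apply/andP; split; lra.
have boxeq a b : leb ((fun x => x + c) @^-1` box a b) = leb (box a b).
  rewrite bE; have [ab|] := pselect (forall i, a ord0 i <= b ord0 i).
    rewrite [LHS]lebesgue_rV_box => [|i]; last by rewrite !mxE lerB.
    rewrite [RHS]lebesgue_rV_box//; congr (_%:E); apply: eq_bigr => i _; rewrite !mxE; ring.
  move=> /existsNP[i /negP]; rewrite -ltNge => ba.
  have box0 (a' b' : Rd) : b' ord0 i < a' ord0 i -> box a' b' = set0.
    by move=> h; apply/seteqP; split => // x /(_ i) /andP[h1 h2]; lra.
  by rewrite (box0 _ _ ba) box0// !mxE; lra.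
have := @measure_eq_boxes R d (pushforward leb f) leb _ _ A mA; apply.
- by move=> a b; exact: boxeq.
- by move=> k; rewrite [X in (X < _)%E](_ : _ = leb (cube k)) ?lebesgue_rV_cube//; exact: boxeq.
Qed.

Lemma measurable_Yd : measurable (@Yd R d).
Proof.
rewrite (_ : Yd = box (const_mx 0) (const_mx 1)); first exact: measurable_box.
by apply/seteqP; split => x h i; have := h i; rewrite !mxE.
Qed.

Lemma Yd_norm (x : Rd) : Yd x -> `|x| <= 1.
Proof.
move=> xY; apply: rV_norm_le => // i; have /andP[h1 h2] := xY i.
by rewrite ger0_norm// ltW.
Qed.

End translation.

(** * Splitting the space into lattice cells *)

Section torus_invariance.
Context {R : realType} {d : nat}.
Local Notation Rd := 'rV[R]_d.
Variable nu : {measure set Rd -> \bar R}.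

Definition cell (k : 'rV[int]_d) : set Rd := [set x | Yd (x + map_mx intr k)].

Lemma measurable_cell k : measurable (cell k).
Proof.
by have := translate_measurable (map_mx intr k : Rd) measurableT (@measurable_Yd R d); rewrite setTI.
Qed.

Lemma cell_uniq k k' (x : Rd) : cell k x -> cell k' x -> k = k'.
Proof.
move=> h h'; apply/rowP => i; have := h i; have := h' i; rewrite !mxE.
move=> /andP[a1 a2] /andP[b1 b2]; apply/eqP; rewrite eq_le -!ltzD1 -!(ltr_int R) !intrD.
by apply/andP; split; lra.
Qed.

Lemma cell_cover (x : Rd) : exists k, cell k x.
Proof.
exists (\row_i - Num.floor (x ord0 i)) => i; rewrite !mxE rmorphN/=.
have := floor_itv (x ord0 i); rewrite intrD => /andP[h1 h2]; apply/andP; split; lra.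
Qed.

(** An enumeration of the cells, empty at the n that code no vector. The reindexing [e] is there to
    pair cell k of one decomposition with cell -k of another, term by term. *)
Definition nth_cell (e : 'rV[int]_d -> 'rV[int]_d) (n : nat) : set Rd :=
  if pickle_inv n is Some k then cell (e k) else set0.

Lemma measure_cells (e : 'rV[int]_d -> 'rV[int]_d) (A : set Rd) : involutive e ->
  measurable A -> nu A = (\sum_(n <oo) nu (A `&` nth_cell e n))%E.
Proof.
move=> eK mA; have mn n : measurable (nth_cell e n).
  by rewrite /nth_cell; case: (pickle_inv n) => [k|//]; exact: measurable_cell.
rewrite {1}(_ : A = \bigcup_n (A `&` nth_cell e n)).
  rewrite measure_bigcup//=.
  - by apply: eq_eseriesl => n; rewrite in_setT.
  - by move=> n _; exact: measurableI.
  - move=> m n _ _ [x [[_ hm] [_ hn]]]; move: hm hn; rewrite /nth_cell.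
    have um : oapp pickle m (pickle_inv m : option 'rV[int]_d) = m := pickle_invK m.
    have un : oapp pickle n (pickle_inv n : option 'rV[int]_d) = n := pickle_invK n.
    case: (pickle_inv m) um => [k /= km|//]; case: (pickle_inv n) un => [l /= ln|//].
    by move=> h1 h2; rewrite -km -ln (can_inj eK (cell_uniq h1 h2)).
apply/seteqP; split => [x Ax|x [n _ []]//].
have [k kx] := cell_cover x; exists (pickle (e k)) => //; split => //.
by rewrite /nth_cell pickleK_inv eK.
Qed.

End torus_invariance.

Section periodic_invariance.
Context {R : realType} {d : nat}.
Local Notation Rd := 'rV[R]_d.
Variable b : Rd -> Rd.
Hypothesis hb : Ck_sharp 1 b.
Variable X : R -> Rd -> Rd.
Hypothesis hX : is_flow b X.
Variable nu : {measure set Rd -> \bar R}.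
Hypothesis nu_inv : forall t A, measurable A -> nu (X t @^-1` A) = nu A.
Hypothesis nu_trans : forall (k : 'rV[int]_d) A, measurable A ->
  nu ((fun x : Rd => x + map_mx intr k) @^-1` A) = nu A.

(* Splitting according to the cell containing X_t(x) turns the invariance of
   nu on the whole space into invariance on the torus. *)
Lemma torus_invariance t A : measurable A -> Zd_periodic A ->
  nu (X t @^-1` A `&` Yd) = nu (A `&` Yd).
Proof.
move=> mA pA; have mX t' B : measurable B -> measurable (X t' @^-1` B).
  by move=> mB; exact: (flow_preimage_measurable hb hX).
have mY := @measurable_Yd R d.
have mn e n : measurable (@nth_cell R d e n).
  by rewrite /nth_cell; case: (pickle_inv n) => [k|//]; exact: measurable_cell.
(* The image under X_t of the set whose measure is sought. *)
pose B : set Rd := A `&` X (- t) @^-1` Yd.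
have mB : measurable B by apply: measurableI => //; exact: mX.
have -> : nu (X t @^-1` A `&` Yd) = nu B.
  rewrite -(nu_inv t mB) preimage_setI.
  by congr (nu (_ `&` _)); apply/seteqP; split => x /=; rewrite (flowK hb hX).
have -> : nu (A `&` Yd) = (\sum_(n <oo) nu (A `&` Yd `&` X (- t) @^-1` nth_cell id n))%E.
  have mAY : measurable (A `&` Yd) by exact: measurableI.
  rewrite -(nu_inv t mAY) (@measure_cells _ _ nu id)//; last exact: mX.
  apply: eq_eseriesr => n _; rewrite -(nu_inv (- t)); last first.
    by apply: measurableI => //; exact: mX.
  congr (nu _); apply/seteqP; split => x /=; by rewrite (flowNK hb hX).
rewrite (@measure_cells _ _ nu -%R) //; last exact: opprK.
apply: eq_eseriesr => n _; rewrite /nth_cell; case: (pickle_inv n) => [k|]; last first.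
  by rewrite preimage_set0 !setI0 !measure0.
(* Translation by k exchanges the two roles: x in cell -k with X_(-t)(x) in Yd becomes x in Yd with
   X_(-t)(x) in cell k. *)
rewrite -(nu_trans k); last by apply: measurableI => //; exact: measurable_cell.
congr (nu _); apply/seteqP; split => x; rewrite /B /cell /=.
- move=> [[Ax XY] xY]; split; [split|].
  + by move: Ax; rewrite pA.
  + by move: xY; rewrite map_mxN addrK.
  + by move: XY; rewrite /= (flow_periodic hb hX).
- move=> [[Ax xY] XY]; split; [split|].
  + by rewrite pA.
  + by rewrite (flow_periodic hb hX).
  + by rewrite map_mxN addrK.
Qed.

End periodic_invariance.

Lemma indic_periodic (R : realType) (d : nat) (A : set 'rV[R]_d) :
  Zd_periodic A -> Zd_periodic (\1_A : 'rV[R]_d -> R).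
Proof.
move=> pA k x; rewrite !indicE; suff -> : (x + map_mx intr k \in A) = (x \in A) by [].
by apply/idP/idP => /set_mem h; apply/mem_set; [rewrite -(pA k)|rewrite pA].
Qed.

(** * The maximal ergodic inequality *)

Section maximal_ergodic.
Context {R : realType} {d : nat}.
Local Notation Rd := 'rV[R]_d.
Variables (P : {measure set Rd -> \bar R}) (T : Rd -> Rd).
Hypothesis P_fin : (P setT < +oo)%E.
Hypothesis mT : measurable_fun [set: Rd] T.
Hypothesis T_per : forall k x, T (x + map_mx intr k) = T x + map_mx intr k.
Hypothesis P_inv : forall A, measurable A -> Zd_periodic A -> P (T @^-1` A) = P A.

Lemma bounded_integrable (g : Rd -> R) (C : R) : measurable_fun setT g ->
  (forall x, `|g x| <= C) -> P.-integrable setT (EFin \o g).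
Proof.
move=> mg gC; apply: measurable_bounded_integrable => //.
by exists C; split; [exact: num_real|move=> M CM x _; rewrite /= (le_trans (gC x))// ltW].
Qed.

(** Invariance is known on periodic sets only, but the preimages of Borel sets under a periodic g
    are periodic; hence g and g o T have the same law on the real line, and so the same integral. *)
Lemma periodic_Rintegral (g : Rd -> R) (C : R) : measurable_fun setT g ->
  (forall x, `|g x| <= C) -> Zd_periodic g -> \int[P]_x g (T x) = \int[P]_x g x.
Proof.
move=> mg gC pg; have mgT : measurable_fun setT (g \o T) by exact: measurableT_comp mT.
pose g1 : {mfun Rd >-> measurableTypeR R} := HB.pack (g : Rd -> measurableTypeR R)
  (isMeasurableFun.Build _ _ Rd (measurableTypeR R) g mg).
pose g2 : {mfun Rd >-> measurableTypeR R} := HB.pack (g \o T : Rd -> measurableTypeR R)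
  (isMeasurableFun.Build _ _ Rd (measurableTypeR R) (g \o T) mgT).
have mid : measurable_fun [set: measurableTypeR R] (EFin : measurableTypeR R -> \bar R).
  by apply/measurable_EFinP.
rewrite /Rintegral; congr fine.
have i1 : P.-integrable setT ((EFin : measurableTypeR R -> \bar R) \o g1).
  exact: bounded_integrable gC.
have i2 : P.-integrable setT ((EFin : measurableTypeR R -> \bar R) \o g2).
  by apply: (@bounded_integrable (g \o T) C) => // x; exact: gC.
transitivity (\int[pushforward P g2]_y (EFin y))%E.
  by rewrite (integral_pushforward (measurable_funP g2) mid).
transitivity (\int[pushforward P g1]_y (EFin y))%E; last first.
  by rewrite (integral_pushforward (measurable_funP g1) mid).
apply: eq_measure_integral => B mB _.
change (P (T @^-1` (g @^-1` B)) = P (g @^-1` B)); rewrite P_inv//.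
- by rewrite -[X in measurable X]setTI; apply: (mg).
- by move=> k x; rewrite /preimage /= pg.
Qed.

Variables (u : Rd -> R) (K : R) (S : nat -> Rd -> R) (A : set Rd).
Hypothesis mu_ : measurable_fun setT u.
Hypothesis uK : forall x, `|u x| <= K.
Hypothesis u_per : Zd_periodic u.
Hypothesis S0 : forall x, S 0%N x = 0.
Hypothesis SS : forall n x, S n.+1 x = u x + S n (T x).
Hypothesis mA : measurable A.
Hypothesis A_per : Zd_periodic A.
Hypothesis A_inv : forall x, A (T x) <-> A x.

(** The maximum of S_0, ..., S_n, in the recursive form on which Garsia's argument rests. *)
Fixpoint maximal (n : nat) (x : Rd) : R :=
  if n is n'.+1 then Num.max 0 (u x + maximal n' (T x)) else 0.

Let M := maximal.

Lemma maximal_ge0 n x : 0 <= M n x.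
Proof. by case: n => [|n] //=; rewrite le_max lexx. Qed.

Lemma maximal_homo n x : M n x <= M n.+1 x.
Proof.
elim: n x => [|n ih] x; first by rewrite maximal_ge0.
rewrite /M /= ge_max le_max lexx/= le_max; apply/orP; right.
by rewrite lerD2l; exact: ih.
Qed.

Lemma maximal_mono m n x : (m <= n)%N -> M m x <= M n x.
Proof. by move=> /subnK <-; elim: (n - m)%N => // k ih; rewrite addSn (le_trans ih)// maximal_homo. Qed.

Lemma le_maximal n x : S n x <= M n x.
Proof.
elim: n x => [|n ih] x; first by rewrite S0.
by rewrite SS /M /= le_max lerD2l ih orbT.
Qed.

Lemma maximal_le n x : M n x <= n%:R * K.
Proof.
have K0 : 0 <= K by rewrite (le_trans _ (uK x)).
elim: n x => [|n ih] x; first by rewrite mul0r.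
rewrite /M /= ge_max mulr_ge0//= -natr1 mulrDl mul1r addrC lerD//.
by rewrite (le_trans (ler_norm _)).
Qed.

Lemma maximal_measurable n : measurable_fun setT (M n).
Proof.
elim: n => [|n ih]; first exact: measurable_cst.
rewrite /M /=; apply: measurable_maxr; first exact: measurable_cst.
by apply: measurable_funD => //; exact: measurableT_comp ih mT.
Qed.

Lemma maximal_periodic n : Zd_periodic (M n).
Proof.
move=> k x; elim: n x => [//|n ih] x.
by rewrite /M /= u_per T_per; congr (Num.max _ (_ + _)); exact: ih.
Qed.

Lemma indic_Rd_le1 (B : set Rd) x : `|\1_B x : R| <= 1.
Proof. by rewrite indicE; case: (_ \in _); rewrite ?normr1 ?normr0. Qed.

(* Garsia's argument: u >= M - M o T wherever the maximal function M is
   positive. *)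
Lemma maximal_ineq n : 0 <= \int[P]_x (\1_(A `&` [set x | 0 < M n.+1 x]) x * u x).
Proof.
have K0 : 0 <= K by rewrite (le_trans _ (uK 0)).
pose h x := \1_A x * M n.+1 x.
have mh : measurable_fun setT h.
  by apply: measurable_funM; [exact: measurable_indic|exact: maximal_measurable].
have hK x : `|h x| <= n.+1%:R * K.
  rewrite /h normrM -[leRHS]mul1r ler_pM// ?indic_Rd_le1//.
  by rewrite ger0_norm ?maximal_ge0 ?maximal_le.
have ph : Zd_periodic h.
  by move=> k x; rewrite /h maximal_periodic (indic_periodic A_per).
have mE : measurable (A `&` [set x | 0 < M n.+1 x]).
  apply: measurableI => //; rewrite -[X in measurable X]setTI.
  have := maximal_measurable n.+1 measurableT (measurable_itv `]0, +oo[).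
  by congr (measurable (_ `&` _)); apply/seteqP; split => x; rewrite /= in_itv/= andbT.
have i0 := bounded_integrable mh hK.
have mhT : measurable_fun setT (fun x => h (T x)) by exact: measurableT_comp mh mT.
have i1 : P.-integrable setT (EFin \o (fun x => h (T x))).
  by apply: (bounded_integrable mhT (C := n.+1%:R * K)) => x; exact: hK.
have I0 : \int[P]_x (h x - h (T x)) = 0.
  by rewrite RintegralB// (periodic_Rintegral mh hK ph) subrr.
rewrite -[leLHS]I0; apply: le_Rintegral => //.
- by have := integrableB measurableT i0 i1; apply: eq_integrable.
- apply: (bounded_integrable _ (C := K)).
    by apply: measurable_funM => //; exact: measurable_indic.
  by move=> x; rewrite normrM -[leRHS]mul1r ler_pM// indic_Rd_le1.
move=> x _; rewrite /h; have AT : \1_A (T x) = \1_A x :> R.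
  by rewrite !indicE; congr (nat_of_bool _)%:R; apply/idP/idP => /set_mem/A_inv/mem_set.
rewrite AT -mulrBr indicI /= [\1_A x]indicE.
case: (boolP (x \in A)) => xA /=; last by rewrite !mul0r.
rewrite !mul1r indicE.
(* If M_(n+1)(x) > 0, it equals u(x) + M_n(T x), which is at most u(x) + M_(n+1)(T x). Otherwise the
   left side is at most 0, because M_(n+1)(T x) >= 0. *)
have [M0|M0] := ltP 0 (M n.+1 x).
  rewrite mem_set//= mul1r lerBlDr.
  apply: (@le_trans _ _ (u x + M n (T x))); last by rewrite lerD2l maximal_homo.
  by move: M0; rewrite {1 2}/M /= lt_max ltxx/= => h0; rewrite ge_max lexx andbT ltW.
rewrite memNset/= ?mul0r; last by apply/negP; rewrite -leNgt.
by rewrite subr_le0; exact: le_trans M0 (maximal_ge0 n.+1 (T x)).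
Qed.

(** The sets where the maximal functions are positive exhaust A, and the integrands stay below the
    constant K, integrable for a finite measure. *)
Lemma maximal_ergodic : (forall x, A x -> exists n, 0 < S n x) ->
  0 <= \int[P]_x (\1_A x * u x).
Proof.
move=> hA; have K0 : 0 <= K by rewrite (le_trans _ (uK 0)).
pose E n := A `&` [set x | 0 < M n.+1 x].
have mE n : measurable (E n).
  apply: measurableI => //; rewrite -[X in measurable X]setTI.
  have := maximal_measurable n.+1 measurableT (measurable_itv `]0, +oo[).
  by congr (measurable (_ `&` _)); apply/seteqP; split => x; rewrite /= in_itv/= andbT.
have mEu n : measurable_fun setT (fun x => \1_(E n) x * u x).
  by apply: measurable_funM => //; exact: measurable_indic.
have mAu : measurable_fun setT (fun x => \1_A x * u x).
  by apply: measurable_funM => //; exact: measurable_indic.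
have bnd (B : set Rd) x : `|\1_B x * u x| <= K.
  by rewrite normrM -[leRHS]mul1r ler_pM// indic_Rd_le1.
have iK : P.-integrable setT (EFin \o (fun=> K : R)).
  by apply: (bounded_integrable (measurable_cst _) (C := `|K|)).
have cvE x : (\1_(E n) x * u x)%:E @[n --> \oo] --> (\1_A x * u x)%:E.
  apply: cvg_near_cst; have [xA|xA] := pselect (A x); last first.
    near=> n; rewrite !indicE !memNset// => -[] //.
  have [m Sm] := hA x xA; exists m => // n /= mn.
  rewrite !indicE !mem_set//; split => //=.
  exact: lt_le_trans Sm (le_trans (le_maximal m x) (maximal_mono x (leq_trans mn (leqnSn n)))).
have [_ _ cv] := @dominated_convergence _ _ _ P setT measurableT
    (fun n x => (\1_(E n) x * u x)%:E) (fun x => (\1_A x * u x)%:E) (EFin \o (fun=> K : R))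
    (fun n => (measurable_EFinP _ _).2 (mEu n)) ((measurable_EFinP _ _).2 mAu)
    (aeW _ (fun x _ => cvE x)) iK (aeW _ (fun x n _ => bnd (E n) x)).
rewrite /Rintegral fine_ge0// -(cvg_lim _ cv)//; apply: lime_ge; first by apply/cvg_ex; eexists; exact: cv.
apply: nearW => n; have := maximal_ineq n; rewrite /Rintegral -lee_fin fineK//.
apply: (integrable_fin_num measurableT).
by apply: (bounded_integrable (mEu n) (C := K)) => x; exact: bnd.
Unshelve. all: by end_near. Qed.

End maximal_ergodic.

(** * Mean displacement and densities *)

Section mean_displacement.
Context {R : realType} {d : nat}.
Local Notation Rd := 'rV[R]_d.
Variable b : Rd -> Rd.
Hypothesis hb : Ck_sharp 1 b.
Variable X : R -> Rd -> Rd.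
Hypothesis hX : is_flow b X.
Variable mu : probability Rd R.
Hypothesis mu_inv : invariant_measure X mu.

Let u (i : 'I_d) (t : R) (y : Rd) : R := (X t y - y) ord0 i.

Lemma displacement_continuous i t : continuous (u i t).
Proof.
move=> x; apply: (@continuous_comp _ _ _ (fun y => X t y - y) (fun M : Rd => M ord0 i)).
  by apply: continuousB; [exact: (flow_continuous hb hX)|exact: cvg_id].
exact: coord_continuous.
Qed.

Lemma displacement_periodic i t : Zd_periodic (u i t).
Proof. by move=> k x; rewrite /u (flow_periodic hb hX) opprD addrACA subrr addr0. Qed.

Lemma displacement_le i t (B : R) x : (forall x, `|b x| <= B) -> `|u i t x| <= B * `|t|.
Proof.
by move=> hB; rewrite (le_trans (rV_norm_coord _ _))//; exact: (flow_displacement hX hB).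
Qed.

Lemma Yd_integrable (g : Rd -> R) (C : R) : measurable_fun setT g ->
  (forall x, `|g x| <= C) -> mu.-integrable Yd (EFin \o g).
Proof.
move=> mg gC; apply: (integrableS measurableT measurable_Yd) => //.
by apply: (bounded_integrable _ mg gC); rewrite [X in (X < _)%E](probability_setT mu) ltry.
Qed.

Let mY := @measurable_Yd R d.

Let intu i t : mu.-integrable Yd (EFin \o u i t).
Proof.
have [B _ hB] := field_bounded hb.
apply: (@Yd_integrable _ (B * `|t|)).
  by apply: continuous_measurable_rV; exact: displacement_continuous.
by move=> x; exact: displacement_le.
Qed.

(** The displacement is additive along orbits, u_(s+t)(y) = u_s(X_t y) + u_t(y); being continuous
    and periodic, unlike X_s itself, u_s is an admissible test function for invariance. *)
Lemma mean_displacementD i s t : \int[mu]_(y in Yd) u i (s + t) y =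
  \int[mu]_(y in Yd) u i s y + \int[mu]_(y in Yd) u i t y.
Proof.
have -> : \int[mu]_(y in Yd) u i s y = \int[mu]_(y in Yd) u i s (X t y).
  rewrite /Rintegral (mu_inv t)//; split; first exact: displacement_continuous.
  exact: displacement_periodic.
have [B _ hB] := field_bounded hb.
have iX : mu.-integrable Yd (EFin \o (fun y => u i s (X t y))).
  apply: (@Yd_integrable _ (B * `|s|)); last by move=> x; exact: displacement_le.
  by apply: (measurableT_comp (continuous_measurable_rV (@displacement_continuous i s)));
    exact: (flow_measurable hb hX).
rewrite -RintegralD//.
by apply: eq_Rintegral => y _; rewrite /u (flowD hb hX) !mxE; ring.
Qed.

Lemma mean_displacementMn i t n :
  \int[mu]_(y in Yd) u i (n%:R * t) y = n%:R * \int[mu]_(y in Yd) u i t y.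
Proof.
elim: n => [|n ih].
  rewrite !mul0r; under eq_Rintegral do rewrite /u (flow0 hX) subrr mxE.
  by rewrite Rintegral_cst// mul0r.
by rewrite -natr1 !mulrDl mul1r mean_displacementD ih mul1r.
Qed.

(* By additivity the mean displacement at time 1 is m times the one at time
   1/m, which is 1/m times the mean of b up to O(1/m^2). *)
Lemma mean_displacement i : \int[mu]_(y in Yd) u i 1 y = \int[mu]_(y in Yd) b y ord0 i.
Proof.
have [C C0 hC] := flow_displacement2 hb hX; have [B B0 hB] := field_bounded hb.
pose I := \int[mu]_(y in Yd) b y ord0 i.
have mb : measurable_fun setT (fun y => b y ord0 i).
  apply: (measurableT_comp (measurable_coord_rV i)).
  by apply: continuous_measurable_rVrV; exact: (field_continuous hb).
have intb : mu.-integrable Yd (EFin \o (fun y => b y ord0 i)).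
  by apply: (@Yd_integrable _ B) => // x; rewrite (le_trans (rV_norm_coord _ _)).
have small t : `|\int[mu]_(y in Yd) u i t y - t * I| <= C * t ^+ 2.
  have ib : mu.-integrable Yd (EFin \o (fun y => t * b y ord0 i)).
    by have := integrableZl mY t intb; apply: eq_integrable.
  rewrite -RintegralZl// -RintegralB//.
  have iD : mu.-integrable Yd (EFin \o (fun y => u i t y - t * b y ord0 i)).
    by have := integrableB mY (intu i t) ib; apply: eq_integrable.
  rewrite (le_trans (le_normr_Rintegral mY iD))//.
  have iC : mu.-integrable Yd (EFin \o (fun=> C * t ^+ 2 : R)).
    by apply: (@Yd_integrable _ `|C * t ^+ 2|).
  apply: (@le_trans _ _ (\int[mu]_(y in Yd) (C * t ^+ 2))).
    apply: le_Rintegral => //; first exact: integrable_norm.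
    move=> y _; apply: le_trans (hC t y); rewrite (le_trans _ (rV_norm_coord _ i))//.
    by rewrite /u !mxE.
  rewrite Rintegral_cst// -[leRHS]mulr1 ler_wpM2l//.
    by rewrite mulr_ge0// sqr_ge0.
  by rewrite -lee_fin fineK ?fin_num_measure// probability_le1.
apply/eqP; rewrite -subr_eq0 -normr_le0; apply/ler_addgt0Pr => e e0; rewrite add0r.
have [m hm] : exists m : nat, C / e < m.+1%:R.
  have h := archi_boundP (divr_ge0 C0 (ltW e0)).
  by exists (Num.bound (C / e)); rewrite (lt_le_trans h)// ler_nat.
have m0 : 0 < m.+1%:R :> R by rewrite ltr0n.
have E : \int[mu]_(y in Yd) u i 1 y = m.+1%:R * \int[mu]_(y in Yd) u i m.+1%:R^-1 y.
  by rewrite -mean_displacementMn mulfV ?gt_eqF.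
have -> : \int[mu]_(y in Yd) u i 1 y - \int[mu]_(y in Yd) b y ord0 i =
   m.+1%:R * (\int[mu]_(y in Yd) u i m.+1%:R^-1 y - m.+1%:R^-1 * I).
  by rewrite E mulrBr mulrA mulfV ?gt_eqF// mul1r.
rewrite normrM (gtr0_norm m0) -ler_pdivlMl// (le_trans (small _))//.
rewrite expr2 mulrA mulrC ler_pM2l ?invr_gt0// ler_pdivrMr//.
by move: hm; rewrite ltr_pdivrMr// mulrC => /ltW.
Qed.

Lemma mean_displacement_nat i (n : nat) :
  \int[mu]_(y in Yd) u i n%:R y = n%:R * \int[mu]_(y in Yd) b y ord0 i.
Proof. by have := mean_displacementMn i 1 n; rewrite mulr1 mean_displacement. Qed.

End mean_displacement.

Section density_on_torus.
Context {R : realType} {d : nat}.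
Local Notation Rd := 'rV[R]_d.
Local Notation leb := (lebesgue_rV d : {measure set Rd -> \bar R}).

(** [has_density] does not impose a sign on sigma. On the part of Yd where sigma < 0 its integral is
    a measure, hence nonnegative, so |sigma| integrates to zero there. *)
Lemma has_density_ge0 (mu : {measure set Rd -> \bar R}) (sigma : Rd -> R) :
  L1_sharp sigma -> has_density mu sigma ->
  leb (Yd `&` [set x | sigma x < 0]) = 0%E.
Proof.
move=> [ms is_ _] hd; have mY := @measurable_Yd R d.
pose N : set Rd := Yd `&` [set x | sigma x < 0].
have mN : measurable N.
  apply: measurableI => //; rewrite -[X in measurable X]setTI.
  have := ms measurableT _ (measurable_itv `]-oo, (0 : R)[).
  by congr (measurable (_ `&` _)); apply/seteqP; split => x; rewrite /= in_itv.
have intN : leb.-integrable N (EFin \o sigma).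
  have iK := is_ _ (@compact_norm_le R d 1).
  by apply: (integrableS (measurable_norm_le 1) mN _ iK) => x [/Yd_norm].
have E : (\int[leb]_(x in N) `|(EFin \o sigma) x| = 0)%E.
  have muN : mu N = (\int[leb]_(x in N) (sigma x)%:E)%E.
    by rewrite hd//; congr integral; rewrite /N setIAC setIid.
  have -> : (\int[leb]_(x in N) `|(EFin \o sigma) x| = (- 1)%:E * \int[leb]_(x in N) (sigma x)%:E)%E.
    rewrite -integralZl//; apply: eq_integral => x; rewrite inE => -[_ /= s0].
    by rewrite ltr0_norm// -EFinM mulN1r.
  apply/eqP; rewrite eq_le; apply/andP; split.
    by rewrite -muN mulN1e oppe_le0.
  have -> : ((- 1)%:E * \int[leb]_(x in N) (sigma x)%:E = \int[leb]_(x in N) (- sigma x)%:E)%E.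
    by rewrite -integralZl//; apply: eq_integral => x _; rewrite -EFinM mulN1r.
  by apply: integral_ge0 => x [_ /= s0]; rewrite lee_fin oppr_ge0 ltW.
have mEs : measurable_fun N (EFin \o sigma) by apply/measurable_EFinP; exact: measurable_funTS.
have [M [mM M0 NM]] := (ae_eq_integral_abs leb mN mEs).1 E.
apply: (subset_measure0 mN mM) => // x Nx; apply: NM => /= h.
have [_ /= s0] := Nx; have := h Nx; rewrite /= => -[s00]; by rewrite s00 ltxx in s0.
Qed.

(** mu coincides with the measure whose density is max(sigma, 0) on Yd and 0 elsewhere; this density
    is nonnegative everywhere and equals sigma a.e. on Yd. *)
Lemma has_density_integral (mu : {measure set Rd -> \bar R}) (sigma g : Rd -> R) :
  L1_sharp sigma -> has_density mu sigma -> measurable_fun setT g ->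
  \int[mu]_(y in Yd) g y = \int[leb]_(y in Yd) (g y * sigma y).
Proof.
move=> ls hd mg; have mY := @measurable_Yd R d; have N0 := has_density_ge0 ls hd.
have [ms _ _] := ls.
pose p (x : Rd) : R := Num.max (sigma x) 0.
have mp : measurable_fun setT p by apply: measurable_maxr => //; exact: measurable_cst.
pose s x := p x * \1_Yd x.
have ms' : measurable_fun setT s by apply: measurable_funM => //; exact: measurable_indic.
have s0 x : 0 <= s x by rewrite mulr_ge0 ?le_max ?lexx ?orbT// indicE ler0n.
have aep : {ae leb, forall x, Yd x -> sigma x = p x}.
  exists (Yd `&` [set x | sigma x < 0]); split => //.
  - apply: measurableI => //; rewrite -[X in measurable X]setTI.
    have := ms measurableT _ (measurable_itv `]-oo, (0 : R)[).
    by congr (measurable (_ `&` _)); apply/seteqP; split => x; rewrite /= in_itv.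
  - move=> x /= /not_implyP[xY h]; split => //=; rewrite ltNge; apply/negP => sx.
    by apply: h; rewrite /p max_l.
pose D := density_measure leb ms' s0.
have muD A : measurable A -> mu A = D A.
  move=> mA; rewrite hd// /D /density_measure.
  have -> : (\int[leb]_(x in A) (s x)%:E = \int[leb]_(x in A `&` Yd) (p x)%:E)%E.
    rewrite integral_mkcondr; apply: eq_integral => x _.
    by rewrite /s /patch indicE; case: (x \in Yd); rewrite ?mulr1 ?mulr0.
  apply: ae_eq_integral.
  - exact: measurableI.
  - by apply/measurable_EFinP; exact: measurable_funTS.
  - by apply/measurable_EFinP; exact: measurable_funTS.
  - by apply: filterS aep => x h [_ /h] /= ->.
rewrite /Rintegral; congr fine.
transitivity (\int[D]_(x in Yd) (g x)%:E)%E.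
  by apply: eq_measure_integral => A mA _; exact: muD.
transitivity (\int[D]_x (g x * \1_Yd x)%:E)%E.
  rewrite integral_mkcond; apply: eq_integral => x _.
  by rewrite /patch indicE; case: (x \in Yd); rewrite ?mulr1 ?mulr0.
rewrite integral_density; last by apply: measurable_funM => //; exact: measurable_indic.
rewrite [RHS]integral_mkcond; apply: ae_eq_integral => //.
- apply/measurable_EFinP; apply: measurable_funM => //.
  by apply: measurable_funM => //; exact: measurable_indic.
- apply/(measurable_restrictT _ mY); apply/measurable_EFinP.
  by apply: measurable_funTS; exact: measurable_funM.
- apply: filterS aep => x h _; rewrite /patch /s !indicE.
  case: (boolP (x \in Yd)) => xY; last by rewrite !(mulr0, mul0r).
  by rewrite !mulr1 h//; exact/set_mem.
Qed.

End density_on_torus.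

(** * The measure with density [sigma0], on the space and on the torus *)

Section transported_density.
Context {R : realType} {d : nat}.
Local Notation Rd := 'rV[R]_d.
Local Notation leb := (lebesgue_rV d : {measure set Rd -> \bar R}).
Variable b : Rd -> Rd.
Hypothesis hb : Ck_sharp 1 b.
Variable X : R -> Rd -> Rd.
Hypothesis hX : is_flow b X.
Variable sigma0 : Rd -> R.
Hypothesis L1sigma : L1_sharp sigma0.
Hypothesis sigma0_gt0 : {ae leb, forall x, 0 < sigma0 x}.
Hypothesis sigma0_mass : (\int[leb]_(y in Yd) (sigma0 y)%:E = 1)%E.
Hypothesis sigma0_div : distr_div_free (fun x => sigma0 x *: b x).

(* sigma0 is positive only almost everywhere, whereas a measure needs a density
   that is nonnegative everywhere. *)
Definition pos_part (x : Rd) : R := Num.max (sigma0 x) 0.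

Lemma pos_part_ge0 x : 0 <= pos_part x.
Proof. by rewrite le_max lexx orbT. Qed.

Lemma measurable_pos_part : measurable_fun [set: Rd] pos_part.
Proof. by have [ms _ _] := L1sigma; apply: measurable_maxr => //; exact: measurable_cst. Qed.

Lemma pos_partE : {ae leb, forall x, sigma0 x = pos_part x}.
Proof. by apply: filterS sigma0_gt0 => x h; rewrite /pos_part max_l// ltW. Qed.

Definition space_measure := density_measure leb measurable_pos_part pos_part_ge0.

Let nu : {measure set Rd -> \bar R} := space_measure.

Lemma space_measureE A : measurable A -> nu A = (\int[leb]_(x in A) (sigma0 x)%:E)%E.
Proof.
move=> mA; rewrite /nu /space_measure /= /density_measure; apply: ae_eq_integral => //.
- by apply/measurable_EFinP; apply: measurable_funTS; exact: measurable_pos_part.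
- by apply/measurable_EFinP; apply: measurable_funTS; have [] := L1sigma.
- by apply: filterS pos_partE => x -> _.
Qed.

Lemma space_measure_ball (Q : R) : (nu [set x : Rd | (`|x| <= Q)%R] < +oo)%E.
Proof.
have mK := @measurable_norm_le R d Q.
rewrite space_measureE//; have [_ h _] := L1sigma.
have iK := h _ (@compact_norm_le R d Q).
by have := integrable_fin_num mK iK; rewrite fin_numElt => /andP[].
Qed.

Lemma space_measure_div (phi : Rd -> R) (Q : R) : smooth phi ->
  (forall x : Rd, Q < `|x| -> phi x = 0) ->
  (\int[nu]_x (lin (b x) (fun j => partial j phi x))%:E = 0)%E.
Proof.
move=> sphi phi0.
have mlin : measurable_fun setT (fun x => lin (b x) (fun j => partial j phi x)).
  apply: measurable_sum => i; apply: measurable_funM.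
    apply: (measurableT_comp (measurable_coord_rV i)).
    by apply: continuous_measurable_rVrV; exact: (field_continuous hb).
  by apply: continuous_measurable_rV; exact: (sphi 1%N).2.
have cphi : compact (closure [set x | phi x != 0]).
  apply: (subclosed_compact _ (@compact_norm_le R d Q)); first exact: closed_closure.
  have cl : closed [set z : Rd | `|z| <= Q].
    by apply: (closed_comp (f := fun z : Rd => `|z|)) (@closed_le _ Q) => z _; exact: norm_continuous.
  rewrite [X in _ `<=` X]((closure_id _).1 cl).
  apply: closureS => x /= px; rewrite leNgt; apply/negP => /phi0 p0.
  by rewrite p0 eqxx in px.
rewrite integral_density// -[RHS](sigma0_div sphi cphi).
have E x : \sum_(i < d) (sigma0 x *: b x) ord0 i * partial i phi x =
    lin (b x) (fun j => partial j phi x) * sigma0 x.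
  by rewrite /lin mulr_suml; apply: eq_bigr => i _; rewrite mxE; ring.
under [RHS]eq_integral do rewrite E.
apply: ae_eq_integral => //.
- by apply/measurable_EFinP; apply: measurable_funM => //; exact: measurable_pos_part.
- by apply/measurable_EFinP; apply: measurable_funM => //; have [] := L1sigma.
- by apply: filterS pos_partE => x -> _.
Qed.

Lemma space_measure_invariant t A : measurable A -> nu (X t @^-1` A) = nu A.
Proof. by move=> mA; exact: (liouville hb hX space_measure_ball space_measure_div). Qed.

Lemma space_measure_translate (k : 'rV[int]_d) A : measurable A ->
  nu ((fun x : Rd => x + map_mx intr k) @^-1` A) = nu A.
Proof.
move=> mA; set T := fun x : Rd => x + map_mx intr k.
have mT : measurable_fun setT T by exact: translate_measurable.
have mTA : measurable (T @^-1` A) by rewrite -[X in measurable X]setTI; exact: mT.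
have mp : measurable_fun setT (EFin \o pos_part).
  by apply/measurable_EFinP; exact: measurable_pos_part.
(* The density is periodic almost everywhere, so it may be composed with T before the change of
   variables. *)
have -> : nu (T @^-1` A) = (\int[leb]_(x in T @^-1` A) (((EFin \o pos_part) \o T) x))%E.
  rewrite /nu /space_measure /= /density_measure; apply: ae_eq_integral => //.
  - exact: measurable_funTS.
  - by apply: measurable_funTS; exact: (measurableT_comp mp mT).
  - have [_ _ /(_ k) per] := L1sigma.
    by apply: filterS per => x h _ /=; rewrite /pos_part h.
rewrite -ge0_integral_pushforward//; last 2 first.
- exact: measurable_funTS.
- by move=> x _; rewrite lee_fin pos_part_ge0.
apply: eq_measure_integral => B mB _; exact: lebesgue_rV_translate.
Qed.

Definition torus_measure := mrestr nu (@measurable_Yd R d).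

Let P : {measure set Rd -> \bar R} := torus_measure.

Lemma torus_measureT : P setT = 1%E.
Proof. by rewrite /P /torus_measure /= /mrestr setTI space_measureE ?sigma0_mass//; exact: measurable_Yd. Qed.

Lemma torus_measure_fin : (P setT < +oo)%E. Proof. by rewrite torus_measureT ltry. Qed.

Lemma torus_measure_invariant t A : measurable A -> Zd_periodic A -> P (X t @^-1` A) = P A.
Proof.
by move=> mA pA; exact: (torus_invariance hb hX space_measure_invariant space_measure_translate).
Qed.

Lemma torus_measure_null A : measurable A -> P A = 0%E -> leb (A `&` Yd) = 0%E.
Proof.
move=> mA; rewrite /P /torus_measure /= /mrestr => PA.
have mAY : measurable (A `&` Yd) by apply: measurableI => //; exact: measurable_Yd.
have mE : measurable_fun (A `&` Yd) (EFin \o pos_part).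
  by apply: measurable_funTS; apply/measurable_EFinP; exact: measurable_pos_part.
have E : (\int[leb]_(x in A `&` Yd) `|(EFin \o pos_part) x| = 0)%E.
  rewrite -[RHS]PA; apply: eq_integral => x _.
  by rewrite /= ger0_norm// pos_part_ge0.
have h0 := (ae_eq_integral_abs leb mAY mE).1 E.
have [M [mM M0 NM]] := filterI h0 sigma0_gt0.
apply: (subset_measure0 mAY mM) => // x Nx; apply: NM => /= -[h1 h2].
by have [] := h1 Nx; rewrite /pos_part max_l ?ltW// => h3; rewrite h3 ltxx in h2.
Qed.

End transported_density.

(** * Conditioning on an invariant periodic set *)

Section invariant_set.
Context {R : realType} {d : nat}.
Local Notation Rd := 'rV[R]_d.
Local Notation leb := (lebesgue_rV d : {measure set Rd -> \bar R}).
Variable b : Rd -> Rd.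
Hypothesis hb : Ck_sharp 1 b.
Variable X : R -> Rd -> Rd.
Hypothesis hX : is_flow b X.
Variable sigma0 : Rd -> R.
Hypothesis L1sigma : L1_sharp sigma0.
Hypothesis sigma0_gt0 : {ae leb, forall x, 0 < sigma0 x}.
Hypothesis sigma0_mass : (\int[leb]_(y in Yd) (sigma0 y)%:E = 1)%E.
Hypothesis sigma0_div : distr_div_free (fun x => sigma0 x *: b x).

Let P : {measure set Rd -> \bar R} := torus_measure L1sigma.

Variable A : set Rd.
Hypothesis mA : measurable A.
Hypothesis A_per : Zd_periodic A.
Hypothesis A_inv : forall t x, A (X t x) <-> A x.
Hypothesis PA : P A != 0%E.

Let P_fin : (P setT < +oo)%E. Proof. exact: torus_measure_fin. Qed.

Let m : R := fine (P A).

Let PAm : P A = m%:E.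
Proof.
rewrite /m fineK// ge0_fin_numE//; apply: le_lt_trans P_fin.
by apply: le_measure; rewrite ?inE.
Qed.

Let m_gt0 : 0 < m.
Proof. by rewrite -lte_fin -PAm lt_def PA measure_ge0. Qed.

Definition normalized_indic (x : Rd) : R := m^-1 * \1_A x.

Lemma normalized_indic_ge0 x : 0 <= normalized_indic x.
Proof. by rewrite mulr_ge0 ?invr_ge0 ?(ltW m_gt0)// indicE ler0n. Qed.

Lemma measurable_normalized_indic : measurable_fun [set: Rd] normalized_indic.
Proof. by apply: measurable_funM => //; exact: measurable_indic. Qed.

(** P(. | A), written with a density relative to P so that [integral_density] computes its
    integrals. *)
Definition cond_measure := density_measure P measurable_normalized_indic normalized_indic_ge0.

Lemma cond_measureE B : measurable B -> cond_measure B = (m^-1%:E * P (A `&` B)%classic)%E.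
Proof.
move=> mB; rewrite /cond_measure /= /density_measure.
under eq_integral do rewrite EFinM.
rewrite ge0_integralZl_EFin//.
- by rewrite integral_indic.
- by apply/measurable_EFinP; apply: measurable_funTS; exact: measurable_indic.
- by rewrite invr_ge0 (ltW m_gt0).
Qed.

Lemma cond_measureT : cond_measure setT = 1%E.
Proof. by rewrite cond_measureE// setIT PAm -EFinM mulVf// (gt_eqF m_gt0). Qed.

HB.instance Definition _ := Measure.on cond_measure.
HB.instance Definition _ := Measure_isProbability.Build _ _ _ cond_measure cond_measureT.

Definition cond_probability : probability Rd R := cond_measure.

Let mY := @measurable_Yd R d.

Lemma cond_probability_Yd : cond_probability Yd = 1%E.
Proof.
rewrite /= cond_measureE// -cond_measureT cond_measureE//; congr (_ * _)%E.
by rewrite /P /torus_measure /= /mrestr setIT -setIA setIid.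
Qed.

Lemma cond_integrable (g : Rd -> R) (C : R) : measurable_fun setT g ->
  (forall x, `|g x| <= C) -> cond_probability.-integrable setT (EFin \o g).
Proof. by move=> mg gC; apply: (bounded_integrable _ mg gC); rewrite [X in (X < _)%E](probability_setT cond_probability) ltry. Qed.

(** The conditional measure is carried by Yd, so integrating over Yd or over the whole space is the
    same; boundedness of g makes the value a real integral against P. *)
Lemma cond_integral_Yd (g : Rd -> R) (C : R) : measurable_fun setT g ->
  (forall x, `|g x| <= C) ->
  (\int[cond_probability]_(x in Yd) (g x)%:E = (\int[P]_x (normalized_indic x * g x))%:E)%E.
Proof.
move=> mg gC; have ig := cond_integrable mg gC.
have -> : (\int[cond_probability]_(x in Yd) (g x)%:E = \int[cond_probability]_x (g x)%:E)%E.
  have NY : cond_probability (~` Yd) = 0%E.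
    by rewrite probability_setC// cond_probability_Yd subee.
  by rewrite [RHS](negligible_integral (measurableC mY) measurableT ig NY) setTD setCK.
have mng : measurable_fun setT (fun x => normalized_indic x * g x).
  by apply: measurable_funM => //; exact: measurable_normalized_indic.
rewrite -[LHS]/(\int[cond_measure]_x (g x)%:E)%E [LHS]integral_density//.
under eq_integral do rewrite mulrC.
rewrite /Rintegral fineK//; apply: (integrable_fin_num measurableT).
apply: (bounded_integrable P_fin mng (C := m^-1 * C)) => x.
by rewrite normrM ler_pM// normrM ger0_norm ?invr_ge0 ?(ltW m_gt0)// ler_piMr ?invr_ge0 ?(ltW m_gt0)// indic_Rd_le1.
Qed.

(** As A is invariant, 1_A(x) psi(X_t x) = (1_A psi)(X_t x), and 1_A psi is bounded and periodic
    because A is; the invariance of P on periodic sets then suffices. *)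
Lemma cond_probability_invariant : invariant_probabilities X cond_probability.
Proof.
split; first exact: cond_probability_Yd.
move=> t psi [cpsi ppsi]; have [C C0 hC] := lbt_bounded cpsi (periodic_lbt ppsi).
have mpsi := continuous_measurable_rV cpsi.
have mX := flow_measurable hb hX t.
rewrite (@cond_integral_Yd (fun y => psi (X t y)) C)//; last exact: measurableT_comp mpsi mX.
rewrite (@cond_integral_Yd psi C)//; congr (_%:E).
pose g x := normalized_indic x * psi x.
have gX x : normalized_indic x * psi (X t x) = g (X t x).
  rewrite /g /normalized_indic; congr (_ * _ * _); rewrite !indicE.
  by congr (nat_of_bool _)%:R; apply/idP/idP => /set_mem/A_inv/mem_set.
under eq_Rintegral do rewrite gX.
apply: (periodic_Rintegral P_fin mX _ (C := m^-1 * C)).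
- by move=> B mB pB; exact: (torus_measure_invariant hb hX).
- by apply: measurable_funM => //; exact: measurable_normalized_indic.
- move=> x; rewrite normrM ler_pM// normrM ger0_norm ?invr_ge0 ?(ltW m_gt0)// ler_piMr//.
    by rewrite invr_ge0 (ltW m_gt0).
  exact: indic_Rd_le1.
- by move=> k x; rewrite /g /normalized_indic (indic_periodic A_per) ppsi.
Qed.

Definition cond_density (x : Rd) : R := sigma0 x * normalized_indic x.

Lemma cond_density_L1 : L1_sharp cond_density.
Proof.
have [ms is_ ps] := L1sigma; split.
- by apply: measurable_funM => //; exact: measurable_normalized_indic.
- move=> K cK; have mK : measurable K.
    rewrite -(setCK K); apply: measurableC; apply: open_measurable_rV.
    by rewrite openC; apply: compact_closed => //; exact: norm_hausdorff.
  have := integrableMl mK (is_ K cK) (measurable_funTS measurable_normalized_indic).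
  apply; exists m^-1; split; [exact: num_real|move=> M CM x _].
  rewrite /= normrM ger0_norm ?invr_ge0 ?(ltW m_gt0)// (le_trans _ (ltW CM))// ler_piMr//.
    by rewrite invr_ge0 (ltW m_gt0).
  exact: indic_Rd_le1.
- move=> k; apply: filterS (ps k) => x h.
  by rewrite /cond_density h /normalized_indic (indic_periodic A_per).
Qed.

Lemma cond_has_density : has_density cond_probability cond_density.
Proof.
have [ms is_ _] := L1sigma; move=> B mB.
have mAB : measurable (A `&` B) by exact: measurableI.
rewrite /= cond_measureE// /P /torus_measure /= /mrestr space_measureE//; last exact: measurableI.
rewrite setIC setICA setIC [(Yd `&` B)%classic]setIC.
rewrite -integralZl//; last 2 first.
- by apply: measurableI => //; exact: measurableI.
- apply: (integrableS (measurable_norm_le 1) _ _ (is_ _ (@compact_norm_le R d 1))).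
    by apply: measurableI => //; exact: measurableI.
  by move=> x [[_ /Yd_norm]].
rewrite integral_mkcondr; apply: eq_integral => x _.
rewrite /patch /cond_density /normalized_indic indicE.
by case: (x \in A); rewrite ?mulr1 ?mulr0// -EFinM mulrC.
Qed.

(** The field is absent from the conclusion on purpose: the time-one displacement is the function
    whose sums along the orbits of X_1 enter the discrete-time maximal inequality. *)
Lemma Db_cond : exists2 z, Db b X z &
  forall i, m * z ord0 i = \int[P]_x (\1_A x * (X 1 x - x) ord0 i).
Proof.
exists (\row_i Rintegral leb Yd (fun y => b y ord0 i * cond_density y)).
  exists cond_density; split => //; first exact: cond_density_L1.
  exists cond_probability; [exact: cond_probability_invariant|exact: cond_has_density].
move=> i; rewrite mxE.
have mb : measurable_fun setT (fun y => b y ord0 i).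
  apply: (measurableT_comp (measurable_coord_rV i)).
  by apply: continuous_measurable_rVrV; exact: (field_continuous hb).
rewrite -(has_density_integral cond_density_L1 cond_has_density mb).
rewrite -(mean_displacement hb hX cond_probability_invariant.2).
have [B B0 hB] := field_bounded hb.
have mu1 : measurable_fun setT (fun y => (X 1 y - y) ord0 i).
  by apply: continuous_measurable_rV; exact: (displacement_continuous hb hX).
have u1 x : `|(X 1 x - x) ord0 i| <= B * `|1|.
  by rewrite (le_trans (rV_norm_coord _ _))//; exact: (flow_displacement hX hB).
rewrite /Rintegral (cond_integral_Yd mu1 u1) /= -RintegralZl//; last first.
  apply: (bounded_integrable P_fin (C := m^-1 * (B * `|1|))).
    by apply: measurable_funM => //; exact: measurable_normalized_indic.
  move=> x; rewrite normrM ler_pM// normrM ger0_norm ?invr_ge0 ?(ltW m_gt0)// ler_piMr//.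
    by rewrite invr_ge0 (ltW m_gt0).
  exact: indic_Rd_le1.
by apply: eq_Rintegral => x _; rewrite /normalized_indic !mulrA mulfV ?(gt_eqF m_gt0)// mul1r.
Qed.

End invariant_set.

(** * Drift sets *)

Section drift.
Context {R : realType} {d : nat}.
Local Notation Rd := 'rV[R]_d.
Local Notation leb := (lebesgue_rV d : {measure set Rd -> \bar R}).
Variable b : Rd -> Rd.
Hypothesis hb : Ck_sharp 1 b.
Variable X : R -> Rd -> Rd.
Hypothesis hX : is_flow b X.

(** Unboundedness is insensitive to bounded changes of the orbit, such as a lattice translation or a
    shift of time; this gives exact periodicity and invariance. Integer times keep the set
    measurable and match the iterates of X_1. *)
Definition drift_set (i : 'I_d) (a c : R) : set Rd :=
  [set x | forall K : nat, exists n : nat, K%:R < a * X n%:R x ord0 i - n%:R * c].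

Lemma drift_set_bounded i a c (C : R) (x y : Rd) :
  (forall n : nat, `|X n%:R x - X n%:R y| <= C) -> drift_set i a c x -> drift_set i a c y.
Proof.
move=> xyC Ax K.
have C0 : 0 <= `|a| * C by rewrite mulr_ge0// (le_trans _ (xyC 0%N)).
have [n hn] := Ax (K + Num.bound (`|a| * C))%N; exists n; move: hn.
have h1 : `|a * (X n%:R x - X n%:R y) ord0 i| <= `|a| * C.
  by rewrite normrM ler_wpM2l// (le_trans (rV_norm_coord _ _)).
have h2 := archi_boundP C0.
have := le_trans (ler_norm _) h1; rewrite natrD !mxE; lra.
Qed.

Lemma drift_set_periodic i a c : Zd_periodic (drift_set i a c).
Proof.
move=> k x; apply/propext.
have E (n : nat) : X n%:R (x + map_mx intr k) - X n%:R x = map_mx intr k.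
  by rewrite (flow_periodic hb hX) addrAC subrr add0r.
split; apply: (drift_set_bounded (C := `|map_mx intr k : Rd|)) => n.
  by rewrite E.
by rewrite distrC E.
Qed.

Lemma drift_set_invariant i a c t x : drift_set i a c (X t x) <-> drift_set i a c x.
Proof.
have [B B0 hB] := field_bounded hb.
have E (n : nat) : `|X n%:R (X t x) - X n%:R x| <= B * `|t|.
  by rewrite -(flowD hb hX) [n%:R + t]addrC (flowD hb hX); exact: (flow_displacement hX hB).
split; apply: (drift_set_bounded (C := B * `|t|)) => n; first exact: E.
by rewrite distrC; exact: E.
Qed.

Lemma measurable_drift_set i a c : measurable (drift_set i a c).
Proof.
have -> : drift_set i a c = \bigcap_(K : nat) \bigcup_(n : nat)
    [set x | K%:R < a * X n%:R x ord0 i - n%:R * c].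
  apply/seteqP; split => [x h K _|x h K]; first by have [n] := h K; exists n.
  by have [n _] := h K I; exists n.
apply: bigcapT_measurable => K; apply: bigcupT_measurable => n.
have mf : measurable_fun setT (fun x => a * X n%:R x ord0 i - n%:R * c).
  apply: measurable_funB; last exact: measurable_cst.
  apply: measurable_funM; first exact: measurable_cst.
  by apply: (measurableT_comp (measurable_coord_rV i)); exact: (flow_measurable hb hX).
rewrite -[X in measurable X]setTI.
have := mf measurableT _ (measurable_itv `](K%:R : R), +oo[).
by congr (measurable (_ `&` _)); apply/seteqP; split => x; rewrite /= in_itv/= andbT.
Qed.

(** Between an integer time and the next, the orbit moves by at most B and the term t c by at most
    |c|, so a bound along integers extends to all times. *)
Lemma drift_bounded i a c x : ~ drift_set i a c x ->
  exists C : R, forall t, 0 <= t -> a * X t x ord0 i <= t * c + C.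
Proof.
move=> nA.
have [K hK] : exists K : nat, forall n : nat, a * X n%:R x ord0 i - n%:R * c <= K%:R.
  apply: contrapT => h; apply: nA => K; apply: contrapT => h'; apply: h.
  by exists K => n; rewrite leNgt; apply/negP => hn; apply: h'; exists n.
have [B B0 hB] := field_bounded hb.
exists (K%:R + `|a| * B + `|c|) => t t0.
have /andP[n1 n2] := truncn_itv t0; set n := Num.truncn t in n1 n2.
have tn : `|t - n%:R| <= 1 by rewrite ger0_norm ?subr_ge0// lerBlDr addrC natr1 ltW.
have h1 : `|a * (X t x - X n%:R x) ord0 i| <= `|a| * B.
  rewrite normrM ler_wpM2l// (le_trans (rV_norm_coord _ _))//.
  rewrite -[t in X t _](subrK n%:R) (flowD hb hX).
  by rewrite (le_trans (flow_displacement hX hB _ _))// ler_piMr.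
have h2 : `|(t - n%:R) * c| <= `|c| by rewrite normrM ler_piMl.
have := hK n; have := le_trans (ler_norm _) h1.
have := le_trans (ler_norm (- _)) (_ : `|- ((t - n%:R) * c)| <= `|c|).
rewrite normrN => /(_ h2); rewrite !mxE; lra.
Qed.

Variable sigma0 : Rd -> R.
Hypothesis L1sigma : L1_sharp sigma0.
Hypothesis sigma0_gt0 : {ae leb, forall x, 0 < sigma0 x}.
Hypothesis sigma0_mass : (\int[leb]_(y in Yd) (sigma0 y)%:E = 1)%E.
Hypothesis sigma0_div : distr_div_free (fun x => sigma0 x *: b x).

Let P : {measure set Rd -> \bar R} := torus_measure L1sigma.

Lemma drift_set_null i a c : (forall z, Db b X z -> a * z ord0 i < c) ->
  leb (drift_set i a c `&` Yd) = 0%E.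
Proof.
move=> zc; set A := drift_set i a c.
have mA : measurable A by exact: measurable_drift_set.
have pA : Zd_periodic A by exact: drift_set_periodic.
apply: (torus_measure_null sigma0_gt0 (L1sigma := L1sigma) mA).
apply/eqP/negPn/negP => PA.
have Ainv t x : A (X t x) <-> A x by exact: drift_set_invariant.
have [z Dz hz] := Db_cond hb hX sigma0_gt0 sigma0_mass sigma0_div mA pA Ainv PA.
have P_fin : (P setT < +oo)%E by exact: torus_measure_fin.
have PAfin : P A \is a fin_num.
  by rewrite ge0_fin_numE//; apply: le_lt_trans P_fin; apply: le_measure; rewrite ?inE.
have m0 : 0 < fine (P A).
  by rewrite -lte_fin fineK// lt_def PA measure_ge0.
have [B B0 hB] := field_bounded hb.
pose v (x : Rd) := (X 1 x - x) ord0 i.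
have mv : measurable_fun setT v.
  by apply: continuous_measurable_rV; exact: (displacement_continuous hb hX).
have vB x : `|v x| <= B.
  rewrite (le_trans (rV_norm_coord _ _))// (le_trans (flow_displacement hX hB _ _))//.
  by rewrite normr1 mulr1.
have vper : Zd_periodic v by exact: (displacement_periodic hb hX).
(* The sums of a v - c along the orbits of X_1 telescope to a (X_n(x) - x)_i - n c. *)
have := @maximal_ergodic R d P (X 1) P_fin (flow_measurable hb hX 1)
  (fun k x => flow_periodic hb hX 1 x k)
  (fun B mB pB => torus_measure_invariant hb hX L1sigma sigma0_gt0 sigma0_div 1 mB pB)
  (fun x => a * v x - c) (`|a| * B + `|c|)
  (fun n x => a * (X n%:R x - x) ord0 i - n%:R * c) A.
have mu_ : measurable_fun setT (fun x => a * v x - c).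
  by apply: measurable_funB => //; apply: measurable_funM.
have mIv : measurable_fun setT (fun x => \1_A x * v x).
  by apply: measurable_funM => //; exact: measurable_indic.
have i1 : P.-integrable setT (EFin \o (fun x => \1_A x * v x)).
  apply: (bounded_integrable P_fin mIv (C := B)) => x.
  by rewrite normrM -[leRHS]mul1r ler_pM// indic_Rd_le1.
have i2 : P.-integrable setT (EFin \o (\1_A : Rd -> R)).
  apply: (bounded_integrable P_fin _ (C := 1)); first exact: measurable_indic.
  by move=> x; exact: indic_Rd_le1.
have -> : \int[P]_x (\1_A x * (a * v x - c)) = fine (P A) * (a * z ord0 i - c).
  transitivity (\int[P]_x (a * (\1_A x * v x) - c * \1_A x)).
    by apply: eq_Rintegral => x _; ring.
  rewrite RintegralB//; last 2 first.
  - by have := integrableZl measurableT a i1; apply: eq_integrable.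
  - by have := integrableZl measurableT c i2; apply: eq_integrable.
  rewrite !RintegralZl// -hz.
  have -> : \int[P]_x (\1_A x) = fine (P A).
    by rewrite /Rintegral integral_indic// setIT.
  by rewrite /P; ring.
move=> h; have {h} : 0 <= fine (P A) * (a * z ord0 i - c).
  apply: h => //.
  - move=> x; rewrite (le_trans (ler_normB _ _))// lerD2r normrM ler_wpM2l//.
  - by move=> k x; rewrite vper.
  - by move=> x; rewrite (flow0 hX) subrr mxE mulr0 mul0r subrr.
  - move=> n x; rewrite -natr1 (flowD hb hX) /v !mxE; ring.
  (* The drift set is defined with X_n(x), the sums with X_n(x) - x: exceeding |a x_i| compensates
     for the starting point. *)
  - move=> x Ax; have [n hn] := Ax (Num.bound `|a * x ord0 i|); exists n.
    have := archi_boundP (normr_ge0 (a * x ord0 i)); have := ler_norm (a * x ord0 i).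
    move: hn; rewrite !mxE; lra.
by rewrite pmulr_rge0// subr_ge0 leNgt (zc _ Dz).
Qed.

(** The whole space is an admissible invariant set, of mass 1. *)
Lemma Db_nonempty : exists z, Db b X z.
Proof.
have PT : P setT != 0%E by rewrite /P (torus_measureT L1sigma sigma0_gt0 sigma0_mass) eqe oner_eq0.
have pT : Zd_periodic ([set: Rd] : set Rd) by [].
have iT t x : [set: Rd] (X t x) <-> [set: Rd] x by [].
have [z Dz _] := Db_cond hb hX sigma0_gt0 sigma0_mass sigma0_div measurableT pT iT PT.
by exists z.
Qed.

End drift.

(** * Limits of the averages X_t(x) / t *)

Section rotation_vector.
Context {R : realType} {d : nat}.
Local Notation Rd := 'rV[R]_d.
Local Notation leb := (lebesgue_rV d : {measure set Rd -> \bar R}).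
Variable b : Rd -> Rd.
Hypothesis hb : Ck_sharp 1 b.
Variable X : R -> Rd -> Rd.
Hypothesis hX : is_flow b X.

(** The two signs bound each coordinate of X_t(x) from above and below by t zeta_i, up to t / (k +
    1) and a constant. Half of the error e absorbs 1 / (k + 1), the other half the constant divided
    by t. *)
Lemma flow_average_cvg (zeta x : Rd) :
  (forall i (s : bool) k, ~ drift_set X i ((-1) ^+ s) ((-1) ^+ s * zeta ord0 i + k.+1%:R^-1) x) ->
  (fun t : R => t^-1 *: X t x) @ +oo --> zeta.
Proof.
move=> hx; apply/cvgrPdist_le => e e0.
have [k ke] : exists k : nat, k.+1%:R^-1 < e / 2.
  by have [k] := @ltr_add_invr R 0 (e / 2) (divr_gt0 e0 (@ltr0Sn R 1)); rewrite add0r; exists k.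
have : \forall t \near +oo, forall i : 'I_d, `|(zeta - t^-1 *: X t x) ord0 i| <= e.
  apply: filter_forall => i.
  have [C1 h1] := drift_bounded hb hX (hx i false k).
  have [C2 h2] := drift_bounded hb hX (hx i true k).
  near=> t.
  have t0 : 0 < t by near: t; exact: nbhs_pinfty_gt.
  have hC1 : C1 <= t * (e / 2).
    by rewrite -ler_pdivrMr ?divr_gt0//; near: t; apply: nbhs_pinfty_ge; exact: num_real.
  have hC2 : C2 <= t * (e / 2).
    by rewrite -ler_pdivrMr ?divr_gt0//; near: t; apply: nbhs_pinfty_ge; exact: num_real.
  have := h1 t (ltW t0); have := h2 t (ltW t0); rewrite expr0 expr1 !mul1r !mulN1r => g2 g1.
  have tk : t * k.+1%:R^-1 <= t * (e / 2) by rewrite ler_pM2l// ltW.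
  rewrite !mxE -(ler_pM2l t0) -[X in X * `|_|](gtr0_norm t0) -normrM mulrBr mulVKf ?gt_eqF//.
  move: g1 g2 tk hC1 hC2; rewrite !mulrDr mulrN mulrCA; move: (t / _) (t * zeta ord0 i) (X t x ord0 i).
  move=> q w y g1 g2 tk hC1 hC2; rewrite ler_norml; apply/andP; split; lra.
by apply: filterS => t; apply: rV_norm_le; exact: ltW.
Unshelve. all: by end_near.
Qed.

Lemma flow_average_unique (zeta z : Rd) : {ae leb, forall x, Yd x ->
    (fun t : R => t^-1 *: X t x) @ +oo --> zeta} -> Db b X z -> z = zeta.
Proof.
move=> cv [sigma [ls [mu [muY mu_inv] hd] ->]]; apply/rowP => i; rewrite mxE.
have mY := @measurable_Yd R d.
have [B B0 hB] := field_bounded hb.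
rewrite -(has_density_integral ls hd); last first.
  apply: (measurableT_comp (measurable_coord_rV i)).
  by apply: continuous_measurable_rVrV; exact: (field_continuous hb).
set I := \int[mu]_(y in Yd) _.
pose f n (y : Rd) : R := n.+1%:R^-1 * (X n.+1%:R y - y) ord0 i.
have mf n : measurable_fun setT (f n).
  apply: measurable_funM; first exact: measurable_cst.
  by apply: continuous_measurable_rV; exact: (displacement_continuous hb hX).
have fB n y : `|f n y| <= B.
  rewrite normrM ger0_norm ?invr_ge0// ler_pdivrMl// mulrC.
  rewrite (le_trans (rV_norm_coord _ _))// (le_trans (flow_displacement hX hB _ _))//.
  by rewrite ger0_norm.
have fI n : \int[mu]_(y in Yd) f n y = I.
  rewrite RintegralZl//.
    by rewrite (mean_displacement_nat hb hX mu_inv) mulrA mulVf ?mul1r// pnatr_eq0.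
  apply: (@Yd_integrable _ _ mu _ (B * `|n.+1%:R|)).
    by apply: continuous_measurable_rV; exact: (displacement_continuous hb hX).
  by move=> x; exact: displacement_le.
have fcv : {ae mu, forall y, Yd y -> (f n y)%:E @[n --> \oo] --> (zeta ord0 i)%:E}.
  have [N [mN N0 hN]] := cv.
  (* A Lebesgue-null exceptional set is null for mu, since mu has a density; this is where absolute
     continuity enters. *)
  exists N; split => //.
    rewrite hd//; apply: null_set_integral.
    - exact: measurableI.
    - by apply/measurable_EFinP; apply: measurable_funTS; have [] := ls.
    - by apply: (subset_measure0 (measurableI _ _ mN mY) mN).
  apply: subset_trans hN => y; apply: contra_not => hy Yy.
  apply: cvg_EFin; first exact: nearW.
  have c1 : (n.+1%:R^-1 *: X n.+1%:R y) ord0 i @[n --> \oo] --> zeta ord0 i.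
    have cc : (M : Rd) ord0 i @[M --> zeta] --> zeta ord0 i by exact: coord_continuous.
    apply: cvg_comp cc; apply: cvg_comp (hy Yy).
    by have := @cvgr_idn R; rewrite -(cvg_shiftS _).
  have c2 : n.+1%:R^-1 * y ord0 i @[n --> \oo] --> (0 : R).
    by rewrite -[X in _ --> X](mul0r (y ord0 i)); apply: cvgMl; exact: cvg_harmonic.
  have -> : fine \o (fun n => (f n y)%:E) =
      (fun n : nat => (n.+1%:R^-1 *: X n.+1%:R y) ord0 i - n.+1%:R^-1 * y ord0 i).
    by apply/funext => n; rewrite /f /= !mxE mulrBr.
  by rewrite -[X in _ --> X]subr0; exact: cvgB c1 c2.
have iB : mu.-integrable Yd (EFin \o (fun=> B : R)).
  by apply: (@Yd_integrable _ _ mu (fun=> B) `|B|).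
have leB : {ae mu, forall (x : Rd) (n : nat), Yd x -> (`|(EFin \o f n) x| <= (EFin \o (fun=> B)) x)%E}.
  by apply: nearW => x n _; rewrite /= lee_fin.
have mEf n : measurable_fun (Yd : set Rd) (EFin \o f n).
  by apply/measurable_EFinP; exact: measurable_funTS.
have [_ _] := dominated_convergence mY mEf (measurable_cst (zeta ord0 i)%:E) fcv iB leB.
have -> : (\int[mu]_(x in Yd) cst (zeta ord0 i)%:E x = (zeta ord0 i)%:E)%E.
  by rewrite -[RHS]mule1 -muY; exact: integral_cst.
have -> : [sequence (\int[mu]_(x in Yd) (EFin \o f n) x)%E]_n = (fun=> I%:E).
  apply/funext => n /=; rewrite -(fI n) /Rintegral fineK//.
  by apply: integrable_fin_num => //; exact: (Yd_integrable mu (mf n) (fB n)).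
move=> /(cvg_unique _ (cvg_cst _)) => h.
by have [] := h (@ereal_hausdorff R).
Qed.

End rotation_vector.

Theorem theorem2p1 (R : realType) (d : nat) (hd : (0 < d)%N)
    (b : 'rV[R]_d -> 'rV[R]_d) (hb : Ck_sharp 1 b)
    (hsigma0 : exists sigma0 : 'rV[R]_d -> R,
      [/\ L1_sharp sigma0,
          {ae lebesgue_rV d, forall x, 0 < sigma0 x},
          (\int[lebesgue_rV d]_(y in Yd) (sigma0 y)%:E = 1)%E &
          distr_div_free (fun x => sigma0 x *: b x)])
    (X : R -> 'rV[R]_d -> 'rV[R]_d) (hX : is_flow b X)
    (zeta : 'rV[R]_d) :
  Db b X = [set zeta] <->
  {ae lebesgue_rV d, forall x, Yd x ->
    (fun t : R => t^-1 *: X t x) @ +oo --> zeta}.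
Proof.
have [sigma0 [L1sigma sigma0_gt0 sigma0_mass sigma0_div]] := hsigma0.
split => [DE|cv]; last first.
  have [z Dz] := Db_nonempty hb hX L1sigma sigma0_gt0 sigma0_mass sigma0_div.
  apply/seteqP; split => [y /(flow_average_unique hb hX cv)//|_ ->].
  by rewrite -(flow_average_unique hb hX cv Dz).
(* Finitely many coordinates and signs and countably many slacks 1 / (k + 1): the union of the
   exceptional sets is still null. *)
have drift_ae : {ae lebesgue_rV d, forall x, forall i (s : bool) k, Yd x ->
    ~ drift_set X i ((-1) ^+ s) ((-1) ^+ s * zeta ord0 i + k.+1%:R^-1) x}.
  apply: filter_forall => i; apply: filter_forall => s; apply: ae_foralln => k.
  exists (drift_set X i ((-1) ^+ s) ((-1) ^+ s * zeta ord0 i + k.+1%:R^-1) `&` Yd); split.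
  - by apply: measurableI; [exact: (measurable_drift_set hb hX)|exact: measurable_Yd].
  - apply: (drift_set_null hb hX L1sigma sigma0_gt0 sigma0_mass sigma0_div) => z.
    by rewrite DE => ->; rewrite ltrDl invr_gt0.
  - by move=> x /not_implyP[Yx /contrapT].
by apply: filterS drift_ae => x h Yx; apply: (flow_average_cvg hb hX) => i s k; exact: h.
Qed.
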